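(* Let $(\Sigma,\mathbb I)$ be a monoidal theory. Then $\mathsf T_{\Sigma,\tilde{\mathbb I}}\cong\mathsf{Mat}\big(\downarrow(\mathrm{Pos}(\mathsf C_{\Sigma,\mathbb I}))\big)$ as poset-enriched finite biproduct rig categories.
   Context: Monoidal signature $(\mathcal S,\Sigma)$: sorts and generators with arity, coarity in $\mathcal S^\star$; $\mathsf C_\Sigma$ the free strict symmetric monoidal category (string diagrams). A monoidal theory $(\Sigma,\mathbb I)$ has $\mathbb I$ a set of pairs of arrows of $\mathsf C_\Sigma$ of equal type; $\mathsf C_{\Sigma,\mathbb I}$ is $\mathsf C_\Sigma$ with the preorder $\le_{\mathbb I}$ on homsets: the smallest reflexive, transitive relation containing $\mathbb I$ closed under $;$ and $\otimes$. For a preorder-enriched category $\mathsf C$, $\mathrm{Pos}(\mathsf C)$ is the poset-enriched category obtained by quotienting homsets by $\le\cap\ge$. For a preorder-enriched $\mathsf C$, $\downarrow(\mathsf C)$ has the same objects and as arrows $X\to Y$ the finitely generated downward-closed subsets of $\mathsf C[X,Y]$ (sets $\downarrow B=\{x\mid\exists b\in B,x\le b\}$ with $B$ finite), ordered by inclusion, with composition $\downarrow\{a;b\mid a\in S,b\in T\}$, addition union, zero the empty set, and monoidal product $\downarrow\{a\otimes b\mid a\in S,b\in T\}$. A finite biproduct (fb) category: symmetric monoidal $(\mathsf C,\oplus,0)$ with natural commutative monoids $\nabla_X,\mathsf i_X$ and cocommutative comonoids $\Delta_X,!_X$ coherent with $\oplus$. $\mathsf T_\Sigma$: the free strict fb category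 on the underlying category of $\mathsf C_\Sigma$ (objects polynomials $U_1\oplus\cdots\oplus U_n$, $U_i\in\mathcal S^\star$; arrows terms in $\mathrm{id}$, $\lceil c\rceil$, $\sigma^\oplus$, $\Delta,!,\nabla,\mathsf i$, $;$, $\oplus$ modulo fb laws, naturality w.r.t. $\lceil c\rceil$, $\lceil\mathrm{id}\rceil=\mathrm{id}$, $\lceil c;d\rceil=\lceil c\rceil;\lceil d\rceil$), with tensor $(\bigoplus_iU_i)\otimes(\bigoplus_jV_j)=\bigoplus_i\bigoplus_jU_iV_j$ and $t_1\otimes t_2=L_{P_1}(t_2);R_{Q_2}(t_1)$ where for a monomial $U$, $L_U,R_U$ preserve $;$, $\oplus$, $\mathrm{id}_0$, $L_U(\lceil c\rceil)=\lceil\mathrm{id}_U\otimes c\rceil$, $R_U(\lceil c\rceil)=\lceil c\otimes\mathrm{id}_U\rceil$, $L_U(\sigma^\oplus_{V,W})=\sigma^\oplus_{UV,UW}$, $R_U(\sigma^\oplus_{V,W})=\sigma^\oplus_{VU,WU}$, $L_U(\Delta_V)=\Delta_{UV}$, $R_U(\Delta_V)=\Delta_{VU}$ etc.; $L_0=R_0=\mathrm{id}_0$, $L_{W\oplus S'}(t)=L_W(t)\oplus L_{S'}(t)$, $R_{W\oplus S'}(t)=\delta^l_{P,W,S'};(R_W(t)\oplus R_{S'}(t));(\delta^l_{Q,W,S'})^{-1}$, $\delta^l_{0,Q,R}=\mathrm{id}_0$, $\delta^l_{U\oplus P',Q,R}=(\mathrm{id}\oplus\delta^l_{P',Q,R});(\mathrm{id}_{UQ}\oplus\sigma^\oplus_{UR,P'Q}\oplus\mathrm{id}_{P'R})$.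 $\tilde{\mathbb I}$ consists of the pairs $(\lceil c\rceil,\lceil d\rceil)$ for $(c,d)\in\mathbb I$ together with the inequalities, for every monomial $U$: $\mathrm{id}_0\le\mathsf i_U;!_U$, $!_U;\mathsf i_U\le\mathrm{id}_U$, $\mathrm{id}_U\oplus\mathrm{id}_U\le\nabla_U;\Delta_U$, $\Delta_U;\nabla_U\le\mathrm{id}_U$. $\mathsf T_{\Sigma,\tilde{\mathbb I}}=\mathrm{Pos}$ of $\mathsf T_\Sigma$ preordered by the smallest reflexive transitive relation containing $\tilde{\mathbb I}$ closed under $;$, $\oplus$, $\otimes$. For a commutative-monoid-enriched $\mathsf S$, $\mathsf{Mat}(\mathsf S)$ has objects formal sums $\bigoplus_iA_i$, arrows $\bigoplus_{i=1}^nA_i\to\bigoplus_{j=1}^mB_j$ the $m\times n$ matrices with $(j,i)$ entry in $\mathsf S[A_i,B_j]$, composition by matrix multiplication, $\oplus$ direct sum, $\otimes$ the Kronecker product $(M\circledast N)_{(i',j'),(i,j)}=M_{i'i}\otimes N_{j'j}$, and order entrywise. *)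

(* Defs.v *)
From Stdlib Require Import List RelationClasses.
Import ListNotations.

Set Implicit Arguments.
Unset Strict Implicit.
Unset Printing Implicit Defensive.

(** * Preorder-enriched categories and their structure

    Homsets are setoids: [eqv] is the equality of arrows, [le] the order.
    Composition is in diagrammatic order.  The records hold operations and the
    order laws that the constructions [pos], [down] and [mat] need; the
    equational axioms are the predicates [..._axioms] below. *)

Record ordcat := OrdCat {
  ob : Type;
  hom : ob -> ob -> Type;
  eqv : forall A B, hom A B -> hom A B -> Prop;
  le : forall A B, hom A B -> hom A B -> Prop;
  idm : forall A, hom A A;
  comp : forall A B C, hom A B -> hom B C -> hom A C;
  eqv_equiv : forall A B, Equivalence (@eqv A B);
  eqv_le : forall A B (f g : hom A B), eqv f g -> le f g;
  le_trans : forall A B (f g h : hom A B), le f g -> le g h -> le f h;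
  comp_le : forall A B C (f f' : hom A B) (g g' : hom B C),
    le f f' -> le g g' -> le (comp f g) (comp f' g')
}.
Arguments hom {C} A B : rename.
Arguments eqv {C A B} f g : rename.
Arguments le {C A B} f g : rename.
Arguments idm {C} A : rename.
Arguments comp {C A B D} f g : rename.

Lemma le_refl (C : ordcat) (A B : ob C) (f : hom A B) : le f f.
Proof. apply eqv_le; destruct (eqv_equiv A B) as [r _ _]; apply r. Qed.

(** Symmetric strict monoidal structure. *)
Record monoidal (C : ordcat) := Monoidal {
  unit_ob : ob C;
  tob : ob C -> ob C -> ob C;
  tenm : forall A B A' B' : ob C,
    hom A B -> hom A' B' -> hom (tob A A') (tob B B');
  braid : forall A B : ob C, hom (tob A B) (tob B A);
  tenm_le : forall (A B A' B' : ob C) (f f' : hom A B) (g g' : hom A' B'),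
    le f f' -> le g g' -> le (tenm f g) (tenm f' g')
}.
Arguments tob {C} m A B.
Arguments tenm {C} m {A B A' B'} f g.
Arguments braid {C} m A B.

(** Monoids and comonoids on every object. *)
Record biproduct (C : ordcat) (S : monoidal C) := Biproduct {
  diag : forall A : ob C, hom A (tob S A A);
  bang : forall A : ob C, hom A (unit_ob S);
  codiag : forall A : ob C, hom (tob S A A) A;
  cobang : forall A : ob C, hom (unit_ob S) A
}.
Arguments diag {C S} b A.
Arguments bang {C S} b A.
Arguments codiag {C S} b A.
Arguments cobang {C S} b A.

(** Right strict rig categories: both monoidal structures are strict and the
    right distributor and the annihilators are identities, so that the left
    distributor is the only distributor recorded. *)
Record fbrig := FbRig {
  rcat :> ordcat;
  rsum : monoidal rcat;
  rfb : biproduct rsum;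
  rprod : monoidal rcat;
  distl : forall A B C : ob rcat,
    hom (tob rprod A (tob rsum B C)) (tob rsum (tob rprod A B) (tob rprod A C))
}.
Arguments distl {R} A B C : rename.

(** ** Axioms

    Strictness identifies objects up to propositional equality only.  [heq]
    compares arrows with equal, not necessarily convertible, types; [hcomp]
    composes along an equality of objects. *)

Inductive heq (C : ordcat) (A B : ob C) (f : hom A B) :
  forall A' B' : ob C, hom A' B' -> Prop :=
| heq_intro : forall g : hom A B, eqv f g -> heq f g.

Definition hcomp (C : ordcat) (X Y Y' Z : ob C) (e : Y = Y')
    (f : hom X Y) (g : hom Y' Z) : hom X Z :=
  comp (eq_rect Y (fun W => hom X W) f Y' e) g.

Record poset_category_axioms (C : ordcat) : Prop := {
  le_antisym : forall (A B : ob C) (f g : hom A B),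
    le f g -> le g f -> eqv f g;
  comp_assoc : forall (A B D E : ob C) (f : hom A B) (g : hom B D) (h : hom D E),
    eqv (comp (comp f g) h) (comp f (comp g h));
  comp_idl : forall (A B : ob C) (f : hom A B), eqv (comp (idm A) f) f;
  comp_idr : forall (A B : ob C) (f : hom A B), eqv (comp f (idm B)) f
}.

Record monoidal_axioms (C : ordcat) (M : monoidal C) : Prop := {
  tob_assoc : forall A B D : ob C, tob M (tob M A B) D = tob M A (tob M B D);
  tob_unitl : forall A : ob C, tob M (unit_ob M) A = A;
  tob_unitr : forall A : ob C, tob M A (unit_ob M) = A;
  tenm_id : forall A B : ob C,
    eqv (tenm M (idm A) (idm B)) (idm (tob M A B));
  tenm_comp : forall (A B D A' B' D' : ob C) (f : hom A B) (g : hom B D)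
      (f' : hom A' B') (g' : hom B' D'),
    eqv (tenm M (comp f g) (comp f' g')) (comp (tenm M f f') (tenm M g g'));
  tenm_assoc : forall (A B A' B' A'' B'' : ob C)
      (f : hom A B) (g : hom A' B') (h : hom A'' B''),
    heq (tenm M (tenm M f g) h) (tenm M f (tenm M g h));
  tenm_unitl : forall (A B : ob C) (f : hom A B),
    heq (tenm M (idm (unit_ob M)) f) f;
  tenm_unitr : forall (A B : ob C) (f : hom A B),
    heq (tenm M f (idm (unit_ob M))) f;
  braid_nat : forall (A B A' B' : ob C) (f : hom A B) (g : hom A' B'),
    eqv (comp (tenm M f g) (braid M B B')) (comp (braid M A A') (tenm M g f));
  braid_inv : forall A B : ob C,
    eqv (comp (braid M A B) (braid M B A)) (idm (tob M A B));
  braid_hex : forall (A B D : ob C)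
      (e : tob M (tob M B A) D = tob M B (tob M A D)),
    heq (braid M A (tob M B D))
        (hcomp e (tenm M (braid M A B) (idm D)) (tenm M (idm B) (braid M A D)))
}.

Record biproduct_axioms (C : ordcat) (S : monoidal C) (F : biproduct S) : Prop := {
  diag_assoc : forall A : ob C,
    heq (comp (diag F A) (tenm S (diag F A) (idm A)))
        (comp (diag F A) (tenm S (idm A) (diag F A)));
  diag_unit : forall A : ob C,
    heq (comp (diag F A) (tenm S (bang F A) (idm A))) (idm A);
  diag_comm : forall A : ob C, eqv (comp (diag F A) (braid S A A)) (diag F A);
  codiag_assoc : forall A : ob C,
    heq (comp (tenm S (codiag F A) (idm A)) (codiag F A))
        (comp (tenm S (idm A) (codiag F A)) (codiag F A));
  codiag_unit : forall A : ob C,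
    heq (comp (tenm S (cobang F A) (idm A)) (codiag F A)) (idm A);
  codiag_comm : forall A : ob C,
    eqv (comp (braid S A A) (codiag F A)) (codiag F A);
  diag_nat : forall (A B : ob C) (f : hom A B),
    eqv (comp f (diag F B)) (comp (diag F A) (tenm S f f));
  bang_nat : forall (A B : ob C) (f : hom A B),
    eqv (comp f (bang F B)) (bang F A);
  codiag_nat : forall (A B : ob C) (f : hom A B),
    eqv (comp (codiag F A) f) (comp (tenm S f f) (codiag F B));
  cobang_nat : forall (A B : ob C) (f : hom A B),
    eqv (comp (cobang F A) f) (cobang F B);
  diag_sum : forall (A B : ob C)
      (e : tob S (tob S A A) (tob S B B) = tob S (tob S A (tob S A B)) B),
    heq (diag F (tob S A B))
        (hcomp e (tenm S (diag F A) (diag F B))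
                 (tenm S (tenm S (idm A) (braid S A B)) (idm B)));
  bang_sum : forall A B : ob C,
    heq (bang F (tob S A B)) (tenm S (bang F A) (bang F B));
  codiag_sum : forall (A B : ob C)
      (e : tob S (tob S A (tob S A B)) B = tob S (tob S A A) (tob S B B)),
    heq (codiag F (tob S A B))
        (hcomp e (tenm S (tenm S (idm A) (braid S B A)) (idm B))
                 (tenm S (codiag F A) (codiag F B)));
  cobang_sum : forall A B : ob C,
    heq (cobang F (tob S A B)) (tenm S (cobang F A) (cobang F B));
  diag_zero : heq (diag F (unit_ob S)) (idm (unit_ob S));
  bang_zero : eqv (bang F (unit_ob S)) (idm (unit_ob S));
  codiag_zero : heq (codiag F (unit_ob S)) (idm (unit_ob S));
  cobang_zero : eqv (cobang F (unit_ob S)) (idm (unit_ob S))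
}.

(** Laplaza's coherence axioms; those all of whose edges are identities in the
    right strict case are omitted. *)
Record distributivity_axioms (R : fbrig) : Prop := {
  distr_ob : forall A B D : ob R,
    tob (rprod R) (tob (rsum R) A B) D
    = tob (rsum R) (tob (rprod R) A D) (tob (rprod R) B D);
  annl_ob : forall A : ob R,
    tob (rprod R) (unit_ob (rsum R)) A = unit_ob (rsum R);
  annr_ob : forall A : ob R,
    tob (rprod R) A (unit_ob (rsum R)) = unit_ob (rsum R);
  distr_nat : forall (A A' B B' D D' : ob R)
      (f : hom A A') (g : hom B B') (h : hom D D'),
    heq (tenm (rprod R) (tenm (rsum R) f g) h)
        (tenm (rsum R) (tenm (rprod R) f h) (tenm (rprod R) g h));
  annl_nat : forall (A B : ob R) (f : hom A B),
    heq (tenm (rprod R) (idm (unit_ob (rsum R))) f) (idm (unit_ob (rsum R)));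
  annr_nat : forall (A B : ob R) (f : hom A B),
    heq (tenm (rprod R) f (idm (unit_ob (rsum R)))) (idm (unit_ob (rsum R)));
  distl_nat : forall (A A' B B' D D' : ob R)
      (f : hom A A') (g : hom B B') (h : hom D D'),
    eqv (comp (tenm (rprod R) f (tenm (rsum R) g h)) (distl A' B' D'))
        (comp (distl A B D)
              (tenm (rsum R) (tenm (rprod R) f g) (tenm (rprod R) f h)));
  distl_iso : forall A B D : ob R, exists g,
    eqv (comp (distl A B D) g) (idm _) /\ eqv (comp g (distl A B D)) (idm _);
  distl_braid_sum : forall A B D : ob R,
    eqv (comp (distl A B D) (braid (rsum R) (tob (rprod R) A B) (tob (rprod R) A D)))
        (comp (tenm (rprod R) (idm A) (braid (rsum R) B D)) (distl A D B));
  distr_braid_sum : forall A B D : ob R,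
    heq (tenm (rprod R) (braid (rsum R) A B) (idm D))
        (braid (rsum R) (tob (rprod R) A D) (tob (rprod R) B D));
  dist_braid_prod : forall A B D : ob R,
    heq (tenm (rsum R) (braid (rprod R) A D) (braid (rprod R) B D))
        (comp (braid (rprod R) (tob (rsum R) A B) D) (distl D A B));
  distl_sum : forall A B D E : ob R,
    heq (comp (distl A B (tob (rsum R) D E))
              (tenm (rsum R) (idm (tob (rprod R) A B)) (distl A D E)))
        (comp (distl A (tob (rsum R) B D) E)
              (tenm (rsum R) (distl A B D) (idm (tob (rprod R) A E))));
  distl_prod : forall A B D E : ob R,
    heq (distl (tob (rprod R) A B) D E)
        (comp (tenm (rprod R) (idm A) (distl B D E))
              (distl A (tob (rprod R) B D) (tob (rprod R) B E)));
  distl_distr_prod : forall A B D E : ob R,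
    heq (tenm (rprod R) (distl A B D) (idm E))
        (distl A (tob (rprod R) B E) (tob (rprod R) D E));
  distl_distr_sum : forall (A B D E : ob R)
      (e : tob (rsum R) (tob (rsum R) (tob (rprod R) A D) (tob (rprod R) A E))
                        (tob (rsum R) (tob (rprod R) B D) (tob (rprod R) B E))
         = tob (rsum R)
             (tob (rsum R) (tob (rprod R) A D)
                           (tob (rsum R) (tob (rprod R) A E) (tob (rprod R) B D)))
             (tob (rprod R) B E)),
    heq (distl (tob (rsum R) A B) D E)
        (hcomp e
           (tenm (rsum R) (distl A D E) (distl B D E))
           (tenm (rsum R)
              (tenm (rsum R) (idm (tob (rprod R) A D))
                 (braid (rsum R) (tob (rprod R) A E) (tob (rprod R) B D)))
              (idm (tob (rprod R) B E))));
  distl_zero : forall A B : ob R,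
    heq (distl (unit_ob (rsum R)) A B) (idm (unit_ob (rsum R)));
  distl_zerol : forall A B : ob R,
    heq (distl A (unit_ob (rsum R)) B) (idm (tob (rprod R) A B));
  distl_zeror : forall A B : ob R,
    heq (distl A B (unit_ob (rsum R))) (idm (tob (rprod R) A B));
  distl_one : forall A B : ob R,
    heq (distl (unit_ob (rprod R)) A B) (idm (tob (rsum R) A B));
  braid_prod_zero : forall A : ob R,
    heq (braid (rprod R) A (unit_ob (rsum R))) (idm (unit_ob (rsum R)))
}.

Record poset_fbrig_axioms (R : fbrig) : Prop := {
  fbrig_category : poset_category_axioms R;
  fbrig_sum : monoidal_axioms (rsum R);
  fbrig_biproduct : biproduct_axioms (rfb R);
  fbrig_prod : monoidal_axioms (rprod R);
  fbrig_distributivity : distributivity_axioms R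
}.

(** ** Strict morphisms and isomorphisms *)

Record preserves_monoidal (C D : ordcat) (M : monoidal C) (N : monoidal D)
    (F : ob C -> ob D)
    (Fm : forall A B : ob C, hom A B -> hom (F A) (F B)) : Prop := {
  pres_unit : F (unit_ob M) = unit_ob N;
  pres_tob : forall A B : ob C, F (tob M A B) = tob N (F A) (F B);
  pres_tenm : forall (A B A' B' : ob C) (f : hom A B) (g : hom A' B'),
    heq (Fm _ _ (tenm M f g)) (tenm N (Fm _ _ f) (Fm _ _ g));
  pres_braid : forall A B : ob C,
    heq (Fm _ _ (braid M A B)) (braid N (F A) (F B))
}.

Record fbrig_functor (R T : fbrig) := FbRigFunctor {
  fob : ob R -> ob T;
  fhom : forall A B : ob R, hom A B -> hom (fob A) (fob B);
  fhom_le : forall (A B : ob R) (f g : hom A B), le f g -> le (fhom f) (fhom g);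
  fhom_eqv : forall (A B : ob R) (f g : hom A B),
    eqv f g -> eqv (fhom f) (fhom g);
  fhom_id : forall A : ob R, eqv (fhom (idm A)) (idm (fob A));
  fhom_comp : forall (A B D : ob R) (f : hom A B) (g : hom B D),
    eqv (fhom (comp f g)) (comp (fhom f) (fhom g));
  fhom_sum : preserves_monoidal (rsum R) (rsum T) fhom;
  fhom_prod : preserves_monoidal (rprod R) (rprod T) fhom;
  fhom_diag : forall A : ob R, heq (fhom (diag (rfb R) A)) (diag (rfb T) (fob A));
  fhom_bang : forall A : ob R, heq (fhom (bang (rfb R) A)) (bang (rfb T) (fob A));
  fhom_codiag : forall A : ob R,
    heq (fhom (codiag (rfb R) A)) (codiag (rfb T) (fob A));
  fhom_cobang : forall A : ob R,
    heq (fhom (cobang (rfb R) A)) (cobang (rfb T) (fob A));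
  fhom_distl : forall A B D : ob R,
    heq (fhom (distl A B D)) (distl (fob A) (fob B) (fob D))
}.
Arguments fhom {R T} F {A B} f : rename.

Record fbrig_iso (R T : fbrig) := FbRigIso {
  iso_fwd : fbrig_functor R T;
  iso_bwd : fbrig_functor T R;
  iso_fwdK_ob : forall A : ob R, fob iso_bwd (fob iso_fwd A) = A;
  iso_fwdK : forall (A B : ob R) (f : hom A B),
    heq (fhom iso_bwd (fhom iso_fwd f)) f;
  iso_bwdK_ob : forall A : ob T, fob iso_fwd (fob iso_bwd A) = A;
  iso_bwdK : forall (A B : ob T) (f : hom A B),
    heq (fhom iso_fwd (fhom iso_bwd f)) f
}.

(** * Pos: the quotient of homsets by [le] and its converse *)

Lemma pos_equiv (C : ordcat) (A B : ob C) :
  Equivalence (fun f g : hom A B => le f g /\ le g f).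
Proof.
split.
- intros f; split; apply le_refl.
- intros f g [h1 h2]; split; assumption.
- intros f g h [h1 h2] [h3 h4]; split; eapply le_trans; eassumption.
Qed.

Definition pos (C : ordcat) : ordcat :=
  @OrdCat (ob C) (@hom C) (fun A B f g => le f g /\ le g f) (@le C)
    (@idm C) (@comp C) (@pos_equiv C) (fun A B f g h => proj1 h)
    (@le_trans C) (@comp_le C).

Definition pos_monoidal (C : ordcat) (M : monoidal C) : monoidal (pos C) :=
  @Monoidal (pos C) (unit_ob M) (tob M) (@tenm C M) (braid M) (@tenm_le C M).

Definition pos_fbrig (R : fbrig) : fbrig :=
  @FbRig (pos R) (pos_monoidal (rsum R))
    (@Biproduct (pos R) (pos_monoidal (rsum R)) (diag (rfb R)) (bang (rfb R))
      (codiag (rfb R)) (cobang (rfb R)))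
    (pos_monoidal (rprod R)) (@distl R).

(** * Finitely generated downward closed sets of arrows *)

(** A monoidal preorder-enriched category whose homsets carry an addition. *)
Record cmoncat := CMonCat {
  ccat :> ordcat;
  cprod : monoidal ccat;
  add : forall A B : ob ccat, hom A B -> hom A B -> hom A B;
  zero : forall A B : ob ccat, hom A B;
  add_le : forall (A B : ob ccat) (f f' g g' : hom A B),
    le f f' -> le g g' -> le (add f g) (add f' g')
}.
Arguments add {C A B} f g : rename.
Arguments zero {C A B} : rename.

Section Down.
Context (C : ordcat) (M : monoidal C).

Definition downset (A B : ob C) (P : hom A B -> Prop) (f : hom A B) : Prop :=
  exists2 b, P b & le f b.

Definition fin_gen (A B : ob C) (S : hom A B -> Prop) : Prop :=
  exists L : list (hom A B), forall f, S f <-> downset (fun b => In b L) f.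

Record dhom (A B : ob C) := DHom { dset :> hom A B -> Prop; dset_fg : fin_gen dset }.

Lemma fg_principal (A B : ob C) (f : hom A B) : fin_gen (downset (eq f)).
Proof.
exists [f]; intros g; split; intros [b hb hg]; exists b; trivial.
- left; exact hb.
- destruct hb as [hb | []]; exact hb.
Qed.

Definition dprincipal (A B : ob C) (f : hom A B) : dhom A B := DHom (fg_principal f).

Lemma fg_image2 (A B A' B' A'' B'' : ob C)
    (op : hom A B -> hom A' B' -> hom A'' B'')
    (op_le : forall f f' g g', le f f' -> le g g' -> le (op f g) (op f' g'))
    (S : dhom A B) (T : dhom A' B') :
  fin_gen (downset (fun f => exists a b, S a /\ T b /\ f = op a b)).
Proof.
destruct S as [S [LS hS]], T as [T [LT hT]]; simpl.
exists (map (fun p => op (fst p) (snd p)) (list_prod LS LT)).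
intros f; split; intros [b hb hf].
- destruct hb as [x [y [hx [hy ->]]]].
  apply hS in hx; apply hT in hy.
  destruct hx as [x' hx' lx], hy as [y' hy' ly].
  exists (op x' y').
  + apply in_map_iff; exists (x', y'); split; trivial; apply in_prod; trivial.
  + eapply le_trans; [exact hf | apply op_le; trivial].
- apply in_map_iff in hb; destruct hb as [[x y] [<- hxy]]; simpl in *.
  apply in_prod_iff in hxy; destruct hxy as [hx hy].
  exists (op x y); trivial; exists x, y; split; [|split]; trivial.
  + apply hS; exists x; trivial; apply le_refl.
  + apply hT; exists y; trivial; apply le_refl.
Qed.

Lemma fg_union (A B : ob C) (S T : dhom A B) : fin_gen (fun f => S f \/ T f).
Proof.
destruct S as [S [LS hS]], T as [T [LT hT]]; simpl.
exists (LS ++ LT); intros f; split.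
- intros [h | h]; [apply hS in h | apply hT in h]; destruct h as [b hb hf];
    exists b; trivial; apply in_or_app; auto.
- intros [b hb hf]; apply in_app_or in hb; destruct hb as [hb | hb];
    [left; apply hS | right; apply hT]; exists b; trivial.
Qed.

Lemma fg_empty (A B : ob C) : fin_gen (fun _ : hom A B => False).
Proof. exists []; intros f; split; [intros [] | intros [b [] _]]. Qed.

Definition dcomp (A B D : ob C) (S : dhom A B) (T : dhom B D) : dhom A D :=
  DHom (@fg_image2 _ _ _ _ _ _ (@comp C A B D) (@comp_le C A B D) S T).

Definition dten (A B A' B' : ob C) (S : dhom A B) (T : dhom A' B') :
    dhom (tob M A A') (tob M B B') :=
  DHom (@fg_image2 _ _ _ _ _ _ (@tenm C M A B A' B') (@tenm_le C M A B A' B') S T).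

Definition dadd (A B : ob C) (S T : dhom A B) : dhom A B := DHom (fg_union S T).

Definition dzero (A B : ob C) : dhom A B := DHom (@fg_empty A B).

Lemma down_equiv (A B : ob C) :
  Equivalence (fun S T : dhom A B => forall f, S f <-> T f).
Proof.
split.
- intros S f; reflexivity.
- intros S T h f; symmetry; apply h.
- intros S T V h1 h2 f; rewrite (h1 f); apply h2.
Qed.

Definition down_cat : ordcat.
Proof.
refine (@OrdCat (ob C) dhom
  (fun A B S T => forall f, S f <-> T f)
  (fun A B S T => forall f, S f -> T f)
  (fun A => dprincipal (idm A)) dcomp down_equiv _ _ _).
- intros A B S T h f; apply h.
- intros A B S T V h1 h2 f h; apply h2, h1, h.
- intros A B D S S' T T' h1 h2 f [g [x [y [hx [hy e]]]] hf].
  exists g; trivial; exists x, y; auto.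
Defined.

Definition down_monoidal : monoidal down_cat.
Proof.
refine (@Monoidal down_cat (unit_ob M) (tob M) dten
  (fun A B => dprincipal (braid M A B)) _).
intros A B D E S S' T T' h1 h2 f [g [x [y [hx [hy e]]]] hf].
exists g; trivial; exists x, y; auto.
Defined.

Definition down : cmoncat.
Proof.
refine (@CMonCat down_cat down_monoidal dadd dzero _).
intros A B S S' T T' h1 h2 f [h | h]; [left; apply h1 | right; apply h2]; exact h.
Defined.

End Down.

(** * Matrices *)

(** [occ l x] is the type of positions of [l] at which the entry is [x]. *)
Fixpoint occ (X : Type) (l : list X) (x : X) : Type :=
  match l with
  | [] => Empty_set
  | y :: l' => ((y = x) + occ l' x)%type
  end.

Fixpoint occ_same (X : Type) (l : list X) (x y : X) :
    occ l x -> occ l y -> option (x = y) :=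
  match l return occ l x -> occ l y -> option (x = y) with
  | [] => fun p _ => match p with end
  | z :: l' => fun p q =>
      match p, q with
      | inl e, inl e' => Some (eq_trans (eq_sym e) e')
      | inr p', inr q' => occ_same p' q'
      | _, _ => None
      end
  end.

Fixpoint occ_enum (X : Type) (l : list X) : list {x : X & occ l x} :=
  match l return list {x : X & occ l x} with
  | [] => []
  | y :: l' =>
      existT (occ (y :: l')) y (inl eq_refl)
      :: map (fun s => existT (occ (y :: l')) (projT1 s) (inr (projT2 s)))
             (occ_enum l')
  end.

Fixpoint occ_left (X : Type) (l l' : list X) (x : X) : occ l x -> occ (l ++ l') x :=
  match l return occ l x -> occ (l ++ l') x with
  | [] => fun p => match p with end
  | y :: k => fun p =>
      match p with inl e => inl e | inr p' => inr (occ_left l' p') end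
  end.

Fixpoint occ_right (X : Type) (l l' : list X) (x : X) (p : occ l' x) :
    occ (l ++ l') x :=
  match l return occ (l ++ l') x with
  | [] => p
  | y :: k => inr (occ_right k p)
  end.

Fixpoint occ_split (X : Type) (l l' : list X) (x : X) :
    occ (l ++ l') x -> (occ l x + occ l' x)%type :=
  match l return occ (l ++ l') x -> (occ l x + occ l' x)%type with
  | [] => fun p => inr p
  | y :: k => fun p =>
      match p with
      | inl e => inl (inl e)
      | inr p' =>
          match occ_split p' with inl q => inl (inr q) | inr q => inr q end
      end
  end.

(** [list_mul op [x1; ..; xn] [y1; ..; ym]] lists the [op xi yj] in
    lexicographic order of [(i, j)]. *)
Definition list_mul (X : Type) (op : X -> X -> X) (l l' : list X) : list X :=
  flat_map (fun x => map (op x) l') l.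

Inductive map_occ (X Y : Type) (f : X -> Y) (l : list X) : Y -> Type :=
| MapOcc : forall x, occ l x -> map_occ f l (f x).
Arguments MapOcc {X Y f l} x p.

Fixpoint occ_unmap (X Y : Type) (f : X -> Y) (l : list X) (y : Y) :
    occ (map f l) y -> map_occ f l y :=
  match l return occ (map f l) y -> map_occ f l y with
  | [] => fun p => match p with end
  | x :: l' => fun p =>
      match p with
      | inl e => match e in _ = y return map_occ f (x :: l') y with
                 | eq_refl => @MapOcc _ _ f (x :: l') x (inl eq_refl)
                 end
      | inr p' => match occ_unmap p' in map_occ _ _ y
                        return map_occ f (x :: l') y with
                  | MapOcc _ q => @MapOcc _ _ f (x :: l') _ (inr q)
                  end
      end
  end.

Fixpoint occ_map (X Y : Type) (f : X -> Y) (l : list X) (x : X) :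
    occ l x -> occ (map f l) (f x) :=
  match l return occ l x -> occ (map f l) (f x) with
  | [] => fun p => match p with end
  | y :: l' => fun p =>
      match p with inl e => inl (f_equal f e) | inr q => inr (occ_map f q) end
  end.

(** A position of [list_mul op l l'] is a pair of positions. *)
Inductive mul_occ (X : Type) (op : X -> X -> X) (l l' : list X) : X -> Type :=
| MulOcc : forall x y, occ l x -> occ l' y -> mul_occ op l l' (op x y).
Arguments MulOcc {X op l l'} x y p q.

Fixpoint occ_unpair (X : Type) (op : X -> X -> X) (l l' : list X) (z : X) :
    occ (list_mul op l l') z -> mul_occ op l l' z :=
  match l return occ (list_mul op l l') z -> mul_occ op l l' z with
  | [] => fun p => match p with end
  | x :: k => fun p =>
      match @occ_split _ (map (op x) l') (list_mul op k l') z p with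
      | inl q => match occ_unmap q in map_occ _ _ z
                       return mul_occ op (x :: k) l' z with
                 | MapOcc _ r => @MulOcc _ op (x :: k) l' _ _ (inl eq_refl) r
                 end
      | inr q => match occ_unpair q in mul_occ _ _ _ z
                       return mul_occ op (x :: k) l' z with
                 | MulOcc _ _ r s => @MulOcc _ op (x :: k) l' _ _ (inr r) s
                 end
      end
  end.

Fixpoint occ_pair (X : Type) (op : X -> X -> X) (l l' : list X) (x y : X) :
    occ l x -> occ l' y -> occ (list_mul op l l') (op x y) :=
  match l return occ l x -> occ l' y -> occ (list_mul op l l') (op x y) with
  | [] => fun p _ => match p with end
  | z :: k => fun p q =>
      match p with
      | inl e => match e in _ = x return occ (list_mul op (z :: k) l') (op x y) with
                 | eq_refl => occ_left (list_mul op k l') (occ_map (op z) q)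
                 end
      | inr p' => occ_right (map (op z) l') (occ_pair op p' q)
      end
  end.

Section Mat.
Context (S : cmoncat).

Local Notation obj := (list (ob S)).
Local Notation mulp := (list_mul (tob (cprod S))).

(** The entry of [M] at the positions [p] of [A] and [q] of [B] is the entry in
    column [p] and row [q] of the matrix. *)
Definition mhom (A B : obj) : Type :=
  forall a b : ob S, occ A a -> occ B b -> hom a b.

(** An arrow [f : a -> b] at the position [p] of column [a], zero elsewhere. *)
Definition entry_at (B : obj) (a b c : ob S) (p : occ B b) (f : hom a b)
    (q : occ B c) : hom a c :=
  match occ_same p q with
  | Some e => eq_rect b (fun x => hom a x) f c e
  | None => zero
  end.

Definition mid (A : obj) : mhom A A := fun a b p q => entry_at p (idm a) q.

(** The 0-1 matrix of a label-preserving map of positions. *)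
Definition mfun (A B : obj) (phi : forall a, occ A a -> occ B a) : mhom A B :=
  fun a b p q => entry_at (phi a p) (idm a) q.

Definition mcomp (A B D : obj) (M : mhom A B) (N : mhom B D) : mhom A D :=
  fun a d p q =>
    fold_right add zero
      (map (fun s => comp (M _ _ p (projT2 s)) (N _ _ (projT2 s) q)) (occ_enum B)).

Definition msum (A B A' B' : obj) (M : mhom A B) (N : mhom A' B') :
    mhom (A ++ A') (B ++ B') :=
  fun a b p q =>
    match occ_split p, occ_split q with
    | inl p', inl q' => M _ _ p' q'
    | inr p', inr q' => N _ _ p' q'
    | _, _ => zero
    end.

Definition msum_braid (A B : obj) : mhom (A ++ B) (B ++ A) :=
  mfun (fun a p => match occ_split p with
                   | inl p' => occ_right B p'
                   | inr p' => occ_left A p'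
                   end).

Definition mdiag (A : obj) : mhom A (A ++ A) :=
  fun a b p q => match occ_split q with
                 | inl q' => mid p q'
                 | inr q' => mid p q'
                 end.

Definition mcodiag (A : obj) : mhom (A ++ A) A :=
  fun a b p q => match occ_split p with
                 | inl p' => mid p' q
                 | inr p' => mid p' q
                 end.

Definition mzero (A B : obj) : mhom A B := fun _ _ _ _ => zero.
Arguments mzero A B : clear implicits.

(** Kronecker product. *)
Definition mprod (A B A' B' : obj) (M : mhom A B) (N : mhom A' B') :
    mhom (mulp A A') (mulp B B') :=
  fun x y p q =>
    match occ_unpair p in mul_occ _ _ _ x, occ_unpair q in mul_occ _ _ _ y
      return hom x y with
    | MulOcc _ _ i j, MulOcc _ _ i' j' => tenm (cprod S) (M _ _ i i') (N _ _ j j')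
    end.

Definition mprod_braid (A B : obj) : mhom (mulp A B) (mulp B A) :=
  fun x y p q =>
    match occ_unpair p in mul_occ _ _ _ x return hom x y with
    | MulOcc a b i j =>
        entry_at (occ_pair (tob (cprod S)) j i) (braid (cprod S) a b) q
    end.

Definition mdistl (A B D : obj) :
    mhom (mulp A (B ++ D)) (mulp A B ++ mulp A D) :=
  mfun (fun x p =>
    match occ_unpair p in mul_occ _ _ _ x return occ (mulp A B ++ mulp A D) x with
    | MulOcc _ _ i j =>
        match occ_split j with
        | inl j' => occ_left (mulp A D) (occ_pair (tob (cprod S)) i j')
        | inr j' => occ_right (mulp A B) (occ_pair (tob (cprod S)) i j')
        end
    end).

Definition meqv (A B : obj) (M N : mhom A B) : Prop :=
  forall a b (p : occ A a) (q : occ B b), eqv (M a b p q) (N a b p q).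

Definition mle (A B : obj) (M N : mhom A B) : Prop :=
  forall a b (p : occ A a) (q : occ B b), le (M a b p q) (N a b p q).

Lemma meqv_equiv (A B : obj) : Equivalence (@meqv A B).
Proof.
split.
- intros M a b p q; destruct (@eqv_equiv S a b) as [r _ _]; apply r.
- intros M N h a b p q; destruct (@eqv_equiv S a b) as [_ s _]; apply s, h.
- intros M N P h1 h2 a b p q; destruct (@eqv_equiv S a b) as [_ _ t];
    eapply t; [apply h1 | apply h2].
Qed.

Definition mat_cat : ordcat.
Proof.
refine (@OrdCat obj mhom meqv mle mid mcomp meqv_equiv _ _ _).
- intros A B M N h a b p q; apply eqv_le, h.
- intros A B M N P h1 h2 a b p q; eapply le_trans; [apply h1 | apply h2].
- intros A B D M M' N N' h1 h2 a d p q; unfold mcomp.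
  induction (occ_enum B) as [|s L IH]; simpl.
  + apply le_refl.
  + apply add_le; [apply comp_le; [apply h1 | apply h2] | exact IH].
Defined.

Definition mat_sum : monoidal mat_cat.
Proof.
refine (@Monoidal mat_cat [] (@app (ob S)) msum msum_braid _).
intros A B A' B' M M' N N' h1 h2 a b p q; simpl; unfold msum.
destruct (occ_split p), (occ_split q); try apply le_refl; [apply h1 | apply h2].
Defined.

Definition mat_prod : monoidal mat_cat.
Proof.
refine (@Monoidal mat_cat [unit_ob (cprod S)] mulp mprod mprod_braid _).
intros A B A' B' M M' N N' h1 h2 x y p q; simpl; unfold mprod.
destruct (occ_unpair p), (occ_unpair q); apply tenm_le; [apply h1 | apply h2].
Defined.

Definition mat_biproduct : biproduct mat_sum :=
  @Biproduct mat_cat mat_sum mdiag (fun A => mzero A []) mcodiag (fun A => mzero [] A).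

Definition mat : fbrig := @FbRig mat_cat mat_sum mat_biproduct mat_prod mdistl.

End Mat.

(** * Monoidal signatures and string diagrams *)

Record signature := Signature {
  sort : Type;
  gen : Type;
  arity : gen -> list sort;
  coarity : gen -> list sort
}.

Section Diagrams.
Context (Sg : signature).

Local Notation word := (list (sort Sg)).
Local Notation poly := (list word).

(** Diagrams and tapes are untyped terms with a typing relation, so that the
    strictness laws relate terms of literally the same type. *)
Inductive cterm : Type :=
| cid : word -> cterm
| cgen : gen Sg -> cterm
| csym : word -> word -> cterm
| ccomp : cterm -> cterm -> cterm
| cten : cterm -> cterm -> cterm.

Inductive ctyped : cterm -> word -> word -> Prop :=
| ctyped_id U : ctyped (cid U) U U
| ctyped_gen g : ctyped (cgen g) (arity g) (coarity g)
| ctyped_sym U V : ctyped (csym U V) (U ++ V) (V ++ U)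
| ctyped_comp c d U V W :
    ctyped c U V -> ctyped d V W -> ctyped (ccomp c d) U W
| ctyped_ten c d U V U' V' :
    ctyped c U V -> ctyped d U' V' -> ctyped (cten c d) (U ++ U') (V ++ V').

(** Equality of the free strict symmetric monoidal category. *)
Inductive ceq : word -> word -> cterm -> cterm -> Prop :=
| ceq_refl U V c : ctyped c U V -> ceq U V c c
| ceq_sym U V c d : ceq U V c d -> ceq U V d c
| ceq_trans U V c d e : ceq U V c d -> ceq U V d e -> ceq U V c e
| ceq_comp U V W c c' d d' :
    ceq U V c c' -> ceq V W d d' -> ceq U W (ccomp c d) (ccomp c' d')
| ceq_ten U V U' V' c c' d d' :
    ceq U V c c' -> ceq U' V' d d' ->
    ceq (U ++ U') (V ++ V') (cten c d) (cten c' d')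
| ceq_assoc U V W X a b c :
    ctyped a U V -> ctyped b V W -> ctyped c W X ->
    ceq U X (ccomp (ccomp a b) c) (ccomp a (ccomp b c))
| ceq_idl U V c : ctyped c U V -> ceq U V (ccomp (cid U) c) c
| ceq_idr U V c : ctyped c U V -> ceq U V (ccomp c (cid V)) c
| ceq_ten_id U V : ceq (U ++ V) (U ++ V) (cten (cid U) (cid V)) (cid (U ++ V))
| ceq_interchange U V W U' V' W' a b a' b' :
    ctyped a U V -> ctyped b V W -> ctyped a' U' V' -> ctyped b' V' W' ->
    ceq (U ++ U') (W ++ W')
      (cten (ccomp a b) (ccomp a' b')) (ccomp (cten a a') (cten b b'))
| ceq_ten_assoc U V U' V' U'' V'' a b c :
    ctyped a U V -> ctyped b U' V' -> ctyped c U'' V'' ->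
    ceq (U ++ U' ++ U'') (V ++ V' ++ V'')
      (cten (cten a b) c) (cten a (cten b c))
| ceq_unitl U V c : ctyped c U V -> ceq U V (cten (cid []) c) c
| ceq_unitr U V c : ctyped c U V -> ceq U V (cten c (cid [])) c
| ceq_sym_nat U V U' V' c d :
    ctyped c U V -> ctyped d U' V' ->
    ceq (U ++ U') (V' ++ V)
      (ccomp (cten c d) (csym V V')) (ccomp (csym U U') (cten d c))
| ceq_sym_inv U V :
    ceq (U ++ V) (U ++ V) (ccomp (csym U V) (csym V U)) (cid (U ++ V))
| ceq_sym_hex U V W :
    ceq (U ++ V ++ W) ((V ++ W) ++ U)
      (csym U (V ++ W))
      (ccomp (cten (csym U V) (cid W)) (cten (cid V) (csym U W))).

Record chom (U V : word) := CHom { chom_term :> cterm; chom_typed : ctyped chom_term U V }.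

Definition chom_id (U : word) : chom U U := CHom (ctyped_id U).
Definition chom_sym (U V : word) : chom (U ++ V) (V ++ U) := CHom (ctyped_sym U V).
Definition chom_comp (U V W : word) (c : chom U V) (d : chom V W) : chom U W :=
  CHom (ctyped_comp (chom_typed c) (chom_typed d)).
Definition chom_ten (U V U' V' : word) (c : chom U V) (d : chom U' V') :
    chom (U ++ U') (V ++ V') :=
  CHom (ctyped_ten (chom_typed c) (chom_typed d)).

(** * Tapes *)

Inductive tape : Type :=
| tid0 : tape
| tidm : word -> tape
| tbox : cterm -> tape
| tswap : word -> word -> tape
| tdiag : word -> tape
| tbang : word -> tape
| tcodiag : word -> tape
| tcobang : word -> tape
| tcomp : tape -> tape -> tape
| tsum : tape -> tape -> tape.

Inductive ttyped : tape -> poly -> poly -> Prop :=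
| ttyped_id0 : ttyped tid0 [] []
| ttyped_idm U : ttyped (tidm U) [U] [U]
| ttyped_box c U V : ctyped c U V -> ttyped (tbox c) [U] [V]
| ttyped_swap U V : ttyped (tswap U V) [U; V] [V; U]
| ttyped_diag U : ttyped (tdiag U) [U] [U; U]
| ttyped_bang U : ttyped (tbang U) [U] []
| ttyped_codiag U : ttyped (tcodiag U) [U; U] [U]
| ttyped_cobang U : ttyped (tcobang U) [] [U]
| ttyped_comp s t P Q R : ttyped s P Q -> ttyped t Q R -> ttyped (tcomp s t) P R
| ttyped_sum s t P Q P' Q' :
    ttyped s P Q -> ttyped t P' Q' -> ttyped (tsum s t) (P ++ P') (Q ++ Q').

(** Structural arrows on polynomials, by coherence from those on monomials. *)

Fixpoint tid (P : poly) : tape :=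
  match P with
  | [] => tid0
  | U :: P' => tsum (tidm U) (tid P')
  end.

Fixpoint tswapm (U : word) (Q : poly) : tape :=
  match Q with
  | [] => tidm U
  | V :: Q' => tcomp (tsum (tswap U V) (tid Q')) (tsum (tidm V) (tswapm U Q'))
  end.

Fixpoint tbraid (P Q : poly) : tape :=
  match P with
  | [] => tid Q
  | U :: P' => tcomp (tsum (tidm U) (tbraid P' Q)) (tsum (tswapm U Q) (tid P'))
  end.

Fixpoint tdiagp (P : poly) : tape :=
  match P with
  | [] => tid0
  | U :: P' => tcomp (tsum (tdiag U) (tdiagp P'))
                     (tsum (tidm U) (tsum (tbraid [U] P') (tid P')))
  end.

Fixpoint tbangp (P : poly) : tape :=
  match P with [] => tid0 | U :: P' => tsum (tbang U) (tbangp P') end.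

Fixpoint tcodiagp (P : poly) : tape :=
  match P with
  | [] => tid0
  | U :: P' => tcomp (tsum (tidm U) (tsum (tbraid P' [U]) (tid P')))
                     (tsum (tcodiag U) (tcodiagp P'))
  end.

Fixpoint tcobangp (P : poly) : tape :=
  match P with [] => tid0 | U :: P' => tsum (tcobang U) (tcobangp P') end.

(** Equality of the free strict fb category on the category of diagrams. *)
Inductive teq : poly -> poly -> tape -> tape -> Prop :=
| teq_refl P Q t : ttyped t P Q -> teq P Q t t
| teq_sym P Q s t : teq P Q s t -> teq P Q t s
| teq_trans P Q s t u : teq P Q s t -> teq P Q t u -> teq P Q s u
| teq_comp P Q R s s' t t' :
    teq P Q s s' -> teq Q R t t' -> teq P R (tcomp s t) (tcomp s' t')
| teq_sum P Q P' Q' s s' t t' :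
    teq P Q s s' -> teq P' Q' t t' ->
    teq (P ++ P') (Q ++ Q') (tsum s t) (tsum s' t')
| teq_assoc P Q R S s t u :
    ttyped s P Q -> ttyped t Q R -> ttyped u R S ->
    teq P S (tcomp (tcomp s t) u) (tcomp s (tcomp t u))
| teq_idl P Q t : ttyped t P Q -> teq P Q (tcomp (tid P) t) t
| teq_idr P Q t : ttyped t P Q -> teq P Q (tcomp t (tid Q)) t
| teq_interchange P Q R P' Q' R' s t s' t' :
    ttyped s P Q -> ttyped t Q R -> ttyped s' P' Q' -> ttyped t' Q' R' ->
    teq (P ++ P') (R ++ R')
      (tsum (tcomp s t) (tcomp s' t')) (tcomp (tsum s s') (tsum t t'))
| teq_sum_assoc P Q P' Q' P'' Q'' s t u :
    ttyped s P Q -> ttyped t P' Q' -> ttyped u P'' Q'' ->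
    teq (P ++ P' ++ P'') (Q ++ Q' ++ Q'')
      (tsum (tsum s t) u) (tsum s (tsum t u))
| teq_unitl P Q t : ttyped t P Q -> teq P Q (tsum tid0 t) t
| teq_unitr P Q t : ttyped t P Q -> teq P Q (tsum t tid0) t
| teq_swap_nat P Q P' Q' s t :
    ttyped s P Q -> ttyped t P' Q' ->
    teq (P ++ P') (Q' ++ Q)
      (tcomp (tsum s t) (tbraid Q Q')) (tcomp (tbraid P P') (tsum t s))
| teq_swap_inv U V :
    teq [U; V] [U; V] (tcomp (tswap U V) (tswap V U)) (tid [U; V])
| teq_diag_assoc U :
    teq [U] [U; U; U]
      (tcomp (tdiag U) (tsum (tdiag U) (tidm U)))
      (tcomp (tdiag U) (tsum (tidm U) (tdiag U)))
| teq_diag_unit U :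
    teq [U] [U] (tcomp (tdiag U) (tsum (tbang U) (tidm U))) (tidm U)
| teq_diag_comm U :
    teq [U] [U; U] (tcomp (tdiag U) (tswap U U)) (tdiag U)
| teq_codiag_assoc U :
    teq [U; U; U] [U]
      (tcomp (tsum (tcodiag U) (tidm U)) (tcodiag U))
      (tcomp (tsum (tidm U) (tcodiag U)) (tcodiag U))
| teq_codiag_unit U :
    teq [U] [U] (tcomp (tsum (tcobang U) (tidm U)) (tcodiag U)) (tidm U)
| teq_codiag_comm U :
    teq [U; U] [U] (tcomp (tswap U U) (tcodiag U)) (tcodiag U)
| teq_diag_nat P Q t :
    ttyped t P Q ->
    teq P (Q ++ Q) (tcomp t (tdiagp Q)) (tcomp (tdiagp P) (tsum t t))
| teq_bang_nat P Q t :
    ttyped t P Q -> teq P [] (tcomp t (tbangp Q)) (tbangp P)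
| teq_codiag_nat P Q t :
    ttyped t P Q ->
    teq (P ++ P) Q (tcomp (tcodiagp P) t) (tcomp (tsum t t) (tcodiagp Q))
| teq_cobang_nat P Q t :
    ttyped t P Q -> teq [] Q (tcomp (tcobangp P) t) (tcobangp Q)
| teq_box U V c d : ceq U V c d -> teq [U] [V] (tbox c) (tbox d)
| teq_box_id U : teq [U] [U] (tbox (cid U)) (tidm U)
| teq_box_comp U V W c d :
    ctyped c U V -> ctyped d V W ->
    teq [U] [W] (tbox (ccomp c d)) (tcomp (tbox c) (tbox d)).

(** ** The tensor of tapes *)

Definition pmul (P Q : poly) : poly := list_mul (@app (sort Sg)) P Q.

(** Left and right whiskering by a monomial. *)
Fixpoint lwm (U : word) (t : tape) : tape :=
  match t with
  | tid0 => tid0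
  | tidm V => tidm (U ++ V)
  | tbox c => tbox (cten (cid U) c)
  | tswap V W => tswap (U ++ V) (U ++ W)
  | tdiag V => tdiag (U ++ V)
  | tbang V => tbang (U ++ V)
  | tcodiag V => tcodiag (U ++ V)
  | tcobang V => tcobang (U ++ V)
  | tcomp s t => tcomp (lwm U s) (lwm U t)
  | tsum s t => tsum (lwm U s) (lwm U t)
  end.

Fixpoint rwm (U : word) (t : tape) : tape :=
  match t with
  | tid0 => tid0
  | tidm V => tidm (V ++ U)
  | tbox c => tbox (cten c (cid U))
  | tswap V W => tswap (V ++ U) (W ++ U)
  | tdiag V => tdiag (V ++ U)
  | tbang V => tbang (V ++ U)
  | tcodiag V => tcodiag (V ++ U)
  | tcobang V => tcobang (V ++ U)
  | tcomp s t => tcomp (rwm U s) (rwm U t)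
  | tsum s t => tsum (rwm U s) (rwm U t)
  end.

Fixpoint tdistl (P Q R : poly) : tape :=
  match P with
  | [] => tid0
  | U :: P' =>
      tcomp (tsum (tid (pmul [U] (Q ++ R))) (tdistl P' Q R))
            (tsum (tid (pmul [U] Q))
               (tsum (tbraid (pmul [U] R) (pmul P' Q)) (tid (pmul P' R))))
  end.

Fixpoint tdistlV (P Q R : poly) : tape :=
  match P with
  | [] => tid0
  | U :: P' =>
      tcomp (tsum (tid (pmul [U] Q))
               (tsum (tbraid (pmul P' Q) (pmul [U] R)) (tid (pmul P' R))))
            (tsum (tid (pmul [U] (Q ++ R))) (tdistlV P' Q R))
  end.

Fixpoint lw (S : poly) (t : tape) : tape :=
  match S with [] => tid0 | W :: S' => tsum (lwm W t) (lw S' t) end.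

(** Right whiskering of [t : P -> Q]. *)
Fixpoint rw (S P Q : poly) (t : tape) : tape :=
  match S with
  | [] => tid0
  | W :: S' => tcomp (tcomp (tdistl P [W] S') (tsum (rwm W t) (rw S' P Q t)))
                     (tdistlV Q [W] S')
  end.

(** The symmetry of the tensor. *)
Fixpoint tpbraidm (P : poly) (V : word) : tape :=
  match P with
  | [] => tid0
  | U :: P' => tsum (tbox (csym U V)) (tpbraidm P' V)
  end.

Fixpoint tpbraid (P Q : poly) : tape :=
  match Q with
  | [] => tid0
  | V :: Q' => tcomp (tdistl P [V] Q') (tsum (tpbraidm P V) (tpbraid P Q'))
  end.

(** ** Typing *)

Lemma pmul_cons (U : word) (P Q : poly) : pmul (U :: P) Q = pmul [U] Q ++ pmul P Q.
Proof. unfold pmul, list_mul; simpl; rewrite app_nil_r; reflexivity. Qed.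

Lemma pmul_sum (U : word) (Q R : poly) :
  pmul [U] (Q ++ R) = pmul [U] Q ++ pmul [U] R.
Proof. unfold pmul, list_mul; simpl; rewrite !app_nil_r, map_app; reflexivity. Qed.

Lemma pmul_nilr (P : poly) : pmul P [] = [].
Proof. induction P as [|U P IH]; [reflexivity | exact IH]. Qed.

Lemma pmul_lmono (U : word) (P : poly) : pmul [U] P = map (app U) P.
Proof. unfold pmul, list_mul; simpl; apply app_nil_r. Qed.

Lemma pmul_rmono (P : poly) (W : word) : pmul P [W] = map (fun U => U ++ W) P.
Proof.
induction P as [|U P IH]; [reflexivity|].
rewrite pmul_cons, IH; reflexivity.
Qed.

Lemma tid_typed (P : poly) : ttyped (tid P) P P.
Proof.
induction P as [|U P IH]; simpl; [constructor|].
change (U :: P) with ([U] ++ P); constructor; [constructor | exact IH].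
Qed.

Lemma tswapm_typed (U : word) (Q : poly) : ttyped (tswapm U Q) (U :: Q) (Q ++ [U]).
Proof.
induction Q as [|V Q IH]; simpl; [constructor|].
apply ttyped_comp with (Q := [V; U] ++ Q).
- apply (@ttyped_sum _ _ [U; V] [V; U] Q Q); [constructor | apply tid_typed].
- apply (@ttyped_sum _ _ [V] [V] (U :: Q) (Q ++ [U])); [constructor | exact IH].
Qed.

Lemma tbraid_typed (P Q : poly) : ttyped (tbraid P Q) (P ++ Q) (Q ++ P).
Proof.
induction P as [|U P IH]; simpl.
- rewrite app_nil_r; apply tid_typed.
- apply ttyped_comp with (Q := [U] ++ Q ++ P).
  + apply (@ttyped_sum _ _ [U] [U] (P ++ Q) (Q ++ P)); [constructor | exact IH].
  + replace (Q ++ U :: P) with ((Q ++ [U]) ++ P) by (rewrite <- app_assoc; reflexivity).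
    apply (@ttyped_sum _ _ (U :: Q) (Q ++ [U]) P P);
      [apply tswapm_typed | apply tid_typed].
Qed.

Lemma tdiagp_typed (P : poly) : ttyped (tdiagp P) P (P ++ P).
Proof.
induction P as [|U P IH]; simpl; [constructor|].
apply ttyped_comp with (Q := [U; U] ++ P ++ P).
- apply (@ttyped_sum _ _ [U] [U; U] P (P ++ P)); [constructor | exact IH].
- apply (@ttyped_sum _ _ [U] [U] (U :: P ++ P) (P ++ U :: P)); [constructor|].
  replace (P ++ U :: P) with ((P ++ [U]) ++ P) by (rewrite <- app_assoc; reflexivity).
  apply (@ttyped_sum _ _ ([U] ++ P) (P ++ [U]) P P);
    [apply (tbraid_typed [U] P) | apply tid_typed].
Qed.

Lemma tbangp_typed (P : poly) : ttyped (tbangp P) P [].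
Proof.
induction P as [|U P IH]; simpl; [constructor|].
apply (@ttyped_sum _ _ [U] [] P []); [constructor | exact IH].
Qed.

Lemma tcodiagp_typed (P : poly) : ttyped (tcodiagp P) (P ++ P) P.
Proof.
induction P as [|U P IH]; simpl; [constructor|].
apply ttyped_comp with (Q := [U; U] ++ P ++ P).
- apply (@ttyped_sum _ _ [U] [U] (P ++ U :: P) (U :: P ++ P)); [constructor|].
  replace (P ++ U :: P) with ((P ++ [U]) ++ P) by (rewrite <- app_assoc; reflexivity).
  apply (@ttyped_sum _ _ (P ++ [U]) ([U] ++ P) P P);
    [apply (tbraid_typed P [U]) | apply tid_typed].
- apply (@ttyped_sum _ _ [U; U] [U] (P ++ P) P); [constructor | exact IH].
Qed.

Lemma tcobangp_typed (P : poly) : ttyped (tcobangp P) [] P.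
Proof.
induction P as [|U P IH]; simpl; [constructor|].
apply (@ttyped_sum _ _ [] [U] [] P); [constructor | exact IH].
Qed.

Lemma tdistl_typed (P Q R : poly) :
  ttyped (tdistl P Q R) (pmul P (Q ++ R)) (pmul P Q ++ pmul P R).
Proof.
induction P as [|U P IH]; [constructor|].
cbn [tdistl]; rewrite !(pmul_cons U P).
apply ttyped_comp with (Q := pmul [U] (Q ++ R) ++ (pmul P Q ++ pmul P R)).
- constructor; [apply tid_typed | exact IH].
- rewrite pmul_sum, <- !app_assoc; constructor; [apply tid_typed|].
  rewrite !app_assoc; constructor; [apply tbraid_typed | apply tid_typed].
Qed.

Lemma tdistlV_typed (P Q R : poly) :
  ttyped (tdistlV P Q R) (pmul P Q ++ pmul P R) (pmul P (Q ++ R)).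
Proof.
induction P as [|U P IH]; [constructor|].
cbn [tdistlV]; rewrite !(pmul_cons U P).
apply ttyped_comp with (Q := pmul [U] (Q ++ R) ++ (pmul P Q ++ pmul P R)).
- rewrite pmul_sum, <- !app_assoc; constructor; [apply tid_typed|].
  rewrite !app_assoc; constructor; [apply tbraid_typed | apply tid_typed].
- constructor; [apply tid_typed | exact IH].
Qed.

Lemma lwm_typed (U : word) (t : tape) (P Q : poly) :
  ttyped t P Q -> ttyped (lwm U t) (pmul [U] P) (pmul [U] Q).
Proof.
rewrite !pmul_lmono.
induction 1; simpl; rewrite ?map_app; try (econstructor; eassumption).
constructor; constructor; [constructor | assumption].
Qed.

Lemma rwm_typed (U : word) (t : tape) (P Q : poly) :
  ttyped t P Q -> ttyped (rwm U t) (pmul P [U]) (pmul Q [U]).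
Proof.
rewrite !pmul_rmono.
induction 1; simpl; rewrite ?map_app; try (econstructor; eassumption).
constructor; constructor; [assumption | constructor].
Qed.

Lemma lw_typed (S : poly) (t : tape) (P Q : poly) :
  ttyped t P Q -> ttyped (lw S t) (pmul S P) (pmul S Q).
Proof.
intros h; induction S as [|W S IH]; [constructor|].
rewrite !(pmul_cons W S); constructor; [apply lwm_typed, h | exact IH].
Qed.

Lemma rw_typed (S : poly) (t : tape) (P Q : poly) :
  ttyped t P Q -> ttyped (rw S P Q t) (pmul P S) (pmul Q S).
Proof.
intros h; induction S as [|W S IH]; [rewrite !pmul_nilr; constructor|].
apply ttyped_comp with (Q := pmul Q [W] ++ pmul Q S); [|apply tdistlV_typed].
apply ttyped_comp with (Q := pmul P [W] ++ pmul P S); [apply tdistl_typed|].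
constructor; [apply rwm_typed, h | exact IH].
Qed.

Lemma tpbraidm_typed (P : poly) (V : word) :
  ttyped (tpbraidm P V) (pmul P [V]) (pmul [V] P).
Proof.
rewrite pmul_rmono, pmul_lmono.
induction P as [|U P IH]; simpl; [constructor|].
apply (@ttyped_sum _ _ [U ++ V] [V ++ U]); [|exact IH].
constructor; constructor.
Qed.

Lemma tpbraid_typed (P Q : poly) : ttyped (tpbraid P Q) (pmul P Q) (pmul Q P).
Proof.
induction Q as [|V Q IH]; [rewrite pmul_nilr; constructor|].
rewrite (pmul_cons V Q P).
apply ttyped_comp with (Q := pmul P [V] ++ pmul P Q).
- apply (tdistl_typed P [V] Q).
- constructor; [apply tpbraidm_typed | exact IH].
Qed.

(** ** Homsets *)

Record thom (P Q : poly) := THom { thom_term :> tape; thom_typed : ttyped thom_term P Q }.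

Definition thom_comp (P Q R : poly) (s : thom P Q) (t : thom Q R) : thom P R :=
  THom (ttyped_comp (thom_typed s) (thom_typed t)).

Definition thom_sum (P Q P' Q' : poly) (s : thom P Q) (t : thom P' Q') :
    thom (P ++ P') (Q ++ Q') :=
  THom (ttyped_sum (thom_typed s) (thom_typed t)).

Definition thom_box (U V : word) (c : chom U V) : thom [U] [V] :=
  THom (ttyped_box (chom_typed c)).

Definition thom_prod (P1 Q1 P2 Q2 : poly) (t1 : thom P1 Q1) (t2 : thom P2 Q2) :
    thom (pmul P1 P2) (pmul Q1 Q2) :=
  THom (ttyped_comp (lw_typed P1 (thom_typed t2)) (rw_typed Q2 (thom_typed t1))).

Definition thom_zero : thom [] [] := THom ttyped_id0.
Definition thom_idm (U : word) : thom [U] [U] := THom (ttyped_idm U).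
Definition thom_diag (U : word) : thom [U] [U; U] := THom (ttyped_diag U).
Definition thom_bang (U : word) : thom [U] [] := THom (ttyped_bang U).
Definition thom_codiag (U : word) : thom [U; U] [U] := THom (ttyped_codiag U).
Definition thom_cobang (U : word) : thom [] [U] := THom (ttyped_cobang U).

End Diagrams.

(** * Monoidal theories *)

(** [ineq] is given on representatives: arrows of the free category are terms
    modulo [ceq]. *)
Record theory := Theory {
  sg : signature;
  ineq : forall U V : list (sort sg), chom U V -> chom U V -> Prop
}.

Section Theory.
Context (Th : theory).

Local Notation word := (list (sort (sg Th))).
Local Notation poly := (list word).
Local Notation chom := (@chom (sg Th)).
Local Notation thom := (@thom (sg Th)).

Inductive cle : forall U V : word, chom U V -> chom U V -> Prop :=
| cle_eq U V (c d : chom U V) : ceq U V c d -> cle c d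
| cle_ineq U V (c d : chom U V) : ineq c d -> cle c d
| cle_trans U V (c d e : chom U V) : cle c d -> cle d e -> cle c e
| cle_comp U V W (c c' : chom U V) (d d' : chom V W) :
    cle c c' -> cle d d' -> cle (chom_comp c d) (chom_comp c' d')
| cle_ten U V U' V' (c c' : chom U V) (d d' : chom U' V') :
    cle c c' -> cle d d' -> cle (chom_ten c d) (chom_ten c' d').

Lemma circ_equiv (U V : word) : Equivalence (fun c d : chom U V => ceq U V c d).
Proof.
split.
- intros c; apply ceq_refl, chom_typed.
- intros c d; apply ceq_sym.
- intros c d e; apply ceq_trans.
Qed.

Definition circ_cat : ordcat :=
  @OrdCat word chom (fun U V c d => ceq U V c d) cle
    (@chom_id _) (@chom_comp _) circ_equiv cle_eq cle_trans cle_comp.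

Definition circ_monoidal : monoidal circ_cat :=
  @Monoidal circ_cat [] (@app _) (@chom_ten _) (@chom_sym _) cle_ten.

Inductive tineq : forall P Q : poly, thom P Q -> thom P Q -> Prop :=
| tineq_box U V (c d : chom U V) : ineq c d -> tineq (thom_box c) (thom_box d)
| tineq_cobang_bang U :
    tineq (thom_zero _) (thom_comp (thom_cobang U) (thom_bang U))
| tineq_bang_cobang U :
    tineq (thom_comp (thom_bang U) (thom_cobang U)) (thom_idm U)
| tineq_codiag_diag U :
    tineq (thom_sum (thom_idm U) (thom_idm U))
          (thom_comp (thom_codiag U) (thom_diag U))
| tineq_diag_codiag U :
    tineq (thom_comp (thom_diag U) (thom_codiag U)) (thom_idm U).

Inductive tle : forall P Q : poly, thom P Q -> thom P Q -> Prop :=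
| tle_eq P Q (s t : thom P Q) : teq P Q s t -> tle s t
| tle_ineq P Q (s t : thom P Q) : tineq s t -> tle s t
| tle_trans P Q (s t u : thom P Q) : tle s t -> tle t u -> tle s u
| tle_comp P Q R (s s' : thom P Q) (t t' : thom Q R) :
    tle s s' -> tle t t' -> tle (thom_comp s t) (thom_comp s' t')
| tle_sum P Q P' Q' (s s' : thom P Q) (t t' : thom P' Q') :
    tle s s' -> tle t t' -> tle (thom_sum s t) (thom_sum s' t')
| tle_prod P Q P' Q' (s s' : thom P Q) (t t' : thom P' Q') :
    tle s s' -> tle t t' -> tle (thom_prod s t) (thom_prod s' t').

Lemma tape_equiv (P Q : poly) : Equivalence (fun s t : thom P Q => teq P Q s t).
Proof.
split.
- intros s; apply teq_refl, thom_typed.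
- intros s t; apply teq_sym.
- intros s t u; apply teq_trans.
Qed.

Definition tape_cat : ordcat :=
  @OrdCat poly thom (fun P Q s t => teq P Q s t) tle
    (fun P => THom (tid_typed P)) (@thom_comp _) tape_equiv tle_eq tle_trans tle_comp.

Definition tape_sum : monoidal tape_cat :=
  @Monoidal tape_cat [] (@app _) (@thom_sum _)
    (fun P Q => THom (tbraid_typed P Q)) tle_sum.

Definition tape_prod : monoidal tape_cat :=
  @Monoidal tape_cat [[]] (@pmul _) (@thom_prod _)
    (fun P Q => THom (tpbraid_typed P Q)) tle_prod.

Definition tape_biproduct : biproduct tape_sum :=
  @Biproduct tape_cat tape_sum
    (fun P => THom (tdiagp_typed P)) (fun P => THom (tbangp_typed P))
    (fun P => THom (tcodiagp_typed P)) (fun P => THom (tcobangp_typed P)).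

Definition tape_preordered : fbrig :=
  @FbRig tape_cat tape_sum tape_biproduct tape_prod
    (fun P Q R => THom (tdistl_typed P Q R)).

Definition tape_rig : fbrig := pos_fbrig tape_preordered.

End Theory.

(* Main.v *)
From Stdlib Require Import List Arith Lia Setoid Morphisms RelationClasses.
From Stdlib Require Import Classical ProofIrrelevance ClassicalEpsilon.
Require Import Defs.
Import ListNotations.

Set Implicit Arguments.
Unset Strict Implicit.
Unset Printing Implicit Defensive.

(** Arrows of both rigs are compared through one semantics.  An arrow [P -> Q] between
    polynomials denotes the set of triples [(i, j, c)] in which [i] and [j] are positions
    of monomials of [P] and [Q] and [c] is a diagram between these monomials; the sets so
    obtained are the well-typed ones that are downward closed and finitely generated at
    every [(i, j)].  For matrices this reads off the entries.  For tapes, [c] ranges over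
    the diagrams below the composite of the boxes along a path from [i] to [j].

    All the laws of a finite biproduct rig hold for such sets, and a full semantics
    that is bijective on objects, reflects the order and preserves the operations transfers
    them to its domain; two domains of such semantics are isomorphic.

    The order on tapes is reflected because [!], [i], [Delta] and [nabla] are adjoint: the
    injections [inj_k] and projections [proj_k] of the monomials satisfy
    [id <= inj_k; proj_k] and [proj_k; inj_k <= id], and [id] is the join of the
    [proj_k; inj_k].  Hence a tape is the join of its entries [inj_k; t; proj_l], and each
    entry, by induction on the tape, is a finite join of boxes. *)

(** Strictness identifies objects only propositionally, so entries typed by [hom] would put a
    transport into almost every law. Relations on natural numbers and untyped terms mention no
    objects: both sides of a strictness law live in one type, and most coherence laws become
    equations between maps of positions, that is, arithmetic with quotients and remainders.

    The isomorphism is not defined by recursion on tapes. Fullness supplies some arrow with a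
    prescribed semantics, and faithfulness makes any such choice functorial, so both directions come
    from the same lemma.

    The sum of parallel arrows given by [Delta] and [nabla], and its neutral element, exist in every
    finite biproduct category; that every arrow has a matrix of entries uses nothing more. The added
    inequalities contribute that the zero is least and that the sum of an arrow with itself is below
    it, so that sums are joins and can be compared with unions of sets. Closure of the order under
    the tensor of tapes is what carries inequalities between tensors of diagrams over to their
    boxes. *)

Ltac splits := split; [|split]; trivial.

Ltac cases_ltb :=
  repeat match goal with
  | |- context [?n <? ?m] => destruct (Nat.ltb_spec n m); try lia
  end.

(** * Arithmetic of pairs of positions *)

Section Index.
Implicit Types (i j n m p a b c d x y : nat).

Lemma div_pair n i j : j < n -> (i * n + j) / n = i.
Proof. intros h; rewrite Nat.div_add_l, Nat.div_small by lia; lia. Qed.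

Lemma mod_pair n i j : j < n -> (i * n + j) mod n = j.
Proof.
intros h; rewrite Nat.add_comm, Nat.Div0.mod_add; apply Nat.mod_small; exact h.
Qed.

Lemma pair_div_mod n i : i = i / n * n + i mod n.
Proof. rewrite Nat.mul_comm; apply Nat.div_mod_eq. Qed.

Lemma pair_lt n m i j : i < n -> j < m -> i * m + j < n * m.
Proof. nia. Qed.

Lemma pair_ex n m p : p < n * m -> exists i j, i < n /\ j < m /\ p = i * m + j.
Proof.
intros h; exists (p / m), (p mod m).
assert (m <> 0) by (intros ->; lia).
split; [|split].
- apply Nat.Div0.div_lt_upper_bound; lia.
- apply Nat.mod_upper_bound; assumption.
- apply pair_div_mod.
Qed.

(** A number in a mixed radix with three digits can be split off from either end. This lemma and the
    next two match the digits of the two readings, which is why the Kronecker product is associative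
    without any reindexing. *)
Lemma div_div a b c : a / b / c = a / (c * b).
Proof. rewrite Nat.mul_comm; apply Nat.Div0.div_div. Qed.

Lemma div_mod_swap a b c : 0 < b -> (a / b) mod c = (a mod (c * b)) / b.
Proof.
intros hb; rewrite Nat.mul_comm, Nat.Div0.mod_mul_r.
rewrite (Nat.mul_comm b), Nat.add_comm, div_pair; trivial.
apply Nat.mod_upper_bound; lia.
Qed.

Lemma mod_mod_mul a b c : 0 < b -> a mod b = (a mod (c * b)) mod b.
Proof.
intros hb; rewrite (Nat.mul_comm c b), Nat.Div0.mod_mul_r.
rewrite (Nat.mul_comm b), Nat.add_comm, mod_pair; trivial.
apply Nat.mod_upper_bound; lia.
Qed.

End Index.

(** * The order on untyped diagrams *)

Section Raw.
Context (Th : theory).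
Local Notation word := (list (sort (sg Th))).
Local Notation poly := (list word).
Local Notation cterm := (cterm (sg Th)).
Implicit Types (U V W : word) (A B D E P Q : poly) (c d e : cterm) (i j : nat) (f g :
  nat -> nat).

Lemma ctyped_unique c U V U' V' : ctyped c U V -> ctyped c U' V' -> U = U' /\ V = V'.
Proof.
intros h; revert U' V'; induction h; intros A B h'; inversion h'; subst; auto.
- match goal with h : ctyped c _ _, h' : ctyped d _ _ |- _ =>
    destruct (IHh1 _ _ h) as [? ?]; destruct (IHh2 _ _ h') as [? ?] end; auto.
- match goal with h : ctyped c _ _, h' : ctyped d _ _ |- _ =>
    destruct (IHh1 _ _ h) as [? ?]; destruct (IHh2 _ _ h') as [? ?] end;
  subst; auto.
Qed.

Lemma ceq_typed U V c d : ceq U V c d -> ctyped c U V /\ ctyped d U V.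
Proof.
induction 1; repeat match goal with h : _ /\ _ |- _ => destruct h end;
  split; eauto using ctyped.
- rewrite !app_assoc; eauto using ctyped.
- change U with ([] ++ U); change V with ([] ++ V); eauto using ctyped.
- rewrite <- (app_nil_r U), <- (app_nil_r V); eauto using ctyped.
- apply ctyped_comp with (V := V ++ U ++ W).
  + rewrite !app_assoc; eauto using ctyped.
  + rewrite <- app_assoc; eauto using ctyped.
Qed.

(** A partial preorder: both sides are well typed whenever it holds, so [cl c c] is another way to
    say that [c] has a type. By [ctyped_unique] the types quantified here are determined, and
    nothing is lost against [cle] ([cl_cle]). *)
Definition cl c d : Prop :=
  exists U V (hc : ctyped c U V) (hd : ctyped d U V), cle (CHom hc) (CHom hd).

Lemma cl_cle U V (f g : chom U V) :
  cl (chom_term f) (chom_term g) <-> cle (Th := Th) f g.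
Proof.
destruct f as [c hc], g as [d hd]; simpl; split.
- intros [U' [V' [hc' [hd' h]]]].
  destruct (ctyped_unique hc hc') as [<- <-].
  rewrite (proof_irrelevance _ hc hc'), (proof_irrelevance _ hd hd'); exact h.
- intros h; exists U, V, hc, hd; exact h.
Qed.

Lemma cl_typed U V c d : cl c d -> (ctyped c U V <-> ctyped d U V).
Proof.
intros [U' [V' [hc [hd _]]]]; split; intros h.
- destruct (ctyped_unique h hc) as [-> ->]; exact hd.
- destruct (ctyped_unique h hd) as [-> ->]; exact hc.
Qed.

Lemma cl_typedl U V c d : cl c d -> ctyped d U V -> ctyped c U V.
Proof. intros h; apply (cl_typed U V h). Qed.

Lemma cl_typedr U V c d : cl c d -> ctyped c U V -> ctyped d U V.
Proof. intros h; apply (cl_typed U V h). Qed.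

Lemma cl_ceq U V c d : ceq U V c d -> cl c d.
Proof.
intros h; destruct (ceq_typed h) as [hc hd].
exists U, V, hc, hd; apply cle_eq; exact h.
Qed.

Lemma cl_refl U V c : ctyped c U V -> cl c c.
Proof. intros h; apply (cl_ceq (ceq_refl h)). Qed.

Lemma cl_trans c d e : cl c d -> cl d e -> cl c e.
Proof.
intros h1 [U [V [hd [he h2]]]].
pose proof (cl_typedl h1 hd) as hc.
exists U, V, hc, he; apply (cle_trans (d := CHom hd)); trivial.
apply cl_cle; exact h1.
Qed.

(** Composability has to be supplied: [cl] relates [c] to [c'] and [d] to [d'] at some types, but
    does not say that these meet in the middle. For [cten] no such condition arises. *)
Lemma cl_comp U V W c c' d d' :
  ctyped c' U V -> ctyped d' V W -> cl c c' -> cl d d' -> cl (ccomp c d) (ccomp c' d').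
Proof.
intros hc' hd' h h'.
pose proof (cl_typedl h hc') as hc; pose proof (cl_typedl h' hd') as hd.
apply (proj2 (cl_cle (chom_comp (CHom hc) (CHom hd)) (chom_comp (CHom hc') (CHom hd')))).
apply cle_comp; apply cl_cle; assumption.
Qed.

Lemma cl_ten c c' d d' : cl c c' -> cl d d' -> cl (cten c d) (cten c' d').
Proof.
intros h h'; pose proof h as [U [V [hc [hc' _]]]]; pose proof h' as [U' [V' [hd [hd' _]]]].
apply (proj2 (cl_cle (chom_ten (CHom hc) (CHom hd)) (chom_ten (CHom hc') (CHom hd')))).
apply cle_ten; apply cl_cle; assumption.
Qed.

Lemma ctyped_ids (a : word) : ctyped (cid a) a a.
Proof. constructor. Qed.

Lemma cl_comp_inv U V W (c m m' n n' : cterm) :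
  cl c (ccomp m n) -> cl m m' -> cl n n' -> ctyped m' U V -> ctyped n' V W ->
  cl c (ccomp m' n').
Proof. intros h hm hn tm tn; apply (cl_trans h); eapply cl_comp; eassumption. Qed.

Lemma cl_idl U V (c m n : cterm) :
  cl c (ccomp m n) -> cl m (cid U) -> ctyped n U V -> cl c n.
Proof.
intros h hm hn; apply (cl_trans (d := ccomp (cid U) n)).
- eapply cl_comp_inv; [exact h | exact hm | eapply cl_refl, hn | apply ctyped_ids | exact hn].
- apply (cl_ceq (ceq_idl hn)).
Qed.

Lemma cl_idr U V (c m n : cterm) :
  cl c (ccomp m n) -> cl n (cid V) -> ctyped m U V -> cl c m.
Proof.
intros h hn hm; apply (cl_trans (d := ccomp m (cid V))).
- eapply cl_comp_inv; [exact h | eapply cl_refl, hm | exact hn | exact hm | apply ctyped_ids].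
- apply (cl_ceq (ceq_idr hm)).
Qed.

(** * Matrices of downward closed sets, on bare positions and terms *)

(** The pair [(i, j)] of positions of [P] and [Q] is sent to the set of diagrams
    [c] with [R i j c]; a position of [pmul P Q] is [x * length Q + y]. *)
Definition raw := nat -> nat -> cterm -> Prop.

Implicit Types (R S T F G H : raw).

Definition requ R S : Prop := forall i j c, R i j c <-> S i j c.

Definition rsub R S : Prop := forall i j c, R i j c -> S i j c.

#[export] Instance requ_equiv : Equivalence requ.
Proof.
split.
- intros R i j c; reflexivity.
- intros R S h i j c; symmetry; apply h.
- intros R S T h1 h2 i j c; rewrite (h1 i j c); apply h2.
Qed.

(** Matrix multiplication: addition being union, the sum over the middle index is the existential
    over [k]. The bound by [cl] takes the downward closure and discards composites that are ill
    typed, since nothing lies below them. *)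
Definition rcomp R S : raw := fun i j c =>
  exists k m n, R i k m /\ S k j n /\ cl c (ccomp m n).

(** A bare relation does not record its dimensions, so the size [n] by [m] of the first block is
    passed explicitly. The same holds for the second factor in [rkron]. *)
Definition rdsum (n m : nat) R S : raw := fun i j c =>
  (i < n /\ j < m /\ R i j c) \/ (n <= i /\ m <= j /\ S (i - n) (j - m) c).

Definition rkron (n m : nat) R S : raw := fun i j c =>
  exists x y, R (i / n) (j / m) x /\ S (i mod n) (j mod m) y /\ cl c (cten x y).

Definition rtr R : raw := fun i j c => R j i c.

#[export] Instance rcomp_proper : Proper (requ ==> requ ==> requ) rcomp.
Proof.
intros R R' h S S' h' i j c; unfold rcomp; split; intros [k [m [n [h1 [h2 h3]]]]];
  exists k, m, n; split; [apply h | split; [apply h'|] | apply h | split; [apply h'|]];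
  assumption.
Qed.

#[export] Instance rdsum_proper : Proper (eq ==> eq ==> requ ==> requ ==> requ) rdsum.
Proof.
intros n _ <- m _ <- R R' h S S' h' i j c; unfold rdsum.
rewrite (h i j c), (h' (i - n) (j - m) c); reflexivity.
Qed.

#[export] Instance rkron_proper : Proper (eq ==> eq ==> requ ==> requ ==> requ) rkron.
Proof.
intros n _ <- m _ <- R R' h S S' h' i j c; unfold rkron.
split; intros [x [y [h1 [h2 h3]]]]; exists x, y; split;
  [apply h | split; [apply h'|] | apply h | split; [apply h'|]]; assumption.
Qed.

(** The generators in [L] are arbitrary terms; an ill-typed one is harmless because it has nothing
    below it. Downward closure is part of the second clause ([is_mat_down]). *)
Definition is_mat P Q R : Prop :=
  (forall i j c, R i j c -> exists a b,
     nth_error P i = Some a /\ nth_error Q j = Some b /\ ctyped c a b) /\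
  (forall i j, exists L, forall c, R i j c <-> exists2 d, In d L & cl c d).

Lemma nth_error_lt (X : Type) (l : list X) i (a : X) :
  nth_error l i = Some a -> i < length l.
Proof. intros h; apply nth_error_Some; rewrite h; discriminate. Qed.

Lemma nth_error_ex (X : Type) (l : list X) i :
  i < length l -> exists a, nth_error l i = Some a.
Proof.
intros h; apply nth_error_Some in h; destruct (nth_error l i) as [a|]; [exists a; trivial|].
contradiction.
Qed.

Lemma is_mat_down P Q R i j c d : is_mat P Q R -> R i j d -> cl c d -> R i j c.
Proof.
intros [_ h] hd hc; destruct (h i j) as [L hL]; apply hL in hd; destruct hd as [e he hde].
apply hL; exists e; trivial; apply (cl_trans hc hde).
Qed.

Lemma is_mat_lt P Q R i j c : is_mat P Q R -> R i j c -> i < length P /\ j < length Q.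
Proof.
intros [h _] hR; apply h in hR; destruct hR as [a [b [h1 [h2 _]]]].
split; eapply nth_error_lt; eassumption.
Qed.

Lemma is_mat_requ P Q R S : requ R S -> is_mat P Q R -> is_mat P Q S.
Proof.
intros h [h1 h2]; split.
- intros i j c hS; apply h1, h, hS.
- intros i j; destruct (h2 i j) as [L hL]; exists L; intros c; rewrite <- (h i j c); apply hL.
Qed.

(** ** Matrices of position maps *)

Definition rfun A f : raw := fun i j c =>
  exists a, nth_error A i = Some a /\ j = f i /\ cl c (cid a).

Local Notation rid A := (rfun A (fun i => i)).

(** Except for the symmetry of [rkron], every structural arrow is the 0-1 matrix of a
    label-preserving map of positions, or the transpose [rtr] of one. *)
Definition lab A B f : Prop :=
  forall i a, nth_error A i = Some a -> nth_error B (f i) = Some a.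

Definition isfun A B f R : Prop :=
  lab A B f /\ requ R (rfun A f).

Lemma lab_lt A B f i : lab A B f -> i < length A -> f i < length B.
Proof.
intros h hi; apply nth_error_ex in hi; destruct hi as [a ha].
eapply nth_error_lt, h, ha.
Qed.

Lemma isfun_requ A B f R S : requ R S -> isfun A B f R -> isfun A B f S.
Proof. intros h [h1 h2]; split; [exact h1 | rewrite <- h; exact h2]. Qed.

Lemma isfun_rfun A B f : lab A B f -> isfun A B f (rfun A f).
Proof. intros h; split; [exact h | reflexivity]. Qed.

Lemma isfun_cast A B A' B' f R : isfun A B f R -> A = A' -> B = B' -> isfun A' B' f R.
Proof. intros h <- <-; exact h. Qed.

Lemma isfun_ext A B f g R :
  isfun A B f R -> (forall i, i < length A -> f i = g i) -> isfun A B g R.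
Proof.
intros [hl h] e; split.
- intros i a hi; rewrite <- e; [apply hl, hi | eapply nth_error_lt, hi].
- rewrite h; intros i j c; unfold rfun; split; intros [a [h1 [h2 h3]]]; exists a;
    rewrite e in * by (eapply nth_error_lt, h1); auto.
Qed.

Lemma isfun_eq A B A' B' f g R S :
  isfun A B f R -> isfun A' B' g S -> A = A' ->
  (forall i, i < length A -> f i = g i) -> requ R S.
Proof.
intros h1 h2 <- e; destruct (isfun_ext h1 e) as [_ h]; destruct h2 as [_ h2].
rewrite h, h2; reflexivity.
Qed.

Lemma isfun_id A : isfun A A (fun i => i) (rid A).
Proof. apply isfun_rfun; intros i a h; exact h. Qed.

Lemma is_mat_fun A B f R : isfun A B f R -> is_mat A B R.
Proof.
intros [hl h]; apply (is_mat_requ (R := rfun A f)); [symmetry; exact h|]; clear R h.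
split.
- intros i j c [a [h1 [-> h2]]]; exists a, a; split; [|split]; auto.
  apply (cl_typedl h2), ctyped_ids.
- intros i j; destruct (nth_error A i) as [a|] eqn:ha;
    [destruct (Nat.eq_dec j (f i)) as [e|e]|].
  + exists [cid a]; intros c; split.
    * intros [a' [h1 [_ h2]]]; rewrite ha in h1; injection h1 as <-.
      exists (cid a); simpl; auto.
    * intros [d [<-|[]] hd]; exists a; auto.
  + exists []; intros c; split; [intros [_ [_ [? _]]]; contradiction | intros [d [] _]].
  + exists []; intros c; split;
      [intros [a [h _]]; rewrite ha in h; discriminate | intros [d [] _]].
Qed.

Lemma is_mat_rtr A B R :
  (forall i j c, R i j c -> exists a, nth_error A i = Some a /\ nth_error B j = Some a
     /\ ctyped c a a) ->
  is_mat B A (rtr R) -> is_mat A B R.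
Proof.
intros ht [_ h]; split.
- intros i j c hR; destruct (ht _ _ _ hR) as [a ha]; exists a, a; exact ha.
- intros i j; apply (h j i).
Qed.

Lemma is_mat_cofun A B f R : isfun B A f (rtr R) -> is_mat A B R.
Proof.
intros h; apply is_mat_rtr; [|eapply is_mat_fun, h].
intros i j c hR; destruct h as [hl h]; apply (h j i c) in hR.
destruct hR as [a [h1 [-> h2]]]; exists a; split; [|split]; auto.
apply (cl_typedl h2), ctyped_ids.
Qed.

(** A 0-1 matrix holds only terms below identities, which downward closure and the unit laws absorb.
    Hence composing with it merely reindexes: this lemma and the next three do so for a position map
    and for its transpose, on either side. All naturality laws below start from them. *)
Lemma fun_pre A B D f S R i j c :
  isfun A B f S -> is_mat B D R ->
  rcomp S R i j c <-> i < length A /\ R (f i) j c.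
Proof.
intros [hl h] hR; split.
- intros [k [m [n [h1 [h2 h3]]]]]; apply (h i k m) in h1; destruct h1 as [a [ha [-> hm]]].
  split; [eapply nth_error_lt, ha|].
  apply (is_mat_down hR h2).
  destruct hR as [hR _]; apply hR in h2; destruct h2 as [a' [b [ha' [_ hn]]]].
  rewrite (hl _ _ ha) in ha'; injection ha' as <-.
  apply (cl_idl h3 hm hn).
- intros [hi hc]; apply nth_error_ex in hi; destruct hi as [a ha].
  pose proof hc as hc'.
  destruct hR as [hR _]; apply hR in hc'; destruct hc' as [a' [b [ha' [_ tc]]]].
  rewrite (hl _ _ ha) in ha'; injection ha' as <-.
  exists (f i), (cid a), c; splits.
  + apply h; exists a; splits; apply (cl_refl (ctyped_ids a)).
  + apply (cl_ceq (ceq_sym (ceq_idl tc))).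
Qed.

Lemma fun_post A B D f R S i j c :
  is_mat A B R -> isfun B D f S ->
  rcomp R S i j c <-> exists k, R i k c /\ j = f k.
Proof.
intros hR [hl h]; split.
- intros [k [m [n [h1 [h2 h3]]]]]; apply (h k j n) in h2; destruct h2 as [b [hb [-> hn]]].
  exists k; split; trivial.
  apply (is_mat_down hR h1).
  destruct hR as [hR _]; apply hR in h1; destruct h1 as [a [b' [_ [hb' hm]]]].
  rewrite hb in hb'; injection hb' as <-.
  apply (cl_idr h3 hn hm).
- intros [k [hc ->]]; pose proof hc as hc'.
  destruct hR as [hR _]; apply hR in hc'; destruct hc' as [a [b [_ [hb tc]]]].
  exists k, c, (cid b); splits.
  + apply h; exists b; splits; apply (cl_refl (ctyped_ids b)).
  + apply (cl_ceq (ceq_sym (ceq_idr tc))).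
Qed.

Lemma cofun_pre A B D g S R i j c :
  isfun B A g (rtr S) -> is_mat B D R ->
  rcomp S R i j c <-> exists k, i = g k /\ R k j c.
Proof.
intros [hl h] hR; split.
- intros [k [m [n [h1 [h2 h3]]]]]; apply (h k i m) in h1; destruct h1 as [a [ha [-> hm]]].
  exists k; split; trivial.
  apply (is_mat_down hR h2).
  destruct hR as [hR _]; apply hR in h2; destruct h2 as [a' [b [ha' [_ hn]]]].
  rewrite ha in ha'; injection ha' as <-.
  apply (cl_idl h3 hm hn).
- intros [k [-> hc]]; pose proof hc as hc'.
  destruct hR as [hR _]; apply hR in hc'; destruct hc' as [a [b [ha [_ tc]]]].
  exists k, (cid a), c; splits.
  + apply (h k (g k)); exists a; splits; apply (cl_refl (ctyped_ids a)).
  + apply (cl_ceq (ceq_sym (ceq_idl tc))).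
Qed.

Lemma cofun_post A B D g R S i j c :
  is_mat A B R -> isfun D B g (rtr S) ->
  rcomp R S i j c <-> j < length D /\ R i (g j) c.
Proof.
intros hR [hl h]; split.
- intros [k [m [n [h1 [h2 h3]]]]]; apply (h j k n) in h2; destruct h2 as [b [hb [-> hn]]].
  split; [eapply nth_error_lt, hb|].
  apply (is_mat_down hR h1).
  destruct hR as [hR _]; apply hR in h1; destruct h1 as [a [b' [_ [hb' hm]]]].
  rewrite (hl _ _ hb) in hb'; injection hb' as <-.
  apply (cl_idr h3 hn hm).
- intros [hj hc]; apply nth_error_ex in hj; destruct hj as [b hb].
  pose proof hc as hc'.
  destruct hR as [hR _]; apply hR in hc'; destruct hc' as [a [b' [_ [hb' tc]]]].
  rewrite (hl _ _ hb) in hb'; injection hb' as <-.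
  exists (g j), c, (cid b); splits.
  + apply (h j (g j)); exists b; splits; apply (cl_refl (ctyped_ids b)).
  + apply (cl_ceq (ceq_sym (ceq_idr tc))).
Qed.

Lemma isfun_comp A B B' D f g R S :
  isfun A B f R -> isfun B' D g S -> B = B' ->
  isfun A D (fun i => g (f i)) (rcomp R S).
Proof.
intros hR hS <-; split; [intros i a h; apply hS, hR, h|].
intros i j c; rewrite (fun_pre i j c hR (is_mat_fun hS)).
destruct hR as [hl hR], hS as [hl' hS]; rewrite (hS (f i) j c); unfold rfun.
split.
- intros [hi [a [h1 [h2 h3]]]]; apply nth_error_ex in hi; destruct hi as [b hb].
  rewrite (hl _ _ hb) in h1; injection h1 as <-; exists b; auto.
- intros [a [h1 [h2 h3]]]; split; [eapply nth_error_lt, h1|]; exists a; auto.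
Qed.

Lemma cofun_comp A B B' D f g R S :
  isfun B A f (rtr R) -> isfun D B' g (rtr S) -> B = B' ->
  isfun D A (fun i => f (g i)) (rtr (rcomp R S)).
Proof.
intros hR hS <-; split; [intros i a h; apply hR, hS, h|].
intros j i c; unfold rtr at 1; rewrite (cofun_post i j c (is_mat_cofun hR) hS).
destruct hR as [hl hR], hS as [hl' hS].
change (R i (g j) c) with (rtr R (g j) i c); rewrite (hR (g j) i c); unfold rfun.
split.
- intros [hi [a [h1 [h2 h3]]]]; apply nth_error_ex in hi; destruct hi as [b hb].
  rewrite (hl' _ _ hb) in h1; injection h1 as <-; exists b; auto.
- intros [a [h1 [h2 h3]]]; split; [eapply nth_error_lt, h1|]; exists a; auto.
Qed.

Definition fsum (n m : nat) f g i : nat :=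
  if i <? n then f i else m + g (i - n).

Lemma nth_error_appl (X : Type) (l l' : list X) i (a : X) :
  nth_error l i = Some a -> nth_error (l ++ l') i = Some a.
Proof. intros h; rewrite nth_error_app1; [exact h | eapply nth_error_lt, h]. Qed.

Lemma nth_error_appr (X : Type) (l l' : list X) i (a : X) :
  nth_error l' i = Some a -> nth_error (l ++ l') (length l + i) = Some a.
Proof.
intros h; rewrite nth_error_app2 by lia; rewrite <- h; f_equal; lia.
Qed.

Lemma isfun_sum A B A' B' f g R S (n m : nat) :
  isfun A B f R -> isfun A' B' g S -> n = length A -> m = length B ->
  isfun (A ++ A') (B ++ B') (fsum n m f g) (rdsum n m R S).
Proof.
intros [hl hR] [hl' hS] -> ->; split.
- intros i a; unfold fsum; destruct (Nat.ltb_spec i (length A)) as [h|h].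
  + rewrite nth_error_app1 by exact h; intros ha; apply nth_error_appl, hl, ha.
  + rewrite nth_error_app2 by exact h; intros ha; apply nth_error_appr, hl', ha.
- rewrite hR, hS; intros i j c; unfold rdsum, rfun, fsum.
  destruct (Nat.ltb_spec i (length A)) as [h|h]; split.
  + intros [[_ [_ [a [h1 [h2 h3]]]]] | [h1 _]]; [|lia].
    exists a; split; [apply nth_error_appl, h1 | auto].
  + intros [a [h1 [-> h3]]]; rewrite nth_error_app1 in h1 by exact h.
    left; split; [exact h|split].
    * apply (lab_lt hl h).
    * exists a; auto.
  + intros [[h1 _] | [_ [h0 [a [h1 [h2 h3]]]]]]; [lia|].
    exists a; rewrite nth_error_app2 by exact h; splits; lia.
  + intros [a [h1 [-> h3]]]; rewrite nth_error_app2 in h1 by exact h.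
    right; split; [|split]; try lia; exists a; splits; lia.
Qed.

Lemma rtr_sum (n m : nat) R S : requ (rtr (rdsum n m R S)) (rdsum m n (rtr R) (rtr S)).
Proof. intros i j c; unfold rtr, rdsum; tauto. Qed.

Lemma cofun_sum A B A' B' f g R S (n m : nat) :
  isfun B A f (rtr R) -> isfun B' A' g (rtr S) -> n = length A -> m = length B ->
  isfun (B ++ B') (A ++ A') (fsum m n f g) (rtr (rdsum n m R S)).
Proof.
intros h h' e e'; eapply isfun_requ; [symmetry; apply rtr_sum|].
apply isfun_sum; assumption.
Qed.

Lemma nth_pmul A B i (w : word) :
  nth_error (pmul A B) i = Some w <->
  exists a b, nth_error A (i / length B) = Some a /\ nth_error B (i mod length B) = Some b
    /\ w = a ++ b.
Proof.
(* Quotient and remainder by [length B] carry no information when [B] is empty; both sides are then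
   false, the right one because [B] has no entries. *)
destruct (Nat.eq_dec (length B) 0) as [e|e].
{ apply length_zero_iff_nil in e; subst B; rewrite pmul_nilr; simpl.
  destruct i; simpl; split; try discriminate; intros [a [b [_ [h _]]]]; discriminate. }
revert i; induction A as [|a A IH]; intros i.
- split; [destruct i; discriminate|].
  intros [a [b [h _]]]; destruct (i / length B); discriminate.
- rewrite pmul_cons, pmul_lmono.
  destruct (Nat.lt_ge_cases i (length B)) as [h|h].
  + rewrite nth_error_app1 by (rewrite length_map; exact h).
    rewrite nth_error_map, Nat.div_small, Nat.mod_small by exact h; simpl.
    destruct (nth_error B i) as [b|]; simpl; split.
    * intros [= <-]; exists a, b; auto.
    * intros [a' [b' [[= <-] [[= <-] ->]]]]; reflexivity.
    * discriminate.
    * intros [a' [b' [_ [h' _]]]]; discriminate.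
  + rewrite nth_error_app2 by (rewrite length_map; exact h).
    rewrite length_map, IH.
    assert (E : i = 1 * length B + (i - length B)) by lia.
    assert (E1 : i / length B = S ((i - length B) / length B))
      by (rewrite E at 1; apply Nat.div_add_l, e).
    assert (E2 : i mod length B = (i - length B) mod length B)
      by (rewrite E at 1; rewrite Nat.add_comm; apply Nat.Div0.mod_add).
    rewrite E1, E2; reflexivity.
Qed.

Lemma length_pmul A B : length (pmul A B) = length A * length B.
Proof.
induction A as [|a A IH]; [reflexivity|].
rewrite pmul_cons, length_app, pmul_lmono, length_map, IH; reflexivity.
Qed.

Definition fprod (n m : nat) f g i : nat :=
  f (i / n) * m + g (i mod n).

Lemma isfun_prod A B A' B' f g R S (n m : nat) :
  isfun A B f R -> isfun A' B' g S -> n = length A' -> m = length B' ->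
  isfun (pmul A A') (pmul B B') (fprod n m f g) (rkron n m R S).
Proof.
intros [hl hR] [hl' hS] -> ->; split.
- intros i w hw; apply nth_pmul in hw; destruct hw as [a [b [ha [hb ->]]]].
  apply nth_pmul; exists a, b; unfold fprod; cbv beta.
  assert (g (i mod length A') < length B') by (eapply nth_error_lt, hl', hb).
  rewrite div_pair, mod_pair by assumption; auto.
- rewrite hR, hS; intros i j c; unfold rkron, rfun, fprod; split.
  + intros [x [y [[a [ha [h1 hx]]] [[b [hb [h2 hy]]] hc]]]].
    exists (a ++ b); split; [|split].
    * apply nth_pmul; exists a, b; auto.
    * rewrite <- h1, <- h2; apply pair_div_mod.
    * apply (cl_trans hc), (cl_trans (cl_ten hx hy)), (cl_ceq (ceq_ten_id a b)).
  + intros [w [hw [-> hc]]]; apply nth_pmul in hw; destruct hw as [a [b [ha [hb ->]]]].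
    assert (g (i mod length A') < length B') by (eapply nth_error_lt, hl', hb).
    exists (cid a), (cid b); split; [|split].
    * exists a; splits; [apply div_pair; trivial | apply (cl_refl (ctyped_ids a))].
    * exists b; splits; [apply mod_pair; trivial | apply (cl_refl (ctyped_ids b))].
    * apply (cl_trans hc), (cl_ceq (ceq_sym (ceq_ten_id a b))).
Qed.


Lemma nth_error_nth_lt (X : Type) (l : list X) i (d : X) :
  i < length l -> nth_error l i = Some (nth i l d).
Proof. intros h; apply nth_error_nth'; exact h. Qed.

Lemma nth_error_nth_eq (X : Type) (l : list X) i (a d : X) :
  nth_error l i = Some a -> nth i l d = a.
Proof. intros h; apply nth_error_nth, h. Qed.

Lemma is_mat_typed P Q R i j c :
  is_mat P Q R -> R i j c -> ctyped c (nth i P []) (nth j Q []).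
Proof.
intros [h _] hR; apply h in hR; destruct hR as [a [b [h1 [h2 h3]]]].
rewrite (nth_error_nth_eq _ h1), (nth_error_nth_eq _ h2); exact h3.
Qed.

Lemma is_mat_intro P Q R :
  (forall i j c, R i j c -> i < length P /\ j < length Q /\
     ctyped c (nth i P []) (nth j Q [])) ->
  (forall i j, exists L, forall c, R i j c <-> exists2 d, In d L & cl c d) ->
  is_mat P Q R.
Proof.
intros h1 h2; split; [|exact h2].
intros i j c h; apply h1 in h; destruct h as [hi [hj h]].
exists (nth i P []), (nth j Q []); splits; apply nth_error_nth_lt; trivial.
Qed.

Lemma is_mat_comp A B D R S : is_mat A B R -> is_mat B D S -> is_mat A D (rcomp R S).
Proof.
intros hR hS; apply is_mat_intro.
- intros i j c [k [m [n [h1 [h2 h3]]]]].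
  destruct (is_mat_lt hR h1), (is_mat_lt hS h2); splits.
  apply (cl_typedl h3); apply ctyped_comp with (V := nth k B []);
    [apply (is_mat_typed hR h1) | apply (is_mat_typed hS h2)].
- intros i j.
  (* Generators for the union over the first [N] middle positions: each further position contributes
     all composites of a generator of [R] with a generator of [S]. *)
  assert (E : forall N, N <= length B -> exists L, forall c,
    (exists k m n, k < N /\ R i k m /\ S k j n /\ cl c (ccomp m n))
    <-> exists2 d, In d L & cl c d).
  { induction N as [|N IH]; intros hN.
    - exists []; intros c; split; [intros [k [_ [_ [h _]]]]; lia | intros [d [] _]].
    - destruct (IH ltac:(lia)) as [L hL].
      destruct (proj2 hR i N) as [L1 h1], (proj2 hS N j) as [L2 h2].
      exists (map (fun p => ccomp (fst p) (snd p)) (list_prod L1 L2) ++ L).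
      intros c; split.
      + intros [k [m [n [hk [a1 [a2 a3]]]]]].
        destruct (Nat.eq_dec k N) as [->|e].
        * pose proof (is_mat_typed hR a1) as tm; pose proof (is_mat_typed hS a2) as tn.
          apply h1 in a1; apply h2 in a2; destruct a1 as [m' im lm], a2 as [n' ini ln].
          exists (ccomp m' n').
          -- apply in_or_app; left; apply in_map_iff; exists (m', n'); split; trivial.
             apply in_prod; trivial.
          -- eapply cl_comp_inv; [exact a3 | exact lm | exact ln | |].
             ++ apply (cl_typedr lm tm).
             ++ apply (cl_typedr ln tn).
        * assert (a : exists2 d, In d L & cl c d)
            by (apply hL; exists k, m, n; split; [lia | auto]).
          destruct a as [d id ld]; exists d; trivial; apply in_or_app; auto.
      + intros [d id ld]; apply in_app_or in id; destruct id as [id|id].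
        * apply in_map_iff in id; destruct id as [[m n] [<- imn]]; simpl in *.
          apply in_prod_iff in imn; destruct imn as [im ini].
          (* The lists [L1] and [L2] may contain ill-typed terms. That something lies below this
             composite shows that it is typed, hence that [m] and [n] belong to [R] and [S]. *)
          assert (T : exists U V, ctyped (ccomp m n) U V)
            by (destruct ld as [U [V [_ [t _]]]]; eauto).
          destruct T as [U [V T]]; inversion T; subst.
          exists N, m, n; split; [lia | split; [|split]]; trivial.
          -- apply h1; exists m; trivial; eapply cl_refl; eassumption.
          -- apply h2; exists n; trivial; eapply cl_refl; eassumption.
        * destruct (proj2 (hL c)) as [k [m [n [hk h]]]]; [exists d; trivial|].
          exists k, m, n; split; [lia | exact h]. }
  destruct (E (length B) (le_n _)) as [L hL]; exists L; intros c; rewrite <- hL.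
  split; intros [k [m [n h]]]; exists k, m, n; [|tauto].
  split; [apply (is_mat_lt hR (proj1 h)) | exact h].
Qed.

Lemma nth_appl (X : Type) (l l' : list X) i (d : X) :
  i < length l -> nth i (l ++ l') d = nth i l d.
Proof. apply app_nth1. Qed.

Lemma nth_appr (X : Type) (l l' : list X) i (d : X) :
  length l <= i -> nth i (l ++ l') d = nth (i - length l) l' d.
Proof. apply app_nth2. Qed.

Lemma is_mat_sum A B A' B' R S :
  is_mat A B R -> is_mat A' B' S ->
  is_mat (A ++ A') (B ++ B') (rdsum (length A) (length B) R S).
Proof.
intros hR hS; apply is_mat_intro.
- rewrite !length_app; intros i j c [[h1 [h2 h3]] | [h1 [h2 h3]]].
  + split; [|split]; try lia; rewrite !nth_appl by assumption; apply (is_mat_typed hR h3).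
  + destruct (is_mat_lt hS h3); split; [|split]; try lia.
    rewrite !nth_appr by assumption; apply (is_mat_typed hS h3).
- intros i j; unfold rdsum.
  destruct (Nat.lt_ge_cases i (length A)) as [hi|hi],
    (Nat.lt_ge_cases j (length B)) as [hj|hj].
  + destruct (proj2 hR i j) as [L hL]; exists L; intros c; rewrite <- hL; intuition lia.
  + exists []; intros c; split; [intuition lia | intros [d [] _]].
  + exists []; intros c; split; [intuition lia | intros [d [] _]].
  + destruct (proj2 hS (i - length A) (j - length B)) as [L hL]; exists L; intros c;
      rewrite <- hL; intuition lia.
Qed.

Lemma nth_pair A B (x y : nat) :
  x < length A -> y < length B ->
  nth (x * length B + y) (pmul A B) [] = nth x A [] ++ nth y B [].
Proof.
intros hx hy; apply nth_error_nth_eq, nth_pmul.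
exists (nth x A []), (nth y B []); rewrite div_pair, mod_pair by assumption.
splits; apply nth_error_nth_lt; trivial.
Qed.

Lemma is_mat_prod A B A' B' R S :
  is_mat A B R -> is_mat A' B' S ->
  is_mat (pmul A A') (pmul B B') (rkron (length A') (length B') R S).
Proof.
intros hR hS; apply is_mat_intro.
- intros i j c [x [y [h1 [h2 h3]]]].
  destruct (is_mat_lt hR h1), (is_mat_lt hS h2).
  rewrite !length_pmul, (pair_div_mod (length A') i), (pair_div_mod (length B') j).
  split; [apply pair_lt; assumption | split; [apply pair_lt; assumption|]].
  rewrite !nth_pair by assumption.
  apply (cl_typedl h3); constructor; [apply (is_mat_typed hR h1) | apply (is_mat_typed hS h2)].
- intros i j.
  destruct (proj2 hR (i / length A') (j / length B')) as [L1 h1],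
    (proj2 hS (i mod length A') (j mod length B')) as [L2 h2].
  exists (map (fun p => cten (fst p) (snd p)) (list_prod L1 L2)); intros c; split.
  + intros [x [y [a1 [a2 a3]]]]; apply h1 in a1; apply h2 in a2.
    destruct a1 as [x' ix lx], a2 as [y' iy ly]; exists (cten x' y').
    * apply in_map_iff; exists (x', y'); split; trivial; apply in_prod; trivial.
    * apply (cl_trans a3 (cl_ten lx ly)).
  + intros [d id ld]; apply in_map_iff in id; destruct id as [[x y] [<- ixy]]; simpl in *.
    apply in_prod_iff in ixy; destruct ixy as [ix iy].
    assert (T : exists U V, ctyped (cten x y) U V)
      by (destruct ld as [U [V [_ [t _]]]]; eauto).
    destruct T as [U [V T]]; inversion T; subst.
    exists x, y; splits.
    * apply h1; exists x; trivial; eapply cl_refl; eassumption.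
    * apply h2; exists y; trivial; eapply cl_refl; eassumption.
Qed.

(** ** Laws of composition, sum and Kronecker product *)

Lemma raw_empty_src Q R S : is_mat [] Q R -> is_mat [] Q S -> requ R S.
Proof.
intros hR hS i j c; split; intros h; [apply (is_mat_lt hR) in h | apply (is_mat_lt hS) in h];
  simpl in h; lia.
Qed.

Lemma raw_empty_tgt P R S : is_mat P [] R -> is_mat P [] S -> requ R S.
Proof.
intros hR hS i j c; split; intros h; [apply (is_mat_lt hR) in h | apply (is_mat_lt hS) in h];
  simpl in h; lia.
Qed.

Lemma raw_comp_assoc A B D E R S T :
  is_mat A B R -> is_mat B D S -> is_mat D E T ->
  requ (rcomp (rcomp R S) T) (rcomp R (rcomp S T)).
Proof.
intros hR hS hT i j c; split.
- intros [k [m [p [[l [m1 [n [h1 [h2 h3]]]]] [h4 h5]]]]].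
  pose proof (is_mat_typed hR h1); pose proof (is_mat_typed hS h2);
    pose proof (is_mat_typed hT h4).
  exists l, m1, (ccomp n p); splits.
  + exists k, n, p; splits; eapply cl_refl; eauto using ctyped.
  + eapply cl_trans; [|eapply cl_ceq, ceq_assoc; eassumption].
    eapply cl_comp_inv; [exact h5 | exact h3 | eapply cl_refl | | ]; eauto using ctyped.
- intros [l [m [p [h1 [[k [n [q [h2 [h3 h4]]]]] h5]]]]].
  pose proof (is_mat_typed hR h1); pose proof (is_mat_typed hS h2);
    pose proof (is_mat_typed hT h3).
  exists k, (ccomp m n), q; splits.
  + exists l, m, n; splits; eapply cl_refl; eauto using ctyped.
  + eapply cl_trans; [|eapply cl_ceq, ceq_sym, ceq_assoc; eassumption].
    eapply cl_comp_inv; [exact h5 | eapply cl_refl | exact h4 | | ]; eauto using ctyped.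
Qed.

Lemma raw_idl A B R : is_mat A B R -> requ (rcomp (rid A) R) R.
Proof.
intros hR i j c; rewrite (fun_pre i j c (isfun_id A) hR).
split; [tauto | intros h; split; trivial; apply (is_mat_lt hR h)].
Qed.

Lemma raw_idr A B R : is_mat A B R -> requ (rcomp R (rid B)) R.
Proof.
intros hR i j c; rewrite (fun_post i j c hR (isfun_id B)).
split; [intros [k [h ->]]; exact h | intros h; exists j; auto].
Qed.

Ltac reindex H :=
  match type of H with ?R ?i ?j ?c =>
    match goal with |- _ ?i' ?j' _ =>
      replace i' with i by lia; replace j' with j by lia; exact H end end.

Lemma raw_sum_comp A B D A' B' D' R S R' S' :
  is_mat A B R -> is_mat B D S -> is_mat A' B' R' -> is_mat B' D' S' ->
  requ (rdsum (length A) (length D) (rcomp R S) (rcomp R' S'))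
    (rcomp (rdsum (length A) (length B) R R') (rdsum (length B) (length D) S S')).
Proof.
intros hR hS hR' hS' i j c; split.
- intros [[hi [hj [k [m [n [h1 [h2 h3]]]]]]] | [hi [hj [k [m [n [h1 [h2 h3]]]]]]]].
  + destruct (is_mat_lt hR h1).
    exists k, m, n; split; [left; auto | split; [left; auto | exact h3]].
  + exists (length B + k), m, n; split; [|split; [|exact h3]]; right.
    * split; [|split]; try lia; reindex h1.
    * split; [|split]; try lia; reindex h2.
- intros [k [m [n [[[h1 [h2 h3]]|[h1 [h2 h3]]] [[[h4 [h5 h6]]|[h4 [h5 h6]]] h7]]]]]; try lia.
  + left; splits; exists k, m, n; auto.
  + right; splits; exists (k - length B), m, n; auto.
Qed.

Lemma raw_sum_assoc (n m n' m' : nat) R S T :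
  requ (rdsum (n + n') (m + m') (rdsum n m R S) T) (rdsum n m R (rdsum n' m' S T)).
Proof.
intros i j c; split.
- intros [[h1 [h2 [[h3 [h4 h5]]|[h3 [h4 h5]]]]] | [h1 [h2 h3]]].
  + left; auto.
  + right; splits; left; splits; lia.
  + right; split; [|split]; try lia; right; split; [|split]; try lia; reindex h3.
- intros [[h1 [h2 h3]] | [h1 [h2 [[h3 [h4 h5]]|[h3 [h4 h5]]]]]].
  + left; split; [|split]; try lia; left; auto.
  + left; split; [|split]; try lia; right; auto.
  + right; split; [|split]; try lia; reindex h5.
Qed.

Lemma raw_sum_unitl (R Z : raw) : requ (rdsum 0 0 Z R) R.
Proof.
intros i j c; split.
- intros [[h _] | [_ [_ h]]]; [lia | reindex h].
- intros h; right; split; [|split]; try lia; reindex h.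
Qed.

Lemma raw_sum_unitr A B (R Z : raw) :
  is_mat A B R -> is_mat [] [] Z -> requ (rdsum (length A) (length B) R Z) R.
Proof.
intros hR hZ i j c; split.
- intros [[_ [_ h]] | [_ [_ h]]]; [exact h | apply (is_mat_lt hZ) in h; simpl in h; lia].
- intros h; left; destruct (is_mat_lt hR h); auto.
Qed.

Definition fbraid (n m i : nat) : nat := if i <? n then m + i else i - n.

Lemma lab_braid A B : lab (A ++ B) (B ++ A) (fbraid (length A) (length B)).
Proof.
intros i a; unfold fbraid; destruct (Nat.ltb_spec i (length A)) as [h|h].
- rewrite nth_error_app1 by exact h; apply nth_error_appr.
- rewrite nth_error_app2 by exact h; apply nth_error_appl.
Qed.

Lemma raw_braid_nat A B A' B' (R S X Y : raw) :
  is_mat A B R -> is_mat A' B' S ->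
  isfun (A ++ A') (A' ++ A) (fbraid (length A) (length A')) X ->
  isfun (B ++ B') (B' ++ B) (fbraid (length B) (length B')) Y ->
  requ (rcomp (rdsum (length A) (length B) R S) Y)
    (rcomp X (rdsum (length A') (length B') S R)).
Proof.
intros hR hS hX hY i j c.
rewrite (fun_post i j c (is_mat_sum hR hS) hY), (fun_pre i j c hX (is_mat_sum hS hR)).
unfold rdsum, fbraid; rewrite length_app; split.
- intros [k [[[h1 [h2 h3]]|[h1 [h2 h3]]] ->]]; cases_ltb.
  + split; [lia|]; right; split; [|split]; try lia; reindex h3.
  + destruct (is_mat_lt hS h3); split; [lia|]; left; split; [|split]; try lia; exact h3.
- intros [hi h]; destruct (Nat.ltb_spec i (length A)) as [hA|hA];
    destruct h as [[h1 [h2 h3]]|[h1 [h2 h3]]]; try lia.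
  + destruct (is_mat_lt hR h3); exists (j - length B'); split.
    * left; splits; reindex h3.
    * cases_ltb; lia.
  + exists (j + length B); split.
    * right; split; [|split]; try lia; reindex h3.
    * cases_ltb; lia.
Qed.

(** Folds two copies of [n] positions onto one. It is the map of the codiagonal, and its transpose
    is the diagonal. *)
Definition fdiag (n i : nat) : nat := if i <? n then i else i - n.

Lemma lab_diag A : lab (A ++ A) A (fdiag (length A)).
Proof.
intros i a; unfold fdiag; destruct (Nat.ltb_spec i (length A)) as [h|h].
- rewrite nth_error_app1 by exact h; trivial.
- rewrite nth_error_app2 by exact h; trivial.
Qed.

Lemma raw_diag_nat A B (R X Y : raw) :
  is_mat A B R ->
  isfun (A ++ A) A (fdiag (length A)) (rtr X) ->
  isfun (B ++ B) B (fdiag (length B)) (rtr Y) ->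
  requ (rcomp R Y) (rcomp X (rdsum (length A) (length B) R R)).
Proof.
intros hR hX hY i j c.
rewrite (cofun_post i j c hR hY), (cofun_pre i j c hX (is_mat_sum hR hR)).
unfold rdsum, fdiag; rewrite length_app; split.
- intros [hj h]; destruct (is_mat_lt hR h); destruct (Nat.ltb_spec j (length B)).
  + exists i; cases_ltb; split; trivial.
    left; auto.
  + exists (length A + i); cases_ltb.
    split; [lia|]; right; split; [|split]; try lia; reindex h.
- intros [k [-> [[h1 [h2 h3]]|[h1 [h2 h3]]]]]; cases_ltb;
    destruct (is_mat_lt hR h3); (split; [lia | exact h3]).
Qed.

Lemma raw_codiag_nat A B (R X Y : raw) :
  is_mat A B R ->
  isfun (A ++ A) A (fdiag (length A)) X ->
  isfun (B ++ B) B (fdiag (length B)) Y ->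
  requ (rcomp X R) (rcomp (rdsum (length A) (length B) R R) Y).
Proof.
intros hR hX hY i j c.
rewrite (fun_pre i j c hX hR), (fun_post i j c (is_mat_sum hR hR) hY).
unfold rdsum, fdiag; rewrite length_app; split.
- intros [hi h]; destruct (is_mat_lt hR h); destruct (Nat.ltb_spec i (length A)).
  + exists j; cases_ltb; split; trivial.
    left; auto.
  + exists (length B + j); cases_ltb.
    split; [|lia]; right; split; [|split]; try lia; reindex h.
- intros [k [[[h1 [h2 h3]]|[h1 [h2 h3]]] ->]]; cases_ltb;
    destruct (is_mat_lt hR h3); (split; [lia | exact h3]).
Qed.

Lemma raw_prod_comp A B D A' B' D' R S R' S' :
  is_mat A B R -> is_mat B D S -> is_mat A' B' R' -> is_mat B' D' S' ->
  requ (rkron (length A') (length D') (rcomp R S) (rcomp R' S'))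
    (rcomp (rkron (length A') (length B') R R') (rkron (length B') (length D') S S')).
Proof.
intros hR hS hR' hS' i j c; split.
- intros [x [y [[k [m [n [h1 [h2 h3]]]]] [[k' [m' [n' [h1' [h2' h3']]]]] h]]]].
  pose proof (is_mat_typed hR h1); pose proof (is_mat_typed hS h2);
  pose proof (is_mat_typed hR' h1'); pose proof (is_mat_typed hS' h2').
  destruct (is_mat_lt hR' h1').
  exists (k * length B' + k'), (cten m m'), (cten n n'); split; [|split].
  + exists m, m'; rewrite div_pair, mod_pair by assumption.
    splits; eapply cl_refl; eauto using ctyped.
  + exists n, n'; rewrite div_pair, mod_pair by assumption.
    splits; eapply cl_refl; eauto using ctyped.
  + apply (cl_trans h), (cl_trans (cl_ten h3 h3')).
    eapply cl_ceq, ceq_interchange; eassumption.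
- intros [k [m [n [[x [x' [h1 [h1' h3]]]] [[y [y' [h2 [h2' h4]]]] h]]]]].
  pose proof (is_mat_typed hR h1); pose proof (is_mat_typed hS h2);
  pose proof (is_mat_typed hR' h1'); pose proof (is_mat_typed hS' h2').
  exists (ccomp x y), (ccomp x' y'); split; [|split].
  + exists (k / length B'), x, y; splits; eapply cl_refl; eauto using ctyped.
  + exists (k mod length B'), x', y'; splits;
      eapply cl_refl; eauto using ctyped.
  + eapply cl_trans; [|eapply cl_ceq, ceq_sym, ceq_interchange; eassumption].
    eapply cl_comp_inv; [exact h | exact h3 | exact h4 | |]; eauto using ctyped.
Qed.

Lemma raw_prod_assoc A B A' B' A'' B'' R S T :
  is_mat A B R -> is_mat A' B' S -> is_mat A'' B'' T ->
  requ (rkron (length A'') (length B'') (rkron (length A') (length B') R S) T)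
    (rkron (length A' * length A'') (length B' * length B'') R
      (rkron (length A'') (length B'') S T)).
Proof.
intros hR hS hT i j c; split.
- intros [xy [z [[x [y [h1 [h2 h3]]]] [h4 h5]]]].
  pose proof (is_mat_typed hR h1); pose proof (is_mat_typed hS h2);
  pose proof (is_mat_typed hT h4); destruct (is_mat_lt hT h4).
  rewrite !div_div in h1; rewrite !div_mod_swap in h2 by lia.
  rewrite (mod_mod_mul i (length A')), (mod_mod_mul j (length B')) in h4 by lia.
  exists x, (cten y z); splits.
  + exists y, z; splits; eapply cl_refl; eauto using ctyped.
  + apply (cl_trans h5); eapply cl_trans; [|eapply cl_ceq, ceq_ten_assoc; eassumption].
    apply cl_ten; trivial; eapply cl_refl; eassumption.
- intros [x [yz [h1 [[y [z [h2 [h3 h4]]]] h5]]]].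
  pose proof (is_mat_typed hR h1); pose proof (is_mat_typed hS h2);
  pose proof (is_mat_typed hT h3); destruct (is_mat_lt hT h3).
  rewrite <- !div_div in h1; rewrite <- !div_mod_swap in h2 by lia.
  rewrite <- !mod_mod_mul in h3 by lia.
  exists (cten x y), z; splits.
  + exists x, y; splits; eapply cl_refl; eauto using ctyped.
  + apply (cl_trans h5); eapply cl_trans;
      [|eapply cl_ceq, ceq_sym, ceq_ten_assoc; eassumption].
    apply cl_ten; trivial; eapply cl_refl; eassumption.
Qed.

(** Meant for a [k] that tensors with the identity of a monomial: the result is then the Kronecker
    product with a one by one identity matrix, on which the positions do not move ([rkron_left],
    [rkron_right]). *)
Definition rmap (k : cterm -> cterm) R : raw := fun i j c =>
  exists d, R i j d /\ cl c (k d).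

Lemma rkron_left U P Q R :
  is_mat P Q R ->
  requ (rmap (cten (cid U)) R)
    (rkron (length P) (length Q) (rid [U]) R).
Proof.
intros hR i j c; split.
- intros [d [hd hc]]; destruct (is_mat_lt hR hd).
  exists (cid U), d; rewrite !Nat.div_small, !Nat.mod_small by assumption.
  splits; exists U; splits.
  apply (cl_refl (ctyped_ids U)).
- intros [x [y [[a [h1 [h2 h3]]] [h4 h5]]]].
  pose proof (is_mat_typed hR h4) as ty; destruct (is_mat_lt hR h4).
  pose proof (nth_error_lt h1) as h0; simpl in h0.
  assert (ei : i / length P = 0) by lia; rewrite ei in *.
  injection h1 as <-.
  assert (hi : i mod length P = i)
    by (pose proof (pair_div_mod (length P) i); rewrite ei in *; lia).
  assert (hj : j mod length Q = j)
    by (pose proof (pair_div_mod (length Q) j); rewrite h2 in *; lia).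
  rewrite hi, hj in *; exists y; split; trivial.
  apply (cl_trans h5), cl_ten; trivial; apply (cl_refl ty).
Qed.

Lemma rkron_right U P Q R :
  is_mat P Q R ->
  requ (rmap (fun c => cten c (cid U)) R) (rkron 1 1 R (rid [U])).
Proof.
intros hR i j c; unfold rkron; rewrite !Nat.div_1_r, !Nat.mod_1_r; split.
- intros [d [hd hc]]; exists d, (cid U); splits.
  exists U; splits; apply (cl_refl (ctyped_ids U)).
- intros [x [y [h4 [[a [h1 [_ h3]]] h5]]]]; pose proof (is_mat_typed hR h4) as tx.
  injection h1 as <-; exists x; split; trivial.
  apply (cl_trans h5), cl_ten; trivial; apply (cl_refl tx).
Qed.

Lemma rmap_unit A B (k : cterm -> cterm) R :
  is_mat A B R -> (forall c U V, ctyped c U V -> ceq U V (k c) c) -> requ (rmap k R) R.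
Proof.
intros hR hk i j c; split.
- intros [d [hd hc]]; apply (is_mat_down hR hd), (cl_trans hc).
  apply (cl_ceq (hk _ _ _ (is_mat_typed hR hd))).
- intros hc; exists c; split; trivial.
  apply (cl_ceq (ceq_sym (hk _ _ _ (is_mat_typed hR hc)))).
Qed.

Lemma raw_prod_unitl A B R :
  is_mat A B R -> requ (rkron (length A) (length B) (rid [[]]) R) R.
Proof.
intros hR; rewrite <- (rkron_left [] hR); apply (rmap_unit hR).
intros c U V; apply ceq_unitl.
Qed.

Lemma raw_prod_unitr A B R : is_mat A B R -> requ (rkron 1 1 R (rid [[]])) R.
Proof.
intros hR; rewrite <- (rkron_right [] hR); apply (rmap_unit hR).
intros c U V; apply ceq_unitr.
Qed.

(** ** Matrices of labelled position maps *)

(** The symmetry of the Kronecker product still has one nonempty entry per source position, but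
    generated by a symmetry of diagrams instead of an identity. Hence this generalisation of [rfun],
    with a diagram [l i] at each position. *)
Definition rlf (n : nat) f (l : nat -> cterm) : raw := fun i j c =>
  i < n /\ j = f i /\ cl c (l i).

Definition islf A B f (l : nat -> cterm) R : Prop :=
  (forall i, i < length A ->
     f i < length B /\ ctyped (l i) (nth i A []) (nth (f i) B [])) /\
  requ R (rlf (length A) f l).

Lemma islf_fun A B f R : isfun A B f R -> islf A B f (fun i => cid (nth i A [])) R.
Proof.
intros [hl h]; split.
- intros i hi; split; [apply (lab_lt hl hi)|].
  rewrite (nth_error_nth_eq [] (hl _ _ (nth_error_nth_lt [] hi))); constructor.
- rewrite h; intros i j c; split.
  + intros [a [h1 h2]]; pose proof (nth_error_lt h1).
    apply (nth_error_nth_eq []) in h1; subst a; split; assumption.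
  + intros [h1 h2]; exists (nth i A []); split; trivial; apply nth_error_nth_lt, h1.
Qed.

Lemma is_mat_lf A B f (l : nat -> cterm) R : islf A B f l R -> is_mat A B R.
Proof.
intros [hl h]; apply (is_mat_requ (R := rlf (length A) f l)); [symmetry; exact h|].
apply is_mat_intro.
- intros i j c [h1 [-> h2]]; destruct (hl i h1); splits.
  apply (cl_typedl h2); trivial.
- intros i j; destruct (Nat.lt_ge_cases i (length A)) as [hi|hi];
    [destruct (Nat.eq_dec j (f i)) as [e|e]|].
  + exists [l i]; intros c; split.
    * intros [_ [_ hc]]; exists (l i); simpl; auto.
    * intros [d [<-|[]] hd]; split; auto.
  + exists []; intros c; split; [intros [_ [? _]]; contradiction | intros [d [] _]].
  + exists []; intros c; split; [intros [? _]; lia | intros [d [] _]].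
Qed.

Lemma lf_pre A B D f (l : nat -> cterm) S R i j c :
  islf A B f l S -> is_mat B D R ->
  rcomp S R i j c <-> i < length A /\ exists n, R (f i) j n /\ cl c (ccomp (l i) n).
Proof.
intros [hl h] hR; split.
- intros [k [m [n [h1 [h2 h3]]]]]; apply (h i k m) in h1; destruct h1 as [hi [-> hm]].
  split; trivial; exists n; split; trivial.
  pose proof (is_mat_typed hR h2) as t; destruct (hl i hi).
  eapply cl_comp_inv; [exact h3 | exact hm | eapply cl_refl | |]; eassumption.
- intros [hi [n [hn hc]]]; exists (f i), (l i), n; splits.
  apply h; splits; destruct (hl i hi); eapply cl_refl; eassumption.
Qed.

Lemma lf_post A B D f (l : nat -> cterm) S R i j c :
  is_mat A B R -> islf B D f l S ->
  rcomp R S i j c <-> exists k m, R i k m /\ j = f k /\ cl c (ccomp m (l k)).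
Proof.
intros hR [hl h]; split.
- intros [k [m [n [h1 [h2 h3]]]]]; apply (h k j n) in h2; destruct h2 as [hk [-> hn]].
  exists k, m; splits.
  pose proof (is_mat_typed hR h1) as t; destruct (hl k hk).
  eapply cl_comp_inv; [exact h3 | eapply cl_refl | exact hn | |]; eassumption.
- intros [k [m [hn [-> hc]]]]; exists k, m, (l k); splits.
  destruct (is_mat_lt hR hn) as [_ hk].
  apply h; splits; destruct (hl k hk); eapply cl_refl; eassumption.
Qed.

Lemma islf_cast A B A' B' f (l : nat -> cterm) R :
  islf A B f l R -> A = A' -> B = B' -> islf A' B' f l R.
Proof. intros h <- <-; exact h. Qed.

Lemma islf_comp A B B' D f g (l l' : nat -> cterm) R S :
  islf A B f l R -> islf B' D g l' S -> B = B' ->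
  islf A D (fun i => g (f i)) (fun i => ccomp (l i) (l' (f i))) (rcomp R S).
Proof.
intros hR hS <-; split.
- intros i hi; destruct (proj1 hR i hi) as [h1 h2]; destruct (proj1 hS (f i) h1) as [h3 h4].
  split; trivial; eauto using ctyped.
- intros i j c; rewrite (lf_pre i j c hR (is_mat_lf hS)).
  destruct hR as [hl hR], hS as [hl' hS]; split.
  + intros [hi [n [hn hc]]]; apply (hS (f i) j n) in hn; destruct hn as [h1 [h2 h3]].
    splits.
    destruct (hl i hi), (hl' (f i) h1).
    eapply cl_comp_inv; [exact hc | eapply cl_refl | exact h3 | |]; eassumption.
  + intros [h1 [-> h2]]; destruct (hl i h1) as [t1 t2]; destruct (hl' (f i) t1).
    split; trivial; exists (l' (f i)); split; trivial.
    apply hS; splits; eapply cl_refl; eassumption.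
Qed.

Lemma islf_prod A B A' B' f g (l l' : nat -> cterm) R S (n m : nat) :
  islf A B f l R -> islf A' B' g l' S -> n = length A' -> m = length B' ->
  islf (pmul A A') (pmul B B') (fprod n m f g) (fun i => cten (l (i / n)) (l' (i mod n)))
    (rkron n m R S).
Proof.
intros [hl hR] [hl' hS] -> ->; split.
- intros i; rewrite !length_pmul; intros hi; apply pair_ex in hi.
  destruct hi as [x [y [hx [hy ->]]]]; unfold fprod; rewrite div_pair, mod_pair by assumption.
  destruct (hl x hx), (hl' y hy); split; [apply pair_lt; assumption|].
  rewrite !nth_pair by assumption; constructor; assumption.
- rewrite hR, hS; intros i j c; unfold rkron, rlf, fprod; rewrite length_pmul; split.
  + intros [x [y [[h1 [h2 h3]] [[h4 [h5 h6]] h7]]]].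
    split; [|split].
    * rewrite (pair_div_mod (length A') i); apply pair_lt; assumption.
    * rewrite <- h2, <- h5; apply pair_div_mod.
    * apply (cl_trans h7 (cl_ten h3 h6)).
  + intros [hi [-> hc]]; apply pair_ex in hi; destruct hi as [x [y [hx [hy ->]]]].
    rewrite !(div_pair x hy), !(mod_pair x hy) in *.
    destruct (hl x hx), (hl' y hy).
    exists (l x), (l' y); rewrite !div_pair, !mod_pair by assumption.
    splits; (splits; eapply cl_refl; eassumption).
Qed.

Lemma islf_eq A B A' B' f g (l l' : nat -> cterm) R S :
  islf A B f l R -> islf A' B' g l' S -> A = A' -> B = B' ->
  (forall i, i < length A -> f i = g i) ->
  (forall i, i < length A -> ceq (nth i A []) (nth (f i) B []) (l i) (l' i)) ->
  requ R S.
Proof.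
intros [hl hR] [hl' hS] <- <- e el; rewrite hR, hS; intros i j c; unfold rlf.
split; intros [h1 [-> h2]]; split; trivial.
- rewrite e by exact h1; split; trivial; apply (cl_trans h2), (cl_ceq (el i h1)).
- rewrite e by exact h1; split; trivial; apply (cl_trans h2), (cl_ceq (ceq_sym (el i h1))).
Qed.

(** Transposition of an [n] by [m] grid listed row by row: the coordinates [x, y] become [y, x]
    ([fpbraid_pair]). *)
Definition fpbraid (n m i : nat) : nat := (i mod m) * n + i / m.

Definition lpbraid A B i : cterm :=
  csym (nth (i / length B) A []) (nth (i mod length B) B []).

Definition rpbraid A B : raw :=
  rlf (length A * length B) (fpbraid (length A) (length B)) (lpbraid A B).

Lemma islf_pbraid A B :
  islf (pmul A B) (pmul B A) (fpbraid (length A) (length B)) (lpbraid A B) (rpbraid A B).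
Proof.
split.
- intros i; rewrite !length_pmul; intros hi; apply pair_ex in hi.
  destruct hi as [x [y [hx [hy ->]]]]; unfold fpbraid, lpbraid.
  rewrite div_pair, mod_pair by assumption; split; [apply pair_lt; assumption|].
  rewrite !nth_pair by assumption; constructor.
- rewrite length_pmul; reflexivity.
Qed.

Lemma raw_pbraid_nat A B A' B' R S :
  is_mat A B R -> is_mat A' B' S ->
  requ (rcomp (rkron (length A') (length B') R S) (rpbraid B B'))
    (rcomp (rpbraid A A') (rkron (length A) (length B) S R)).
Proof.
intros hR hS i j c.
rewrite (lf_post i j c (is_mat_prod hR hS) (islf_pbraid B B')),
  (lf_pre i j c (islf_pbraid A A') (is_mat_prod hS hR)).
rewrite length_pmul; unfold rkron, fpbraid, lpbraid; split.
- intros [k [m [[x [y [h1 [h2 h3]]]] [-> h4]]]].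
  destruct (is_mat_lt hR h1), (is_mat_lt hS h2).
  pose proof (is_mat_typed hR h1) as t1; pose proof (is_mat_typed hS h2) as t2.
  split.
  { rewrite (pair_div_mod (length A') i); apply pair_lt; assumption. }
  exists (cten y x); split.
  + exists y, x; rewrite !div_pair, !mod_pair by assumption.
    splits; eapply cl_refl; eauto using ctyped.
  + eapply cl_trans; [|eapply cl_ceq, ceq_sym_nat; eassumption].
    eapply cl_comp_inv; [exact h4 | exact h3 | eapply cl_refl | |]; eauto using ctyped.
- intros [hi [n [[y [x [h2 [h1 h3]]]] h4]]].
  apply pair_ex in hi; destruct hi as [p [q [hp [hq ->]]]].
  rewrite !(div_pair p hq), !(mod_pair p hq), !(div_pair q hp), !(mod_pair q hp) in *.
  destruct (is_mat_lt hR h1), (is_mat_lt hS h2).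
  pose proof (is_mat_typed hR h1) as t1; pose proof (is_mat_typed hS h2) as t2.
  exists ((j mod length B) * length B' + j / length B), (cten x y).
  rewrite !div_pair, !mod_pair by assumption; split; [|split].
  + exists x, y; splits; eapply cl_refl; eauto using ctyped.
  + apply pair_div_mod.
  + eapply cl_trans; [|eapply cl_ceq, ceq_sym, ceq_sym_nat; eassumption].
    eapply cl_comp_inv; [exact h4 | eapply cl_refl | exact h3 | |]; eauto using ctyped.
Qed.

(** The left distributor and its inverse, for polynomials with [n], [b] and [d]
    monomials. *)
Definition fdistl (n b d p : nat) : nat :=
  if p mod (b + d) <? b then p / (b + d) * b + p mod (b + d)
  else n * b + (p / (b + d) * d + (p mod (b + d) - b)).

Definition fdistlV (n b d p : nat) : nat :=
  if p <? n * b then p / b * (b + d) + p mod b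
  else (p - n * b) / d * (b + d) + (b + (p - n * b) mod d).

Lemma fdistl_pairl (n b d x y : nat) : y < b -> fdistl n b d (x * (b + d) + y) = x * b + y.
Proof.
intros h; unfold fdistl; rewrite div_pair, mod_pair by lia.
cases_ltb; lia.
Qed.

Lemma fdistl_pairr (n b d x y : nat) :
  y < d -> fdistl n b d (x * (b + d) + (b + y)) = n * b + (x * d + y).
Proof.
intros h; unfold fdistl; rewrite div_pair, mod_pair by lia.
cases_ltb; lia.
Qed.

Lemma fdistlV_pairl (n b d x y : nat) :
  x < n -> y < b -> fdistlV n b d (x * b + y) = x * (b + d) + y.
Proof.
intros hx hy; unfold fdistlV; rewrite div_pair, mod_pair by lia.
destruct (Nat.ltb_spec (x * b + y) (n * b)); nia.
Qed.

Lemma fdistlV_pairr (n b d x y : nat) :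
  y < d -> fdistlV n b d (n * b + (x * d + y)) = x * (b + d) + (b + y).
Proof.
intros hy; unfold fdistlV.
cases_ltb.
replace (n * b + (x * d + y) - n * b) with (x * d + y) by lia.
rewrite div_pair, mod_pair by lia; reflexivity.
Qed.

Lemma pair_sum_ex (n b d p : nat) :
  p < n * (b + d) ->
  (exists x y, x < n /\ y < b /\ p = x * (b + d) + y) \/
  (exists x y, x < n /\ y < d /\ p = x * (b + d) + (b + y)).
Proof.
intros hp; apply pair_ex in hp; destruct hp as [x [y [hx [hy ->]]]].
destruct (Nat.lt_ge_cases y b).
- left; exists x, y; auto.
- right; exists x, (y - b); split; [|split]; lia.
Qed.

Lemma sum_pair_ex (n b d p : nat) :
  p < n * b + n * d ->
  (exists x y, x < n /\ y < b /\ p = x * b + y) \/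
  (exists x y, x < n /\ y < d /\ p = n * b + (x * d + y)).
Proof.
intros hp; destruct (Nat.lt_ge_cases p (n * b)) as [h|h].
- left; apply pair_ex, h.
- right; destruct (@pair_ex n d (p - n * b)) as [x [y [hx [hy e]]]]; [lia|].
  exists x, y; split; [|split]; lia.
Qed.

Lemma fdistlK (n b d p : nat) : p < n * (b + d) -> fdistlV n b d (fdistl n b d p) = p.
Proof.
intros hp; destruct (pair_sum_ex hp) as [[x [y [hx [hy ->]]]]|[x [y [hx [hy ->]]]]].
- rewrite fdistl_pairl, fdistlV_pairl by assumption; reflexivity.
- rewrite fdistl_pairr, fdistlV_pairr by assumption; reflexivity.
Qed.

Lemma fdistlVK (n b d p : nat) : p < n * b + n * d -> fdistl n b d (fdistlV n b d p) = p.
Proof.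
intros hp; destruct (sum_pair_ex hp) as [[x [y [hx [hy ->]]]]|[x [y [hx [hy ->]]]]].
- rewrite fdistlV_pairl, fdistl_pairl by assumption; reflexivity.
- rewrite fdistlV_pairr, fdistl_pairr by assumption; reflexivity.
Qed.

Lemma lab_distl A B D :
  lab (pmul A (B ++ D)) (pmul A B ++ pmul A D) (fdistl (length A) (length B) (length D)).
Proof.
intros i w hi; pose proof (nth_error_lt hi) as h; rewrite length_pmul, length_app in h.
pose proof (nth_error_nth_eq [] hi) as e; clear hi; subst w.
destruct (pair_sum_ex h) as [[x [y [hx [hy ->]]]]|[x [y [hx [hy ->]]]]];
  rewrite <- length_app, nth_pair by (rewrite ?length_app; lia); rewrite length_app.
- rewrite fdistl_pairl by exact hy; apply nth_error_appl.
  rewrite nth_appl, <- nth_pair by assumption.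
  apply nth_error_nth_lt; rewrite length_pmul; apply pair_lt; assumption.
- rewrite fdistl_pairr by exact hy; rewrite <- length_pmul; apply nth_error_appr.
  rewrite nth_appr by lia.
  replace (length B + y - length B) with y by lia.
  rewrite <- nth_pair by assumption.
  apply nth_error_nth_lt; rewrite length_pmul; apply pair_lt; assumption.
Qed.

Lemma lab_distlV A B D :
  lab (pmul A B ++ pmul A D) (pmul A (B ++ D)) (fdistlV (length A) (length B) (length D)).
Proof.
intros i w hi; pose proof (nth_error_lt hi) as h.
rewrite length_app, !length_pmul in h.
assert (h' : fdistlV (length A) (length B) (length D) i < length (pmul A (B ++ D))).
{ rewrite length_pmul, length_app.
  destruct (sum_pair_ex h) as [[x [y [hx [hy ->]]]]|[x [y [hx [hy ->]]]]];
    rewrite ?fdistlV_pairl, ?fdistlV_pairr by assumption; apply pair_lt; lia. }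
rewrite (nth_error_nth_lt [] h'), <- hi; symmetry.
rewrite <- (fdistlVK h) at 1; apply lab_distl, nth_error_nth_lt, h'.
Qed.

(** Both composites are reindexings, so the claim is about single entries. The positions of the
    second factor lie in the first or in the second summand; the mixed cases vanish because a direct
    sum is empty off the diagonal, and the other two match after computing [fdistl]. *)
Lemma raw_distl_nat A A' B B' D D' (F G H X Y : raw) :
  is_mat A A' F -> is_mat B B' G -> is_mat D D' H ->
  isfun (pmul A (B ++ D)) (pmul A B ++ pmul A D)
    (fdistl (length A) (length B) (length D)) X ->
  isfun (pmul A' (B' ++ D')) (pmul A' B' ++ pmul A' D')
    (fdistl (length A') (length B') (length D')) Y ->
  requ
    (rcomp (rkron (length B + length D) (length B' + length D') F
              (rdsum (length B) (length B') G H)) Y)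
    (rcomp X (rdsum (length A * length B) (length A' * length B')
       (rkron (length B) (length B') F G) (rkron (length D) (length D') F H))).
Proof.
intros hF hG hH hX hY i j c.
pose proof (is_mat_prod hF (is_mat_sum hG hH)) as h1.
pose proof (is_mat_sum (is_mat_prod hF hG) (is_mat_prod hF hH)) as h2.
rewrite !length_app in h1; rewrite !length_pmul in h2.
rewrite (fun_post i j c h1 hY), (fun_pre i j c hX h2).
rewrite length_pmul, length_app; split.
- intros [k [hk ->]]; pose proof (is_mat_lt h1 hk) as [hi hk'].
  rewrite length_pmul, length_app in hi, hk'; split; trivial.
  destruct hk as [x [y [a1 [a2 a3]]]].
  destruct (pair_sum_ex hi) as [[p [q [hp [hq ->]]]]|[p [q [hp [hq ->]]]]];
  destruct (pair_sum_ex hk') as [[p' [q' [hp' [hq' ->]]]]|[p' [q' [hp' [hq' ->]]]]];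
  rewrite !div_pair in a1 by lia; rewrite !mod_pair in a2 by lia;
  destruct a2 as [[b1 [b2 b3]]|[b1 [b2 b3]]]; try lia;
  rewrite ?fdistl_pairl, ?fdistl_pairr by assumption.
  + left; split; [|split]; try (apply pair_lt; assumption).
    exists x, y; rewrite !div_pair, !mod_pair by assumption; auto.
  + right; split; [|split]; try lia.
    exists x, y; rewrite !(Nat.add_comm (_ * _) (_ * _ + _)), !Nat.add_sub,
      !div_pair, !mod_pair by assumption.
    rewrite !(Nat.add_comm (length B)), !(Nat.add_comm (length B')), !Nat.add_sub in b3; auto.
- intros [hi h].
  destruct (pair_sum_ex hi) as [[p [q [hp [hq ->]]]]|[p [q [hp [hq ->]]]]];
    rewrite ?fdistl_pairl, ?fdistl_pairr in h by assumption;
    destruct h as [[b1 [b2 [x [y [b3 [b4 b5]]]]]]|[b1 [b2 [x [y [b3 [b4 b5]]]]]]];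
    try (exfalso; nia).
  + rewrite !div_pair in b3 by lia; rewrite !mod_pair in b4 by lia.
    destruct (is_mat_lt hF b3), (is_mat_lt hG b4).
    (* The preimage of [j] under the distributor, that is, the first branch of [fdistlV]; the other
       case uses the second branch. *)
    exists (j / length B' * (length B' + length D') + j mod length B'); split.
    * exists x, y; rewrite !div_pair, !mod_pair by lia; splits.
      left; auto.
    * rewrite fdistl_pairl by assumption; apply pair_div_mod.
  + rewrite (Nat.add_comm (_ * _) (_ * _ + _)), Nat.add_sub in b3, b4.
    rewrite !div_pair in b3 by lia; rewrite !mod_pair in b4 by lia.
    destruct (is_mat_lt hF b3), (is_mat_lt hH b4).
    set (r := j - length A' * length B') in *.
    exists (r / length D' * (length B' + length D') + (length B' + r mod length D')); split.
    * exists x, y; rewrite !div_pair, !mod_pair by lia; splits.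
      right; split; [|split]; try lia.
      rewrite !(Nat.add_comm (length B)), !(Nat.add_comm (length B')), !Nat.add_sub; exact b4.
    * rewrite fdistl_pairr by assumption; rewrite <- pair_div_mod; lia.
Qed.

(** The second coordinate runs fastest in a product, so the first [length A * length D] positions
    are exactly those whose first coordinate lies in [A]. This is why right distributivity is strict
    while left distributivity permutes. *)
Lemma raw_distr_nat A A' B B' D D' F G H :
  is_mat A A' F -> is_mat B B' G -> is_mat D D' H ->
  requ (rkron (length D) (length D') (rdsum (length A) (length A') F G) H)
    (rdsum (length A * length D) (length A' * length D')
       (rkron (length D) (length D') F H) (rkron (length D) (length D') G H)).
Proof.
intros hF hG hH i j c.
assert (S : forall n d p : nat, 0 < d -> n * d <= p ->
  (p - n * d) / d = p / d - n /\ (p - n * d) mod d = p mod d).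
{ intros n d p hd hp.
  assert (e : p = (p - n * d) + n * d) by lia.
  split.
  - rewrite e at 2; rewrite Nat.div_add by lia; lia.
  - rewrite e at 2; rewrite Nat.Div0.mod_add; reflexivity. }
assert (L : forall n d p : nat, 0 < d -> (p / d < n <-> p < n * d)).
{ intros n d p hd; rewrite (pair_div_mod d p) at 2.
  pose proof (Nat.mod_upper_bound p d ltac:(lia)); nia. }
split.
- intros [x [y [a1 [a2 a3]]]]; destruct (is_mat_lt hH a2).
  pose proof (L (length A) (length D) i ltac:(lia)).
  pose proof (L (length A') (length D') j ltac:(lia)).
  destruct a1 as [[b1 [b2 b3]]|[b1 [b2 b3]]].
  + left; split; [tauto | split; [tauto|]]; exists x, y; auto.
  + right; split; [lia | split; [lia|]]; exists x, y.
    destruct (S (length A) (length D) i) as [-> ->]; [lia|lia|].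
    destruct (S (length A') (length D') j) as [-> ->]; [lia|lia|]; auto.
- intros [[a1 [a2 [x [y [b1 [b2 b3]]]]]]|[a1 [a2 [x [y [b1 [b2 b3]]]]]]];
    destruct (is_mat_lt hH b2).
  + destruct (is_mat_lt hF b1); exists x, y; splits; left; auto.
  + assert (0 < length D) by lia; assert (0 < length D') by lia.
    destruct (S (length A) (length D) i) as [e1 e2]; [lia|lia|].
    destruct (S (length A') (length D') j) as [e3 e4]; [lia|lia|].
    rewrite e1, e3 in b1; rewrite e2, e4 in b2.
    pose proof (L (length A) (length D) i ltac:(lia)).
    pose proof (L (length A') (length D') j ltac:(lia)).
    exists x, y; splits; right; splits; lia.
Qed.


Lemma pmul_appl (P Q R : poly) : pmul (P ++ Q) R = pmul P R ++ pmul Q R.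
Proof. apply flat_map_app. Qed.

Lemma pmul_onel P : pmul [[]] P = P.
Proof. rewrite pmul_lmono, map_id; reflexivity. Qed.

Lemma pmul_oner P : pmul P [[]] = P.
Proof.
rewrite pmul_rmono; rewrite <- (map_id P) at 2; apply map_ext.
intros U; apply app_nil_r.
Qed.

Lemma pmul_assoc (P Q R : poly) : pmul (pmul P Q) R = pmul P (pmul Q R).
Proof.
induction P as [|U P IH]; [reflexivity|].
rewrite (pmul_cons U P Q), pmul_appl, IH, (pmul_cons U P (pmul Q R)); f_equal.
clear; induction Q as [|V Q IH]; [reflexivity|].
rewrite !pmul_lmono in *; rewrite (pmul_cons V Q R); simpl map at 1.
rewrite (pmul_cons (U ++ V)), map_app, IH; f_equal.
rewrite !pmul_lmono, map_map; apply map_ext; intros W; symmetry; apply app_assoc.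
Qed.


Lemma fpbraid_pair (n m x y : nat) : y < m -> fpbraid n m (x * m + y) = y * n + x.
Proof. intros h; unfold fpbraid; rewrite div_pair, mod_pair; trivial. Qed.

Lemma fprod_pair (n m : nat) f g (x y : nat) :
  y < n -> fprod n m f g (x * n + y) = f x * m + g y.
Proof. intros h; unfold fprod; rewrite div_pair, mod_pair; trivial. Qed.

Lemma fsum_l (n m : nat) f g i : i < n -> fsum n m f g i = f i.
Proof. intros h; unfold fsum; cases_ltb; lia. Qed.

Lemma fsum_r (n m : nat) f g i : fsum n m f g (n + i) = m + g i.
Proof.
unfold fsum; cases_ltb.
rewrite (Nat.add_comm n i), Nat.add_sub; reflexivity.
Qed.

Lemma lpbraid_pair A B (x y : nat) :
  y < length B -> lpbraid A B (x * length B + y) = csym (nth x A []) (nth y B []).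
Proof. intros h; unfold lpbraid; rewrite div_pair, mod_pair; trivial. Qed.

Lemma raw_pbraid_inv A B : requ (rcomp (rpbraid A B) (rpbraid B A)) (rid (pmul A B)).
Proof.
eapply islf_eq;
  [apply (islf_comp (islf_pbraid A B) (islf_pbraid B A) eq_refl)
  | apply islf_fun, isfun_id | reflexivity | reflexivity | | ];
  rewrite length_pmul; intros i hi; apply pair_ex in hi;
  destruct hi as [x [y [hx [hy ->]]]]; rewrite !fpbraid_pair by assumption; trivial.
rewrite !lpbraid_pair, nth_pair by assumption; apply ceq_sym_inv.
Qed.

Lemma raw_pbraid_hex A B D :
  requ (rpbraid A (pmul B D))
    (rcomp (rkron (length D) (length D) (rpbraid A B) (rid D))
       (rkron (length (pmul A D)) (length (pmul D A)) (rid B) (rpbraid A D))).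
Proof.
assert (E : forall i, i < length (pmul (pmul A B) D) ->
  exists x y z, x < length A /\ y < length B /\ z < length D /\
    i = (x * length B + y) * length D + z).
{ intros i hi; rewrite !length_pmul in hi; apply pair_ex in hi.
  destruct hi as [xy [z [hxy [hz ->]]]].
  apply pair_ex in hxy; destruct hxy as [x [y [hx [hy ->]]]]; exists x, y, z; auto. }
(* A triple of coordinates bracketed in both ways: [E1] serves the symmetry with [pmul B D], [E2]
   the middle object of the composite. *)
assert (E1 : forall x y z,
  (x * length B + y) * length D + z = x * length (pmul B D) + (y * length D + z))
  by (intros; rewrite length_pmul; ring).
assert (E2 : forall x y z,
  (y * length A + x) * length D + z = y * length (pmul A D) + (x * length D + z))
  by (intros; rewrite length_pmul; ring).
eapply islf_eq;
  [ apply (islf_cast (islf_pbraid A (pmul B D)) (eq_sym (pmul_assoc A B D)) eq_refl)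
  | apply (islf_comp
     (islf_prod (islf_pbraid A B) (islf_fun (isfun_id D)) eq_refl eq_refl)
     (islf_prod (islf_fun (isfun_id B)) (islf_pbraid A D) eq_refl eq_refl)
     (pmul_assoc B A D))
  | reflexivity | apply pmul_assoc | |]; intros i hi; apply E in hi;
  destruct hi as [x [y [z [hx [hy [hz ->]]]]]];
  assert (hyz : y * length D + z < length (pmul B D))
    by (rewrite length_pmul; apply pair_lt; assumption);
  assert (hxz : x * length D + z < length (pmul A D))
    by (rewrite length_pmul; apply pair_lt; assumption).
- rewrite (fprod_pair _ _ _ _ hz), fpbraid_pair, E2, (fprod_pair _ _ _ _ hxz) by assumption.
  rewrite E1, !fpbraid_pair by assumption; rewrite length_pmul; ring.
- rewrite (fprod_pair _ _ _ _ hz), (fpbraid_pair _ _ hy), E2.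
  rewrite !(div_pair _ hz), !(mod_pair _ hz), !(div_pair _ hxz), !(mod_pair _ hxz).
  rewrite !lpbraid_pair by assumption.
  rewrite E1, fpbraid_pair, lpbraid_pair by assumption.
  rewrite <- E1, !nth_pair by (rewrite ?length_pmul; try apply pair_lt; assumption).
  rewrite <- app_assoc; apply ceq_sym_hex.
Qed.

Lemma sum_pair_r_ex (n b d p : nat) :
  p < n * d + b * d ->
  (exists x z, x < n /\ z < d /\ p = x * d + z) \/
  (exists x z, x < b /\ z < d /\ p = n * d + (x * d + z)).
Proof.
intros hp; destruct (Nat.lt_ge_cases p (n * d)) as [h|h].
- left; apply pair_ex, h.
- right; destruct (@pair_ex b d (p - n * d)) as [x [y [hx [hy e]]]]; [lia|].
  exists x, y; split; [|split]; lia.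
Qed.

(** The entries are symmetries, so position maps alone do not decide this law. Both sides exchange
    the coordinates [x, z], and the label at [x] in [A ++ B] is read in [A] or in [B] according to
    the block of [x]. *)
Lemma raw_dist_pbraid A B D T :
  isfun (pmul D (A ++ B)) (pmul D A ++ pmul D B)
    (fdistl (length D) (length A) (length B)) T ->
  requ (rdsum (length (pmul A D)) (length (pmul D A)) (rpbraid A D) (rpbraid B D))
    (rcomp (rpbraid (A ++ B) D) T).
Proof.
intros hT i j c.
rewrite (fun_post i j c (is_mat_lf (islf_pbraid (A ++ B) D)) hT).
unfold rdsum, rpbraid, rlf; rewrite length_app, !length_pmul; split.
- intros [[h1 [h2 [hi [-> h]]]]|[h1 [h2 [hi [e h]]]]];
    apply pair_ex in hi; destruct hi as [x [z [hx [hz ei]]]].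
  + subst i; rewrite fpbraid_pair, lpbraid_pair in * by exact hz.
    exists (z * (length A + length B) + x); split.
    * rewrite nth_appl by assumption; splits; nia.
    * rewrite fpbraid_pair, fdistl_pairl by assumption; reflexivity.
  + rewrite ei, fpbraid_pair, lpbraid_pair in * by exact hz.
    assert (i = (length A + x) * length D + z) by lia; subst i.
    exists (z * (length A + length B) + (length A + x)); split.
    * rewrite fpbraid_pair, lpbraid_pair, nth_appr by lia.
      replace (length A + x - length A) with x by lia; splits; nia.
    * rewrite fdistl_pairr by exact hx; lia.
- intros [k [[hi [-> h]] ->]]; apply pair_ex in hi; destruct hi as [x [z [hx [hz ->]]]].
  rewrite fpbraid_pair, lpbraid_pair in * by exact hz.
  destruct (Nat.lt_ge_cases x (length A)) as [h'|h'].
  + rewrite nth_appl in h by exact h'; rewrite fdistl_pairl by exact h'.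
    left; rewrite fpbraid_pair by exact hz.
    pose proof (pair_lt h' hz); pose proof (pair_lt hz h'); auto.
  + assert (e : exists y, x = length A + y) by (exists (x - length A); lia).
    destruct e as [y ->]; assert (hy : y < length B) by lia.
    rewrite nth_appr in h by lia; rewrite fdistl_pairr by lia.
    replace (length A + y - length A) with y in h by lia.
    right; replace ((length A + y) * length D + z - length A * length D)
      with (y * length D + z) by nia.
    rewrite !fpbraid_pair, lpbraid_pair by exact hz.
    pose proof (pair_lt hy hz); repeat split; trivial; nia.
Qed.

(** * Faithful and full matrix semantics *)

(** Such a semantics determines the rig up to isomorphism, and transfers to it every law of
    the matrices. *)
Record raw_sem (X : fbrig) := RawSem {
  pol : ob X -> poly;
  unpol : poly -> ob X;
  polK : forall A : ob X, unpol (pol A) = A;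
  unpolK : forall P, pol (unpol P) = P;
  sem : forall A B : ob X, hom A B -> raw;
  sem_mat : forall (A B : ob X) (f : hom A B), is_mat (pol A) (pol B) (sem f);
  sem_full : forall (A B : ob X) R, is_mat (pol A) (pol B) R ->
    exists f : hom A B, requ (sem f) R;
  sem_le : forall (A B : ob X) (f g : hom A B), le f g <-> rsub (sem f) (sem g);
  sem_eqv : forall (A B : ob X) (f g : hom A B), eqv f g <-> requ (sem f) (sem g);
  pol_sum : forall A B : ob X, pol (tob (rsum X) A B) = pol A ++ pol B;
  pol_zero : pol (unit_ob (rsum X)) = [];
  pol_prod : forall A B : ob X, pol (tob (rprod X) A B) = pmul (pol A) (pol B);
  pol_one : pol (unit_ob (rprod X)) = [[]];
  sem_id : forall A : ob X, requ (sem (idm A)) (rid (pol A));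
  sem_comp : forall (A B D : ob X) (f : hom A B) (g : hom B D),
    requ (sem (comp f g)) (rcomp (sem f) (sem g));
  sem_sum : forall (A B A' B' : ob X) (f : hom A B) (g : hom A' B'),
    requ (sem (tenm (rsum X) f g))
      (rdsum (length (pol A)) (length (pol B)) (sem f) (sem g));
  sem_prod : forall (A B A' B' : ob X) (f : hom A B) (g : hom A' B'),
    requ (sem (tenm (rprod X) f g))
      (rkron (length (pol A')) (length (pol B')) (sem f) (sem g));
  sem_braid : forall A B : ob X,
    isfun (pol A ++ pol B) (pol B ++ pol A) (fbraid (length (pol A)) (length (pol B)))
      (sem (braid (rsum X) A B));
  sem_pbraid : forall A B : ob X,
    requ (sem (braid (rprod X) A B)) (rpbraid (pol A) (pol B));
  sem_diag : forall A : ob X,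
    isfun (pol A ++ pol A) (pol A) (fdiag (length (pol A))) (rtr (sem (diag (rfb X) A)));
  sem_codiag : forall A : ob X,
    isfun (pol A ++ pol A) (pol A) (fdiag (length (pol A))) (sem (codiag (rfb X) A));
  sem_distl : forall A B D : ob X,
    isfun (pmul (pol A) (pol B ++ pol D)) (pmul (pol A) (pol B) ++ pmul (pol A) (pol D))
      (fdistl (length (pol A)) (length (pol B)) (length (pol D))) (sem (distl A B D))
}.
Arguments sem {X} r {A B} f : rename.
Arguments pol {X} r A : rename.
Arguments unpol {X} r P : rename.

(** * Transfer of the rig laws along a semantics *)

Section Laws.
Context (X : fbrig) (s : raw_sem X).
Local Notation sm := (sem s).
Local Notation pol := (pol s).

Lemma pol_inj (A B : ob X) : pol A = pol B -> A = B.
Proof. intros h; rewrite <- (polK s A), h; apply polK. Qed.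

(** The semantics of arrows of different types can be compared directly because [raw] does not
    depend on objects. Once the objects are identified, faithfulness leaves no transport behind. *)
Lemma sem_heq (A B A' B' : ob X) (f : hom A B) (g : hom A' B') :
  A = A' -> B = B' -> requ (sm f) (sm g) -> heq f g.
Proof. intros <- <- h; constructor; apply (sem_eqv s), h. Qed.

Lemma sem_hcomp (A B B' D : ob X) (e : B = B') (f : hom A B) (g : hom B' D) :
  requ (sm (hcomp e f g)) (rcomp (sm f) (sm g)).
Proof. destruct e; apply sem_comp. Qed.

Lemma sfun_id (A : ob X) : isfun (pol A) (pol A) (fun i => i) (sm (idm A)).
Proof. eapply isfun_requ; [symmetry; apply sem_id | apply isfun_id]. Qed.

(** The polynomials are independent of the objects of [f] and [g]: each structural arrow comes with
    the form of its boundary that suits it, and the strictness equations appear only as the side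
    condition [Q = Q']. *)
Lemma sfun_comp (A B D : ob X) (P Q Q' R : poly) (h k : nat -> nat) (f : hom A B)
    (g : hom B D) :
  isfun P Q h (sm f) -> isfun Q' R k (sm g) -> Q = Q' ->
  isfun P R (fun i => k (h i)) (sm (comp f g)).
Proof.
intros; eapply isfun_requ; [symmetry; apply sem_comp | eapply isfun_comp; eassumption].
Qed.

Lemma sfun_hcomp (A B B' D : ob X) (e : B = B') (P Q Q' R : poly) (h k : nat -> nat)
    (f : hom A B) (g : hom B' D) :
  isfun P Q h (sm f) -> isfun Q' R k (sm g) -> Q = Q' ->
  isfun P R (fun i => k (h i)) (sm (hcomp e f g)).
Proof. destruct e; apply sfun_comp. Qed.

Lemma sfun_sum (A B A' B' : ob X) P Q P' Q' (h k : nat -> nat) (f : hom A B)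
    (g : hom A' B') :
  isfun P Q h (sm f) -> isfun P' Q' k (sm g) ->
  length (pol A) = length P -> length (pol B) = length Q ->
  isfun (P ++ P') (Q ++ Q') (fsum (length P) (length Q) h k) (sm (tenm (rsum X) f g)).
Proof.
intros hf hg e e'; eapply isfun_requ; [symmetry; apply sem_sum|].
rewrite e, e'; apply isfun_sum; trivial.
Qed.

Lemma sfun_prod (A B A' B' : ob X) P Q P' Q' (h k : nat -> nat) (f : hom A B)
    (g : hom A' B') :
  isfun P Q h (sm f) -> isfun P' Q' k (sm g) ->
  length (pol A') = length P' -> length (pol B') = length Q' ->
  isfun (pmul P P') (pmul Q Q') (fprod (length P') (length Q') h k)
    (sm (tenm (rprod X) f g)).
Proof.
intros hf hg e e'; eapply isfun_requ; [symmetry; apply sem_prod|].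
rewrite e, e'; apply isfun_prod; trivial.
Qed.

Lemma scofun_id (A : ob X) : isfun (pol A) (pol A) (fun i => i) (rtr (sm (idm A))).
Proof.
split; [intros i a h; exact h|].
intros i j c; unfold rtr; rewrite (sem_id s A j i c); split;
  intros [a [h1 [-> h2]]]; exists a; auto.
Qed.

Lemma scofun_braid (A B : ob X) :
  isfun (pol B ++ pol A) (pol A ++ pol B) (fbraid (length (pol B)) (length (pol A)))
    (rtr (sm (braid (rsum X) A B))).
Proof.
destruct (sem_braid s A B) as [hl h]; split; [apply lab_braid|].
pose proof (@lab_braid (pol B) (pol A)) as hl'.
assert (E : forall n m i, i < n + m -> fbraid m n (fbraid n m i) = i).
{ intros n m i hi; unfold fbraid; destruct (Nat.ltb_spec i n);
    [destruct (Nat.ltb_spec (m + i) m) | destruct (Nat.ltb_spec (i - n) m)]; lia. }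
intros i j c; unfold rtr; rewrite (h j i c); split; intros [a [h1 [-> h2]]]; exists a.
- split; [apply hl, h1 | split; trivial]; symmetry; apply E.
  rewrite <- length_app; eapply nth_error_lt, h1.
- split; [apply hl', h1 | split; trivial]; symmetry; apply E.
  rewrite <- length_app; eapply nth_error_lt, h1.
Qed.

Lemma scofun_comp (A B D : ob X) (P Q Q' R : poly) (h k : nat -> nat) (f : hom A B)
    (g : hom B D) :
  isfun Q P h (rtr (sm f)) -> isfun R Q' k (rtr (sm g)) -> Q = Q' ->
  isfun R P (fun i => h (k i)) (rtr (sm (comp f g))).
Proof.
intros hf hg e; apply (isfun_requ (R := rtr (rcomp (sm f) (sm g)))).
- intros i j c; symmetry; apply sem_comp.
- eapply cofun_comp; eassumption.
Qed.

Lemma scofun_hcomp (A B B' D : ob X) (e : B = B') (P Q Q' R : poly) (h k : nat -> nat)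
    (f : hom A B) (g : hom B' D) :
  isfun Q P h (rtr (sm f)) -> isfun R Q' k (rtr (sm g)) -> Q = Q' ->
  isfun R P (fun i => h (k i)) (rtr (sm (hcomp e f g))).
Proof. destruct e; apply scofun_comp. Qed.

Lemma scofun_sum (A B A' B' : ob X) P Q P' Q' (h k : nat -> nat) (f : hom A B)
    (g : hom A' B') :
  isfun Q P h (rtr (sm f)) -> isfun Q' P' k (rtr (sm g)) ->
  length (pol A) = length P -> length (pol B) = length Q ->
  isfun (Q ++ Q') (P ++ P') (fsum (length Q) (length P) h k)
    (rtr (sm (tenm (rsum X) f g))).
Proof.
intros hf hg e e';
  apply (isfun_requ (R := rtr (rdsum (length P) (length Q) (sm f) (sm g)))).
- intros i j c; symmetry; unfold rtr; rewrite <- e, <- e'; apply sem_sum.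
- apply cofun_sum; trivial.
Qed.

Lemma isfun_nil P (h : nat -> nat) R : is_mat [] P R -> isfun [] P h R.
Proof.
intros hR; split.
- intros [|i] a; discriminate.
- apply (raw_empty_src hR), is_mat_fun with (f := h), isfun_rfun.
  intros [|i] a; discriminate.
Qed.

Lemma scofun_bang (A : ob X) : isfun [] (pol A) (fun i => i) (rtr (sm (bang (rfb X) A))).
Proof.
pose proof (sem_mat s (bang (rfb X) A)) as h; rewrite pol_zero in h.
apply isfun_nil, is_mat_intro.
- intros i j c hR; apply (is_mat_lt h) in hR; simpl in hR; lia.
- intros i j; apply (proj2 h).
Qed.

Lemma sfun_cobang (A : ob X) : isfun [] (pol A) (fun i => i) (sm (cobang (rfb X) A)).
Proof.
apply isfun_nil; pose proof (sem_mat s (cobang (rfb X) A)) as h; rewrite pol_zero in h.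
exact h.
Qed.

Ltac polys :=
  rewrite ?(pol_sum s), ?(pol_prod s), ?(pol_sum s), ?(pol_prod s), ?(pol_zero s),
    ?(pol_one s).
Ltac polyq :=
  polys; rewrite ?app_nil_r, ?pmul_nilr, ?pmul_appl, ?pmul_onel, ?pmul_oner, ?pmul_assoc,
    ?pmul_appl, ?app_nil_r,
    <- ?app_assoc; reflexivity.
Ltac obq := apply pol_inj; polyq.

Ltac sfun :=
  lazymatch goal with
  | |- isfun _ _ _ (rtr (sm (comp _ _))) => eapply scofun_comp; [sfun | sfun | polyq]
  | |- isfun _ _ _ (rtr (sm (hcomp _ _ _))) => eapply scofun_hcomp; [sfun | sfun | polyq]
  | |- isfun _ _ _ (rtr (sm (tenm (rsum _) _ _))) =>
      eapply scofun_sum; [sfun | sfun | f_equal; polyq | f_equal; polyq]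
  | |- isfun _ _ _ (rtr (sm (idm _))) => apply scofun_id
  | |- isfun _ _ _ (rtr (sm (braid _ _ _))) => apply scofun_braid
  | |- isfun _ _ _ (rtr (sm (diag _ _))) => apply sem_diag
  | |- isfun _ _ _ (rtr (sm (bang _ _))) => apply scofun_bang
  | |- isfun _ _ _ (sm (comp _ _)) => eapply sfun_comp; [sfun | sfun | polyq]
  | |- isfun _ _ _ (sm (hcomp _ _ _)) => eapply sfun_hcomp; [sfun | sfun | polyq]
  | |- isfun _ _ _ (sm (tenm (rsum _) _ _)) =>
      eapply sfun_sum; [sfun | sfun | f_equal; polyq | f_equal; polyq]
  | |- isfun _ _ _ (sm (tenm (rprod _) _ _)) =>
      eapply sfun_prod; [sfun | sfun | f_equal; polyq | f_equal; polyq]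
  | |- isfun _ _ _ (sm (idm _)) => apply sfun_id
  | |- isfun _ _ _ (sm (braid _ _ _)) => apply sem_braid
  | |- isfun _ _ _ (sm (codiag _ _)) => apply sem_codiag
  | |- isfun _ _ _ (sm (cobang _ _)) => apply sfun_cobang
  | |- isfun _ _ _ (sm (distl _ _ _)) => apply sem_distl
  end.

Lemma cofun_eq A B A' B' f g R S :
  isfun A B f (rtr R) -> isfun A' B' g (rtr S) -> A = A' ->
  (forall i, i < length A -> f i = g i) -> requ R S.
Proof.
intros h1 h2 e h; pose proof (isfun_eq h1 h2 e h) as E; intros i j c; apply (E j i c).
Qed.

(** Reduces an equation between 0-1 matrices to an equation between position maps. *)
Ltac funs :=
  eapply isfun_eq; [sfun | sfun | polyq |];
  polys; repeat rewrite ?length_app, ?length_pmul; cbv beta.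
Ltac cofuns :=
  eapply cofun_eq; [sfun | sfun | polyq |];
  polys; repeat rewrite ?length_app, ?length_pmul; cbv beta.
Ltac sums :=
  intros i; simpl length; unfold fsum, fbraid, fdiag;
  cases_ltb; lia.

Lemma raw_sem_category : poset_category_axioms X.
Proof.
split.
- intros A B f g h h'; apply (sem_eqv s); apply (sem_le s) in h, h'.
  intros i j c; split; [apply h | apply h'].
- intros A B D E f g h; apply (sem_eqv s); rewrite !sem_comp.
  eapply raw_comp_assoc; apply sem_mat.
- intros A B f; apply (sem_eqv s); rewrite sem_comp, sem_id; eapply raw_idl, sem_mat.
- intros A B f; apply (sem_eqv s); rewrite sem_comp, sem_id; eapply raw_idr, sem_mat.
Qed.

Lemma raw_sem_sum : monoidal_axioms (rsum X).
Proof.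
split.
- intros; obq.
- intros; obq.
- intros; obq.
- intros A B; apply (sem_eqv s); funs; sums.
- intros A B D A' B' D' f g f' g'; apply (sem_eqv s).
  rewrite sem_comp, !sem_sum, !sem_comp; eapply raw_sum_comp; apply sem_mat.
- intros A B A' B' A'' B'' f g h; apply sem_heq; [obq | obq |].
  rewrite !sem_sum, !pol_sum, !length_app; apply raw_sum_assoc.
- intros A B f; apply sem_heq; [obq | obq |].
  rewrite sem_sum, !pol_zero; apply raw_sum_unitl.
- intros A B f; apply sem_heq; [obq | obq |].
  rewrite sem_sum; apply raw_sum_unitr; [apply sem_mat|].
  pose proof (sem_mat s (idm (unit_ob (rsum X)))) as h; rewrite !pol_zero in h; exact h.
- intros A B A' B' f g; apply (sem_eqv s); rewrite !sem_comp, !sem_sum.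
  apply raw_braid_nat; try apply sem_mat; apply sem_braid.
- intros A B; apply (sem_eqv s); funs; sums.
- intros A B D e; apply sem_heq; [obq | obq |]; funs; sums.
Qed.

Lemma raw_sem_biproduct : biproduct_axioms (rfb X).
Proof.
split.
- intros A; apply sem_heq; [obq | obq |]; cofuns; sums.
- intros A; apply sem_heq; [obq | obq |]; cofuns; sums.
- intros A; apply (sem_eqv s); cofuns; sums.
- intros A; apply sem_heq; [obq | obq |]; funs; sums.
- intros A; apply sem_heq; [obq | obq |]; funs; sums.
- intros A; apply (sem_eqv s); funs; sums.
- intros A B f; apply (sem_eqv s); rewrite !sem_comp, sem_sum.
  apply raw_diag_nat; [apply sem_mat | apply sem_diag | apply sem_diag].
- intros A B f; apply (sem_eqv s); apply raw_empty_tgt with (P := pol A);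
    rewrite <- (pol_zero s); apply sem_mat.
- intros A B f; apply (sem_eqv s); rewrite !sem_comp, sem_sum.
  apply raw_codiag_nat; [apply sem_mat | apply sem_codiag | apply sem_codiag].
- intros A B f; apply (sem_eqv s); apply raw_empty_src with (Q := pol B);
    rewrite <- (pol_zero s); apply sem_mat.
- intros A B e; apply sem_heq; [obq | obq |]; cofuns; sums.
- intros A B; apply sem_heq; [obq | obq |]; cofuns; sums.
- intros A B e; apply sem_heq; [obq | obq |]; funs; sums.
- intros A B; apply sem_heq; [obq | obq |]; funs; sums.
- apply sem_heq; [obq | obq |]; cofuns; sums.
- apply (sem_eqv s); cofuns; sums.
- apply sem_heq; [obq | obq |]; funs; sums.
- apply (sem_eqv s); funs; sums.
Qed.

Lemma raw_sem_prod : monoidal_axioms (rprod X).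
Proof.
split.
- intros; obq.
- intros; obq.
- intros; obq.
- intros A B; apply (sem_eqv s); funs; unfold fprod.
  intros i _; symmetry; apply pair_div_mod.
- intros A B D A' B' D' f g f' g'; apply (sem_eqv s).
  rewrite sem_comp, !sem_prod, !sem_comp; eapply raw_prod_comp; apply sem_mat.
- intros A B A' B' A'' B'' f g h; apply sem_heq; [obq | obq |].
  rewrite !sem_prod, !pol_prod, !length_pmul; eapply raw_prod_assoc; apply sem_mat.
- intros A B f; apply sem_heq; [obq | obq |].
  rewrite sem_prod, sem_id, pol_one; apply raw_prod_unitl, sem_mat.
- intros A B f; apply sem_heq; [obq | obq |].
  rewrite sem_prod, sem_id, pol_one; eapply raw_prod_unitr, sem_mat.
- intros A B A' B' f g; apply (sem_eqv s); rewrite !sem_comp, !sem_prod, !sem_pbraid.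
  apply raw_pbraid_nat; apply sem_mat.
- intros A B; apply (sem_eqv s); rewrite sem_comp, sem_id, !sem_pbraid, pol_prod.
  apply raw_pbraid_inv.
- intros A B D e; apply sem_heq; [obq | obq |].
  rewrite sem_hcomp, !sem_prod, !sem_pbraid, !sem_id, !pol_prod; apply raw_pbraid_hex.
Qed.


Lemma sem_empty (A B A' B' : ob X) (f : hom A B) (g : hom A' B') :
  pol A = [] -> pol A' = [] -> requ (sm f) (sm g).
Proof.
intros e e' i j c; split; intros h; apply (is_mat_lt (sem_mat _ _)) in h;
  rewrite ?e, ?e' in h; simpl in h; lia.
Qed.

(** The signature of rigs has no operation for the inverse, but fullness provides one: the 0-1
    matrix of [fdistlV] is the semantics of some arrow. *)
Lemma distl_inverse (A B D : ob X) : exists g : hom _ _,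
  eqv (comp (distl A B D) g) (idm _) /\ eqv (comp g (distl A B D)) (idm _).
Proof.
pose proof (isfun_rfun (@lab_distlV (pol A) (pol B) (pol D))) as hV.
destruct (@sem_full X s (tob (rsum X) (tob (rprod X) A B) (tob (rprod X) A D))
  (tob (rprod X) A (tob (rsum X) B D)) (rfun (pmul (pol A) (pol B) ++ pmul (pol A) (pol D))
    (fdistlV (length (pol A)) (length (pol B)) (length (pol D))))) as [g hg].
{ polys; apply (is_mat_fun hV). }
apply (isfun_requ (symmetry hg)) in hV.
exists g; split; apply (sem_eqv s).
- eapply isfun_eq; [eapply sfun_comp; [apply sem_distl | exact hV | reflexivity]
    | apply sfun_id | polyq |].
  rewrite length_pmul, length_app; intros i hi; apply fdistlK, hi.
- eapply isfun_eq; [eapply sfun_comp; [exact hV | apply sem_distl | reflexivity]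
    | apply sfun_id | polyq |].
  rewrite length_app, !length_pmul; intros i hi; apply fdistlVK, hi.
Qed.

Ltac pos2 A B :=
  generalize (length (pol A)), (length (pol B)); clear; intros a b i hi.
Ltac pos3 A B D :=
  generalize (length (pol A)), (length (pol B)), (length (pol D)); clear;
  intros a b d i hi.
Ltac pos4 A B D E :=
  generalize (length (pol A)), (length (pol B)), (length (pol D)), (length (pol E)); clear;
  intros a b d e i hi.

Lemma raw_sem_distributivity : distributivity_axioms X.
Proof.
split.
- intros; obq.
- intros; obq.
- intros; obq.
- intros A A' B B' D D' f g h; apply sem_heq; [obq | obq |].
  rewrite sem_prod, !sem_sum, !sem_prod, !pol_prod, !length_pmul.
  eapply raw_distr_nat; apply sem_mat.
- intros A B f; apply sem_heq; [obq | obq |]; apply sem_empty; polyq.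
- intros A B f; apply sem_heq; [obq | obq |]; apply sem_empty; polyq.
- intros A A' B B' D D' f g h; apply (sem_eqv s).
  rewrite !sem_comp, !sem_sum, !sem_prod, !sem_sum, !pol_prod, !pol_sum,
    !length_pmul, !length_app.
  eapply raw_distl_nat; apply sem_mat || apply sem_distl.
- apply distl_inverse.
(* From here on most laws are identities in mixed radix arithmetic. A position in a product with a
   sum is split by [pair_sum_ex] according to the summand, which decides every comparison. *)
- intros A B D; apply (sem_eqv s); funs; pos3 A B D.
  destruct (pair_sum_ex hi) as [[x [y [hx [hy ->]]]]|[x [y [hx [hy ->]]]]];
    rewrite ?fdistl_pairl, ?fdistl_pairr, fprod_pair by lia; unfold fbraid.
  + destruct (Nat.ltb_spec (x * b + y) (a * b)); [|nia].
    cases_ltb.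
    rewrite fdistl_pairr by assumption; reflexivity.
  + cases_ltb.
    cases_ltb.
    replace (b + y - b) with y by lia.
    rewrite fdistl_pairl by assumption; lia.
- intros A B D; apply sem_heq; [obq | obq |]; funs; pos3 A B D.
  rewrite Nat.mul_add_distr_r in hi; apply sum_pair_r_ex in hi.
  destruct hi as [[x [z [hx [hz ->]]]]|[x [z [hx [hz ->]]]]].
  + rewrite fprod_pair by assumption; unfold fbraid.
    destruct (Nat.ltb_spec (x * d + z) (a * d)); [|nia].
    cases_ltb; ring.
  + replace (a * d + (x * d + z)) with ((a + x) * d + z) by ring.
    rewrite fprod_pair by assumption; unfold fbraid.
    destruct (Nat.ltb_spec ((a + x) * d + z) (a * d)); [nia|].
    cases_ltb; replace (a + x - a) with x by lia; nia.
- intros A B D; apply sem_heq; [obq | obq |].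
  rewrite sem_comp, sem_sum, !sem_pbraid, !pol_sum, !pol_prod.
  apply raw_dist_pbraid, sem_distl.
- intros A B D E; apply sem_heq; [obq | obq |]; funs; pos4 A B D E.
  destruct (pair_sum_ex hi) as [[x [y [hx [hy ->]]]]|[x [y [hx [hy ->]]]]];
    rewrite ?fdistl_pairl, ?fdistl_pairr by lia.
  + rewrite (fsum_l _ _ _ (pair_lt hx hy)).
    rewrite (Nat.add_assoc b d e), fdistl_pairl by lia.
    rewrite (fsum_l (n := a * (b + d))) by (lia || (apply pair_lt; lia)).
    rewrite fdistl_pairl by lia; reflexivity.
  + rewrite fsum_r.
    destruct (Nat.lt_ge_cases y d) as [h|h].
    * rewrite fdistl_pairl by lia.
      replace (x * (b + (d + e)) + (b + y)) with (x * (b + d + e) + (b + y)) by lia.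
      rewrite fdistl_pairl by lia.
      rewrite (fsum_l (n := a * (b + d))) by (lia || (apply pair_lt; lia)).
      rewrite fdistl_pairr by lia; reflexivity.
    * replace y with (d + (y - d)) by lia.
      rewrite fdistl_pairr by lia.
      replace (x * (b + (d + e)) + (b + (d + (y - d))))
        with (x * (b + d + e) + (b + d + (y - d))) by lia.
      rewrite fdistl_pairr, fsum_r by lia; ring.
- intros A B D E; apply sem_heq; [obq | obq |]; funs; pos4 A B D E.
  destruct (pair_sum_ex hi) as [[xy [z [hxy [hz ->]]]]|[xy [z [hxy [hz ->]]]]];
    apply pair_ex in hxy; destruct hxy as [x [y [hx [hy ->]]]];
    rewrite ?fdistl_pairl, ?fdistl_pairr by lia.
  + replace ((x * b + y) * (d + e) + z) with (x * (b * (d + e)) + (y * (d + e) + z)) by ring.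
    rewrite fprod_pair, (fdistl_pairl b e y hz) by (apply pair_lt; lia).
    rewrite fdistl_pairl by (lia || (apply pair_lt; lia)); ring.
  + replace ((x * b + y) * (d + e) + (d + z))
      with (x * (b * (d + e)) + (y * (d + e) + (d + z))) by ring.
    rewrite fprod_pair, (fdistl_pairr b d y hz) by (apply pair_lt; lia).
    rewrite fdistl_pairr by (lia || (apply pair_lt; lia)); ring.
- intros A B D E; apply sem_heq; [obq | obq |]; funs; pos4 A B D E.
  apply pair_ex in hi; destruct hi as [xy [z [hxy [hz ->]]]].
  rewrite fprod_pair by assumption.
  destruct (pair_sum_ex hxy) as [[x [y [hx [hy ->]]]]|[x [y [hx [hy ->]]]]];
    rewrite ?fdistl_pairl, ?fdistl_pairr by lia.
  + replace ((x * (b + d) + y) * e + z) with (x * (b * e + d * e) + (y * e + z)) by ring.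
    rewrite fdistl_pairl by (lia || (apply pair_lt; lia)); ring.
  + replace ((x * (b + d) + (b + y)) * e + z)
      with (x * (b * e + d * e) + (b * e + (y * e + z))) by ring.
    rewrite fdistl_pairr by (lia || (apply pair_lt; lia)); ring.
- intros A B D E e; apply sem_heq; [obq | obq |]; funs; clear e; pos4 A B D E.
  (* Four blocks: the second coordinate in [D] or [E], the first in [A] or [B]. The symmetry on the
     right only exchanges the block of [A] with [E] and that of [B] with [D]. *)
  destruct (pair_sum_ex hi) as [[x [y [hx [hy ->]]]]|[x [y [hx [hy ->]]]]];
    rewrite ?fdistl_pairl, ?fdistl_pairr by lia;
    destruct (Nat.lt_ge_cases x a) as [h|h].
  + rewrite (fsum_l (n := a * (d + e))) by (lia || (apply pair_lt; lia)).
    rewrite fdistl_pairl by lia.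
    rewrite fsum_l by (pose proof (pair_lt h hy); lia).
    rewrite fsum_l by (lia || (apply pair_lt; lia)); reflexivity.
  + replace (x * (d + e) + y) with (a * (d + e) + ((x - a) * (d + e) + y)) by nia.
    rewrite fsum_r, fdistl_pairl by lia.
    replace (a * d + a * e + ((x - a) * d + y))
      with (a * d + (a * e + ((x - a) * d + y))) by lia.
    assert (hxy : (x - a) * d + y < b * d) by (lia || (apply pair_lt; lia)).
    rewrite fsum_l by lia.
    rewrite fsum_r; unfold fbraid.
    destruct (Nat.ltb_spec (a * e + ((x - a) * d + y)) (a * e)); [lia | nia].
  + rewrite (fsum_l (n := a * (d + e))) by (lia || (apply pair_lt; lia)).
    rewrite fdistl_pairr by lia.
    assert (hxy : x * e + y < a * e) by (lia || (apply pair_lt; lia)).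
    rewrite fsum_l by lia.
    rewrite fsum_r; unfold fbraid.
    cases_ltb; lia.
  + replace (x * (d + e) + (d + y)) with (a * (d + e) + ((x - a) * (d + e) + (d + y))) by nia.
    rewrite fsum_r, fdistl_pairr by lia.
    replace (a * d + a * e + (b * d + ((x - a) * e + y)))
      with (a * d + (a * e + b * d) + ((x - a) * e + y)) by lia.
    rewrite fsum_r; nia.
- intros A B; apply sem_heq; [obq | obq |]; apply sem_empty; polyq.
- intros A B; apply sem_heq; [obq | obq |]; funs; simpl length; pos2 A B.
  unfold fdistl; simpl.
  assert (hb : 0 < b) by (destruct b; lia).
  rewrite Nat.mul_0_r, Nat.sub_0_r; simpl.
  symmetry; apply pair_div_mod.
- intros A B; apply sem_heq; [obq | obq |]; funs; simpl length; pos2 A B.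
  rewrite Nat.add_0_r in hi; apply pair_ex in hi; destruct hi as [x [y [hx [hy ->]]]].
  replace (x * b + y) with (x * (b + 0) + y) at 1 by lia.
  apply fdistl_pairl, hy.
- intros A B; apply sem_heq; [obq | obq |]; funs; simpl length; pos2 A B.
  replace i with (0 * (a + b) + i) at 1 by lia.
  destruct (Nat.lt_ge_cases i a) as [h|h].
  + rewrite fdistl_pairl by exact h; lia.
  + replace i with (a + (i - a)) by lia.
    rewrite fdistl_pairr by lia; lia.
- intros A; apply sem_heq; [obq | obq |]; apply sem_empty; polyq.
Qed.

Lemma raw_sem_fbrig : poset_fbrig_axioms X.
Proof.
split; [apply raw_sem_category | apply raw_sem_sum | apply raw_sem_biproduct
  | apply raw_sem_prod | apply raw_sem_distributivity].
Qed.

End Laws.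

(** * Isomorphism of two rigs with a common semantics *)

Section Translation.
Context (X Y : fbrig) (s : raw_sem X) (t : raw_sem Y).

Definition tr_ob (A : ob X) : ob Y := unpol t (pol s A).

Lemma pol_tr (A : ob X) : pol t (tr_ob A) = pol s A.
Proof. apply unpolK. Qed.

Lemma tr_ex (A B : ob X) (f : hom A B) :
  exists g : hom (tr_ob A) (tr_ob B), requ (sem t g) (sem s f).
Proof. apply sem_full; rewrite !pol_tr; apply sem_mat. Qed.

(** An arbitrary choice suffices: arrows with equal semantics are equal by [sem_eqv], so every
    equation required of the functor can be checked on semantics. *)
Definition tr (A B : ob X) (f : hom A B) : hom (tr_ob A) (tr_ob B) :=
  proj1_sig (constructive_indefinite_description _ (tr_ex f)).

Lemma sem_tr (A B : ob X) (f : hom A B) : requ (sem t (tr f)) (sem s f).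
Proof. unfold tr; destruct (constructive_indefinite_description _ _); assumption. Qed.

Lemma tr_ob_eq (A : ob X) (B : ob Y) : pol s A = pol t B -> tr_ob A = B.
Proof. intros h; apply (pol_inj (s := t)); rewrite pol_tr; exact h. Qed.

Lemma isfun_requ_eq A B f R S : isfun A B f R -> isfun A B f S -> requ R S.
Proof. intros h1 h2; apply (isfun_eq h1 h2); trivial. Qed.

Lemma rtr_requ R S : requ (rtr R) (rtr S) -> requ R S.
Proof. intros h i j c; apply (h j i c). Qed.

Ltac trq :=
  apply tr_ob_eq;
  rewrite ?pol_prod, ?pol_sum, ?pol_prod, ?pol_zero, ?pol_one, ?pol_tr; reflexivity.

Lemma tr_functor : exists F : fbrig_functor X Y,
  (forall A : ob X, fob F A = tr_ob A) /\
  (forall (A B : ob X) (f : hom A B), requ (sem t (fhom F f)) (sem s f)).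
Proof.
unshelve eexists (@FbRigFunctor X Y tr_ob tr _ _ _ _ _ _ _ _ _ _ _);
  [.. | split; [reflexivity | exact sem_tr]].
- intros A B f g h; apply (sem_le t); apply (sem_le s) in h.
  intros i j c hc; apply sem_tr, h, sem_tr, hc.
- intros A B f g h; apply (sem_eqv t); apply (sem_eqv s) in h.
  rewrite !sem_tr; exact h.
- intros A; apply (sem_eqv t); rewrite sem_tr, !sem_id, pol_tr; reflexivity.
- intros A B D f g; apply (sem_eqv t); rewrite sem_tr, !sem_comp, !sem_tr; reflexivity.
- split.
  + trq.
  + intros A B; trq.
  + intros A B A' B' f g; apply (sem_heq (s := t)); [trq | trq |].
    rewrite sem_tr, !sem_sum, !sem_tr, !pol_tr; reflexivity.
  + intros A B; apply (sem_heq (s := t)); [trq | trq |].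
    rewrite sem_tr; apply (isfun_requ_eq (sem_braid s A B)).
      rewrite <- !pol_tr; apply sem_braid.
- split.
  + trq.
  + intros A B; trq.
  + intros A B A' B' f g; apply (sem_heq (s := t)); [trq | trq |].
    rewrite sem_tr, !sem_prod, !sem_tr, !pol_tr; reflexivity.
  + intros A B; apply (sem_heq (s := t)); [trq | trq |].
    rewrite sem_tr, !sem_pbraid, !pol_tr; reflexivity.
- intros A; apply (sem_heq (s := t)); trivial.
  + trq.
  + rewrite sem_tr; apply rtr_requ, (isfun_requ_eq (sem_diag s A)).
    rewrite <- !pol_tr; apply sem_diag.
- intros A; apply (sem_heq (s := t)); trivial.
  + trq.
  (* Any two matrices into the empty polynomial agree, which is why [raw_sem] has no field for
     [bang] or, dually, for [cobang]. *)
  + apply raw_empty_tgt with (P := pol s A).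
    rewrite <- (pol_zero s), <- !pol_tr; apply sem_mat.
    rewrite <- (pol_zero t), <- !pol_tr; apply sem_mat.
- intros A; apply (sem_heq (s := t)); trivial.
  + trq.
  + rewrite sem_tr; apply (isfun_requ_eq (sem_codiag s A)).
    rewrite <- !pol_tr; apply sem_codiag.
- intros A; apply (sem_heq (s := t)); trivial.
  + trq.
  + apply raw_empty_src with (Q := pol s A).
    rewrite <- (pol_zero s), <- !pol_tr; apply sem_mat.
    rewrite <- (pol_zero t), <- !pol_tr; apply sem_mat.
- intros A B D; apply (sem_heq (s := t)); [trq | trq |].
  rewrite sem_tr; apply (isfun_requ_eq (sem_distl s A B D)).
    rewrite <- !pol_tr; apply sem_distl.
Qed.

End Translation.

Lemma raw_sem_iso (X Y : fbrig) : raw_sem X -> raw_sem Y -> inhabited (fbrig_iso X Y).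
Proof.
intros s t.
destruct (tr_functor s t) as [F [oF hF]], (tr_functor t s) as [G [oG hG]].
assert (GF : forall A : ob X, fob G (fob F A) = A).
{ intros A; rewrite oG, oF; apply tr_ob_eq, pol_tr. }
assert (FG : forall A : ob Y, fob F (fob G A) = A).
{ intros A; rewrite oF, oG; apply tr_ob_eq, pol_tr. }
constructor; apply (@FbRigIso X Y F G GF); trivial.
- intros A B f; apply (sem_heq (s := s)); trivial; rewrite hG, hF; reflexivity.
- intros A B f; apply (sem_heq (s := t)); trivial; rewrite hF, hG; reflexivity.
Qed.

End Raw.

(** * Positions in lists *)

Section Positions.
Context (X : Type).
Implicit Types (l k : list X) (x y : X).

(** The bridge from the dependent positions of [mat] to bare numbers. By [nth_opos], [opos_ex] and
    [opos_inj] it is a bijection from [occ l x] onto the indices at which [l] has the entry [x]. *)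
Fixpoint opos l x : occ l x -> nat :=
  match l return occ l x -> nat with
  | [] => fun p => match p with end
  | y :: l' => fun p => match p with inl _ => 0 | inr q => S (opos q) end
  end.

Lemma nth_opos l x (p : occ l x) : nth_error l (opos p) = Some x.
Proof.
induction l as [|y l IH]; [destruct p|].
destruct p as [e|q]; simpl; [rewrite e; reflexivity | apply IH].
Qed.

Lemma opos_lt l x (p : occ l x) : opos p < length l.
Proof. eapply nth_error_lt, nth_opos. Qed.

Lemma opos_ex l x (i : nat) : nth_error l i = Some x -> exists p : occ l x, opos p = i.
Proof.
revert i; induction l as [|y l IH]; intros [|i] h; try discriminate h.
- injection h as e; exists (inl e); reflexivity.
- destruct (IH i h) as [p hp]; exists (inr p); simpl; rewrite hp; reflexivity.
Qed.

(** Besides its number, a position contains only a proof that the entry found there is the label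
    [x]; proof irrelevance removes that difference. *)
Lemma opos_inj l x (p q : occ l x) : opos p = opos q -> p = q.
Proof.
induction l as [|y l IH]; [destruct p|].
destruct p as [e|p], q as [e'|q]; simpl; intros h; try discriminate h.
- f_equal; apply proof_irrelevance.
- f_equal; apply IH; injection h; trivial.
Qed.

Lemma opos_label l x y (p : occ l x) (q : occ l y) : opos p = opos q -> x = y.
Proof.
intros h; pose proof (nth_opos p) as hp; rewrite h, nth_opos in hp; congruence.
Qed.

Lemma occ_sameP l x y (p : occ l x) (q : occ l y) :
  match occ_same p q with Some _ => opos p = opos q | None => opos p <> opos q end.
Proof.
induction l as [|z l IH]; [destruct p|].
destruct p as [e|p], q as [e'|q]; simpl; try discriminate; trivial.
specialize (IH p q); destruct (occ_same p q); congruence.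
Qed.

Lemma in_occ_enum l x (p : occ l x) : In (existT (occ l) x p) (occ_enum l).
Proof.
induction l as [|y l IH]; [destruct p|].
destruct p as [e|p].
- destruct e; left; reflexivity.
- right; apply in_map_iff; exists (existT (occ l) x p); split; [reflexivity | apply IH].
Qed.

Lemma opos_left l k x (p : occ l x) : opos (occ_left k p) = opos p.
Proof.
induction l as [|y l IH]; [destruct p|].
destruct p as [e|p]; simpl; [reflexivity | rewrite IH; reflexivity].
Qed.

Lemma opos_right l k x (p : occ k x) : opos (occ_right l p) = length l + opos p.
Proof. induction l as [|y l IH]; simpl; [reflexivity | rewrite IH; reflexivity]. Qed.

Lemma occ_splitP l k x (p : occ (l ++ k) x) :
  match occ_split p with
  | inl q => opos p = opos q
  | inr q => opos p = length l + opos q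
  end.
Proof.
induction l as [|y l IH]; [reflexivity|].
destruct p as [e|p]; simpl; [reflexivity|].
specialize (IH p); destruct (occ_split p); simpl; rewrite IH; reflexivity.
Qed.

End Positions.

Lemma opos_map (X Y : Type) (f : X -> Y) (l : list X) (x : X) (p : occ l x) :
  opos (occ_map f p) = opos p.
Proof.
induction l as [|y l IH]; [destruct p|].
destruct p as [e|p]; simpl; [reflexivity | rewrite IH; reflexivity].
Qed.

Lemma occ_unmapP (X Y : Type) (f : X -> Y) (l : list X) (y : Y) (p : occ (map f l) y) :
  match occ_unmap p with MapOcc _ q => opos q = opos p end.
Proof.
induction l as [|x l IH]; [destruct p|].
destruct p as [e|p]; simpl; [destruct e; reflexivity|].
specialize (IH p); destruct (occ_unmap p); simpl; rewrite IH; reflexivity.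
Qed.

Definition mpos (X : Type) (op : X -> X -> X) (l l' : list X) (z : X)
    (m : mul_occ op l l' z) : nat :=
  match m with MulOcc _ _ i j => opos i * length l' + opos j end.

Lemma occ_unpairP (X : Type) (op : X -> X -> X) (l l' : list X) (z : X)
    (p : occ (list_mul op l l') z) : mpos (occ_unpair p) = opos p.
Proof.
induction l as [|x l IH]; [destruct p|].
pose proof (@occ_splitP _ (map (op x) l') (list_mul op l l') z p) as h.
change (mpos (match @occ_split X (map (op x) l') (list_mul op l l') z p with
  | inl q => match occ_unmap q in map_occ _ _ z return mul_occ op (x :: l) l' z with
             | MapOcc _ r => @MulOcc _ op (x :: l) l' _ _ (inl eq_refl) r end
  | inr q => match occ_unpair q in mul_occ _ _ _ z return mul_occ op (x :: l) l' z with
             | MulOcc _ _ r s => @MulOcc _ op (x :: l) l' _ _ (inr r) s end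
  end) = @opos X (map (op x) l' ++ list_mul op l l') z p).
destruct (@occ_split X (map (op x) l') (list_mul op l l') z p) as [q|q]; rewrite h.
- pose proof (occ_unmapP q) as h'; destruct (occ_unmap q); exact h'.
- specialize (IH q); destruct (occ_unpair q); simpl in *; rewrite length_map, <- IH; lia.
Qed.

Lemma opos_pair (X : Type) (op : X -> X -> X) (l l' : list X) (x y : X)
    (p : occ l x) (q : occ l' y) :
  opos (occ_pair op p q) = opos p * length l' + opos q.
Proof.
induction l as [|z l IH]; [destruct p|].
destruct p as [e|p]; simpl.
- destruct e; rewrite opos_left, opos_map; reflexivity.
- rewrite opos_right, length_map, IH; lia.
Qed.

(** * Semantics of the matrices *)

Section MatSemantics.
Context (Th : theory).
Local Notation word := (list (sort (sg Th))).
Local Notation poly := (list word).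
Local Notation cterm := (cterm (sg Th)).
Local Notation chom := (@chom (sg Th)).
Local Notation dn := (down (pos_monoidal (circ_monoidal Th))).
Local Notation mhom := (@mhom dn).
Local Notation raw := (raw Th).
Implicit Types (a b : word) (A B D : poly) (R : raw) (i j : nat).

Definition matsem A B (M : mhom A B) : raw := fun i j c =>
  exists a b (p : occ A a) (q : occ B b) (f : chom a b),
    opos p = i /\ opos q = j /\ chom_term f = c /\ dset (M a b p q) f.

Lemma chom_eq a b (f g : chom a b) : chom_term f = chom_term g -> f = g.
Proof.
destruct f as [c hc], g as [d hd]; simpl; intros h; subst d.
rewrite (proof_irrelevance _ hc hd); reflexivity.
Qed.

Lemma matsem_at A B (M : mhom A B) a b (p : occ A a) (q : occ B b) (f : chom a b) :
  matsem M (opos p) (opos q) (chom_term f) <-> dset (M a b p q) f.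
Proof.
split.
- intros [a' [b' [p' [q' [f' [hp [hq [hf h]]]]]]]].
  destruct (opos_label hp), (opos_label hq).
  apply opos_inj in hp, hq; apply chom_eq in hf; subst; exact h.
- intros h; exists a, b, p, q, f; auto.
Qed.

Lemma matsem_mat A B (M : mhom A B) : is_mat A B (matsem M).
Proof.
split.
- intros i j c [a [b [p [q [f [<- [<- [<- _]]]]]]]]; exists a, b.
  split; [apply nth_opos | split; [apply nth_opos | apply chom_typed]].
- intros i j.
  destruct (nth_error A i) as [a|] eqn:ha; [destruct (nth_error B j) as [b|] eqn:hb|].
  + destruct (opos_ex ha) as [p <-], (opos_ex hb) as [q <-].
    destruct (dset_fg (M a b p q)) as [L hL].
    exists (map (@chom_term _ a b) L); intros c; split.
    * intros [a' [b' [p' [q' [f [hp [hq [<- h]]]]]]]].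
      destruct (opos_label hp), (opos_label hq).
      apply opos_inj in hp, hq; subst p' q'.
      apply hL in h; destruct h as [g hg hfg]; exists (chom_term g).
      -- apply in_map, hg.
      -- apply cl_cle, hfg.
    * intros [d hd hc]; apply in_map_iff in hd; destruct hd as [g [<- hg]].
      pose proof (cl_typedl hc (chom_typed g)) as tc.
      exists a, b, p, q, (CHom tc); split; [|split; [|split]]; trivial.
      apply hL; exists g; trivial; apply cl_cle, hc.
  + exists []; intros c; split; [|intros [d [] _]].
    intros [a' [b' [p [q [f [_ [hq _]]]]]]]; subst j; rewrite nth_opos in hb; discriminate.
  + exists []; intros c; split; [|intros [d [] _]].
    intros [a' [b' [p [q [f [hp _]]]]]]; subst i; rewrite nth_opos in ha; discriminate.
Qed.

Lemma matsem_requ A B (M : mhom A B) R :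
  is_mat A B R ->
  (forall a b (p : occ A a) (q : occ B b) (f : chom a b),
     dset (M a b p q) f <-> R (opos p) (opos q) (chom_term f)) ->
  requ (matsem M) R.
Proof.
intros hR h i j c; split.
- intros [a [b [p [q [f [<- [<- [<- hf]]]]]]]]; apply h, hf.
- intros hc; pose proof (proj1 hR _ _ _ hc) as [a [b [ha [hb tc]]]].
  destruct (opos_ex ha) as [p <-], (opos_ex hb) as [q <-].
  exists a, b, p, q, (CHom tc); split; [|split; [|split]]; trivial; apply h, hc.
Qed.

Lemma fin_gen_terms a b (L : list cterm) :
  exists K : list (chom a b), forall f : chom a b,
    (exists2 d, In d L & cl (Th := Th) (chom_term f) d) <->
    (exists2 g, In g K & cl (Th := Th) (chom_term f) (chom_term g)).
Proof.
induction L as [|d L [K hK]].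
- exists []; intros f; split; intros [? [] _].
- destruct (classic (ctyped d a b)) as [td|td].
  + exists (CHom td :: K); intros f; split.
    * intros [e [<-|he] hf]; [exists (CHom td); simpl; auto|].
      destruct (proj1 (hK f)) as [g hg hfg]; [exists e; auto|]; exists g; simpl; auto.
    * intros [g [<-|hg] hf]; [exists d; simpl; auto|].
      destruct (proj2 (hK f)) as [e he hfe]; [exists g; auto|]; exists e; simpl; auto.
  + exists K; intros f; rewrite <- hK; split; intros [e he hf]; exists e; simpl; auto.
    destruct he as [<-|he]; trivial.
    destruct td; apply (cl_typedr hf (chom_typed f)).
Qed.

Lemma matsem_full A B R : is_mat A B R -> exists M : mhom A B, requ (matsem M) R.
Proof.
intros hR.
assert (H : forall a b (p : occ A a) (q : occ B b),
  @fin_gen (pos (circ_cat Th)) a b (fun f => R (opos p) (opos q) (chom_term f))).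
{ intros a b p q; destruct (proj2 hR (opos p) (opos q)) as [L hL].
  destruct (fin_gen_terms a b L) as [K hK]; exists K; intros f.
  rewrite hL, hK; split; intros [g hg hf]; exists g; trivial; apply cl_cle, hf. }
exists (fun a b p q => DHom (H a b p q)).
apply matsem_requ; [exact hR | reflexivity].
Qed.

Lemma entry_atP B (a b c : word) (p : occ B b) (q : occ B c) (h : chom a b)
    (f : chom a c) :
  dset (@entry_at dn B a b c p (@dprincipal (pos (circ_cat Th)) a b h) q) f <->
  opos p = opos q /\ cl (chom_term f) (chom_term h).
Proof.
unfold entry_at; pose proof (@occ_sameP (ob dn) B b c p q) as e.
destruct (@occ_same (ob dn) B b c p q) as [e'|].
- destruct e'; simpl; split.
  + intros [g <- hg]; split; trivial; apply cl_cle, hg.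
  + intros [_ hf]; exists h; trivial; apply cl_cle, hf.
- split; [intros [] | intros [h' _]; contradiction].
Qed.

Lemma rfun_at A (g : nat -> nat) a (p : occ A a) j (c : cterm) :
  rfun A g (opos p) j c <-> j = g (opos p) /\ cl c (cid a).
Proof.
unfold rfun; rewrite nth_opos; split.
- intros [a' [[= <-] h]]; exact h.
- intros h; exists a; auto.
Qed.

Lemma mfunP A B (phi : forall a, occ A a -> occ B a) (f : nat -> nat) :
  lab A B f -> (forall a (p : occ A a), opos (phi a p) = f (opos p)) ->
  isfun A B f (matsem (@mfun dn A B phi)).
Proof.
intros hl h; eapply isfun_requ; [symmetry; apply matsem_requ | apply isfun_rfun, hl].
- apply (is_mat_fun (isfun_rfun hl)).
- intros a b p q g; rewrite rfun_at, <- h.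
  unfold mfun; refine (iff_trans (@entry_atP B a a b (phi a p) q (chom_id a) g) _).
  split; intros [h1 h2]; auto.
Qed.

Lemma midP A a b (p : occ A a) (q : occ A b) (f : chom a b) :
  dset (@mid dn A a b p q) f <-> opos p = opos q /\ cl (chom_term f) (cid a).
Proof. exact (@entry_atP A a a b p q (chom_id a) f). Qed.

Lemma matsem_comp A B D (M : mhom A B) (N : mhom B D) :
  requ (matsem (@mcomp dn A B D M N)) (rcomp (matsem M) (matsem N)).
Proof.
apply matsem_requ; [eapply is_mat_comp; apply matsem_mat|].
intros a d p q f; unfold mcomp.
(* Addition in [down] is union and its zero is empty, so an element of a finite sum is an element of
   one summand. *)
assert (E : forall L : list {x : word & occ B x},
  dset (fold_right (@add dn a d) zero
    (map (fun s => @comp dn _ _ _ (M a _ p (projT2 s)) (N _ d (projT2 s) q)) L)) f <->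
  exists s, In s L /\
    dset (@comp dn _ _ _ (M a _ p (projT2 s)) (N _ d (projT2 s) q)) f).
{ induction L as [|s L IH]; simpl.
  - split; [intros [] | intros [s [[] _]]].
  - split.
    + intros [h|h]; [exists s; auto | apply IH in h; destruct h as [s' [h1 h2]]].
      exists s'; auto.
    + intros [s' [[<-|h1] h2]]; [left; exact h2 | right; apply IH; exists s'; auto]. }
refine (iff_trans (E (occ_enum B)) _); clear E; split.
- intros [[b r] [_ h]]; simpl in h; destruct h as [g [x [y [hx [hy ->]]]] hf].
  exists (opos r), (chom_term x), (chom_term y); rewrite !matsem_at.
  splits; apply (proj2 (cl_cle (Th := Th) f (chom_comp x y))), hf.
- intros [k [m [n [hm [hn hc]]]]].
  destruct (proj1 (matsem_mat M) _ _ _ hm) as [a' [b [ha [hb tm]]]].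
  destruct (proj1 (matsem_mat N) _ _ _ hn) as [b' [d' [hb' [hd tn]]]].
  rewrite nth_opos in ha, hd; injection ha as <-; injection hd as <-.
  rewrite hb in hb'; injection hb' as <-.
  destruct (opos_ex hb) as [r <-].
  exists (existT _ b r); split; [apply in_occ_enum|]; simpl.
  exists (chom_comp (CHom tm) (CHom tn)).
  + exists (CHom tm), (CHom tn); rewrite <- !matsem_at; auto.
  + apply cl_cle, hc.
Qed.

Lemma matsem_sum A B A' B' (M : mhom A B) (N : mhom A' B') :
  requ (matsem (@msum dn A B A' B' M N))
    (rdsum (length A) (length B) (matsem M) (matsem N)).
Proof.
apply matsem_requ; [apply is_mat_sum; apply matsem_mat|].
intros a b p q f; unfold msum, rdsum; change (ob dn) with word.
pose proof (@occ_splitP word A A' a p) as hp.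
pose proof (@occ_splitP word B B' b q) as hq.
destruct (@occ_split word A A' a p) as [p'|p'],
  (@occ_split word B B' b q) as [q'|q']; rewrite hp, hq;
  pose proof (opos_lt p'); pose proof (opos_lt q').
- rewrite matsem_at; intuition lia.
- split; [intros [] | intuition lia].
- split; [intros [] | intuition lia].
- replace (length A + opos p' - length A) with (opos p') by lia.
  replace (length B + opos q' - length B) with (opos q') by lia.
  rewrite matsem_at; intuition lia.
Qed.

Lemma matsem_prod A B A' B' (M : mhom A B) (N : mhom A' B') :
  requ (matsem (@mprod dn A B A' B' M N))
    (rkron (length A') (length B') (matsem M) (matsem N)).
Proof.
apply matsem_requ; [apply is_mat_prod; apply matsem_mat|].
intros a b p q f; unfold mprod; change (ob dn) with word.
rewrite <- (@occ_unpairP word _ _ _ _ p), <- (@occ_unpairP word _ _ _ _ q).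
destruct (@occ_unpair word _ _ _ _ p) as [a a' i i'],
  (@occ_unpair word _ _ _ _ q) as [b b' j j']; simpl mpos.
unfold rkron; rewrite !div_pair, !mod_pair by apply opos_lt; split.
- intros [g [x [y [hx [hy ->]]]] hf].
  exists (chom_term x), (chom_term y); rewrite !matsem_at; splits.
  apply (proj2 (cl_cle (Th := Th) f (chom_ten x y))), hf.
- intros [m [n [hm [hn hc]]]].
  destruct (proj1 (matsem_mat M) _ _ _ hm) as [a1 [b1 [ha [hb tm]]]].
  destruct (proj1 (matsem_mat N) _ _ _ hn) as [a2 [b2 [ha2 [hb2 tn]]]].
  rewrite nth_opos in ha, hb, ha2, hb2.
  injection ha as <-; injection hb as <-; injection ha2 as <-; injection hb2 as <-.
  exists (chom_ten (CHom tm) (CHom tn)).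
  + exists (CHom tm), (CHom tn); rewrite <- !matsem_at; auto.
  + apply cl_cle, hc.
Qed.

Lemma matsem_pbraid A B : requ (matsem (@mprod_braid dn A B)) (rpbraid A B).
Proof.
apply matsem_requ; [apply (is_mat_lf (islf_pbraid A B))|].
intros a b p q f; unfold mprod_braid, rpbraid, rlf; change (ob dn) with word.
rewrite <- (@occ_unpairP word _ _ _ _ p).
destruct (@occ_unpair word _ _ _ _ p) as [a a' i j]; simpl mpos.
rewrite fpbraid_pair, lpbraid_pair by apply opos_lt.
rewrite (nth_error_nth_eq [] (nth_opos i)), (nth_error_nth_eq [] (nth_opos j)).
refine (iff_trans (@entry_atP _ _ _ _ (occ_pair (@app _) j i) q (chom_sym a a') f) _).
rewrite opos_pair.
pose proof (pair_lt (opos_lt i) (opos_lt j)); intuition.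
Qed.

Lemma matsem_diag A : isfun (A ++ A) A (fdiag (length A)) (rtr (matsem (@mdiag dn A))).
Proof.
pose proof (isfun_rfun (@lab_diag Th A)) as hD.
apply (isfun_requ (R := rfun (A ++ A) (fdiag (length A)))); [|exact hD].
symmetry; apply rtr_requ; symmetry; symmetry; apply matsem_requ.
{ apply is_mat_cofun with (f := fdiag (length A)); exact hD. }
intros a b p q f; unfold rtr; rewrite rfun_at; unfold mdiag, fdiag; change (ob dn) with word.
pose proof (@occ_splitP word A A b q) as hq.
destruct (@occ_split word A A b q) as [q'|q']; rewrite hq; pose proof (opos_lt q').
- cases_ltb.
  rewrite midP; split; intros [h1 h2]; split; trivial;
    destruct (opos_label h1); assumption.
- cases_ltb.
  rewrite (Nat.add_comm (length A)), Nat.add_sub.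
  rewrite midP; split; intros [h1 h2]; split; trivial;
    destruct (opos_label h1); assumption.
Qed.

Lemma matsem_codiag A : isfun (A ++ A) A (fdiag (length A)) (matsem (@mcodiag dn A)).
Proof.
pose proof (isfun_rfun (@lab_diag Th A)) as hD.
apply (isfun_requ (R := rfun (A ++ A) (fdiag (length A)))); [|exact hD].
symmetry; apply matsem_requ; [apply (is_mat_fun hD)|].
intros a b p q f; rewrite rfun_at; unfold mcodiag, fdiag; change (ob dn) with word.
pose proof (@occ_splitP word A A a p) as hp.
destruct (@occ_split word A A a p) as [p'|p']; rewrite hp; pose proof (opos_lt p').
- cases_ltb.
  rewrite midP; intuition.
- cases_ltb.
  rewrite (Nat.add_comm (length A)), Nat.add_sub, midP; intuition.
Qed.

Lemma matsem_distl A B D :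
  isfun (pmul A (B ++ D)) (pmul A B ++ pmul A D)
    (fdistl (length A) (length B) (length D)) (matsem (@mdistl dn A B D)).
Proof.
apply mfunP; [apply lab_distl|]; change (ob dn) with word.
intros w p; rewrite <- (@occ_unpairP word _ _ _ _ p).
destruct (@occ_unpair word _ _ _ _ p) as [a b i j]; simpl mpos; rewrite length_app.
pose proof (@occ_splitP word B D b j) as hj.
destruct (@occ_split word B D b j) as [j'|j']; rewrite hj.
- rewrite opos_left, opos_pair, fdistl_pairl by apply opos_lt; reflexivity.
- rewrite opos_right, opos_pair, fdistl_pairr by apply opos_lt.
  f_equal; apply length_pmul.
Qed.

Lemma matsem_braid A B :
  isfun (A ++ B) (B ++ A) (fbraid (length A) (length B)) (matsem (@msum_braid dn A B)).
Proof.
apply mfunP; [apply lab_braid|]; change (ob dn) with word.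
intros w p; pose proof (@occ_splitP word A B w p) as hp; unfold fbraid.
destruct (@occ_split word A B w p) as [q|q]; rewrite hp; pose proof (opos_lt q).
- rewrite opos_right; cases_ltb; lia.
- rewrite opos_left; cases_ltb; lia.
Qed.

Lemma mat_raw_sem : inhabited (raw_sem Th (mat dn)).
Proof.
constructor.
apply (@RawSem Th (mat dn) (fun A => A) (fun A => A) (fun A => eq_refl) (fun A => eq_refl)
  matsem); try reflexivity.
- exact matsem_mat.
- exact matsem_full.
- intros A B M N; split.
  + intros h i j c [a [b [p [q [f [<- [<- [<- hf]]]]]]]]; apply matsem_at, (h a b p q), hf.
  + intros h a b p q f hf; apply matsem_at, h, matsem_at, hf.
- intros A B M N; split.
  + intros h i j c; split; intros [a [b [p [q [f [<- [<- [<- hf]]]]]]]];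
      apply matsem_at, (h a b p q), hf.
  + intros h a b p q f; rewrite <- !matsem_at; apply h.
- intros A; apply (@mfunP A A (fun a p => p) (fun i => i)); [intros i a hi; exact hi | reflexivity].
- exact matsem_comp.
- exact matsem_sum.
- exact matsem_prod.
- exact matsem_braid.
- exact matsem_pbraid.
- exact matsem_diag.
- exact matsem_codiag.
- exact matsem_distl.
Qed.

End MatSemantics.

(** * Semantics of tapes *)

Section TapeSemantics.
Context (Th : theory).
Local Notation word := (list (sort (sg Th))).
Local Notation poly := (list word).
Local Notation cterm := (cterm (sg Th)).
Local Notation tape := (tape (sg Th)).
Local Notation raw := (raw Th).
Implicit Types (U V W : word) (P Q R A B : poly) (c d : cterm) (s t u x : tape) (i j k l
  : nat) (f g : nat -> nat).
Local Notation rid A := (rfun A (fun i => i)).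

(** The interpretation is defined on untyped tapes, whereas [rdsum] needs the dimensions of its
    first block; [tin] and [tout] read them off the syntax. *)
Fixpoint tin (t : tape) : nat :=
  match t with
  | tid0 _ | tcobang _ => 0
  | tidm _ | tbox _ | tdiag _ | tbang _ => 1
  | tswap _ _ | tcodiag _ => 2
  | tcomp s _ => tin s
  | tsum s t => tin s + tin t
  end.

Fixpoint tout (t : tape) : nat :=
  match t with
  | tid0 _ | tbang _ => 0
  | tidm _ | tbox _ | tcodiag _ | tcobang _ => 1
  | tswap _ _ | tdiag _ => 2
  | tcomp _ t => tout t
  | tsum s t => tout s + tout t
  end.

Lemma tin_typed t P Q : ttyped t P Q -> tin t = length P.
Proof. induction 1; simpl; trivial; rewrite length_app; congruence. Qed.

Lemma tout_typed t P Q : ttyped t P Q -> tout t = length Q.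
Proof. induction 1; simpl; trivial; rewrite length_app; congruence. Qed.

(** One boundary of [tbang] and of [tcobang] has no positions, hence the empty relations. A box
    generates its single entry; it is the only place where a generator of the signature can
    enter. *)
Fixpoint rt (t : tape) : raw :=
  match t with
  | tid0 _ | tbang _ | tcobang _ => fun _ _ _ => False
  | tidm U => rid [U]
  | tbox d => fun i j c => i = 0 /\ j = 0 /\ cl c d
  | tswap U V => rfun [U; V] (fbraid 1 1)
  | tdiag U => rtr (rfun [U; U] (fdiag 1))
  | tcodiag U => rfun [U; U] (fdiag 1)
  | tcomp s t => rcomp (rt s) (rt t)
  | tsum s t => rdsum (tin s) (tout s) (rt s) (rt t)
  end.

Lemma rt_sum s t P Q :
  ttyped s P Q -> rt (tsum s t) = rdsum (length P) (length Q) (rt s) (rt t).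
Proof. intros h; simpl; rewrite (tin_typed h), (tout_typed h); reflexivity. Qed.

Lemma is_mat_empty P Q : is_mat P Q (fun _ _ _ => False : Prop).
Proof.
split; [intros i j c [] | intros i j; exists []; intros c; split; [intros [] | intros [d [] _]]].
Qed.

Lemma is_mat_box d U V : ctyped d U V -> is_mat [U] [V] (rt (tbox d)).
Proof.
intros td; split.
- intros i j c [-> [-> h]]; exists U, V; splits; apply (cl_typedl h td).
- intros i j; destruct (Nat.eq_dec i 0) as [->|hi]; [destruct (Nat.eq_dec j 0) as [->|hj]|].
  + exists [d]; intros c; split; [intros [_ [_ h]]; exists d; simpl; auto|].
    intros [e [<-|[]] h]; simpl; auto.
  + exists []; intros c; split; [intros [_ [? _]]; contradiction | intros [e [] _]].
  + exists []; intros c; split; [intros [? _]; contradiction | intros [e [] _]].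
Qed.

Lemma rt_mat t P Q : ttyped t P Q -> is_mat P Q (rt t).
Proof.
induction 1.
- apply is_mat_empty.
- apply (is_mat_fun (isfun_id _)).
- apply is_mat_box; assumption.
- apply (is_mat_fun (isfun_rfun (@lab_braid Th [U] [V]))).
- apply (is_mat_cofun (f := fdiag 1)), (isfun_rfun (@lab_diag Th [U])).
- apply is_mat_empty.
- apply (is_mat_fun (isfun_rfun (@lab_diag Th [U]))).
- apply is_mat_empty.
- eapply is_mat_comp; eassumption.
- rewrite (rt_sum t H); apply is_mat_sum; assumption.
Qed.

Lemma isfun_tidm U : isfun [U] [U] (fun i => i) (rt (tidm U)).
Proof. apply isfun_id. Qed.

Lemma isfun_tswap U V : isfun [U; V] [V; U] (fbraid 1 1) (rt (tswap U V)).
Proof. apply (isfun_rfun (@lab_braid Th [U] [V])). Qed.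

Lemma isfun_tcodiag U : isfun [U; U] [U] (fdiag 1) (rt (tcodiag U)).
Proof. apply (isfun_rfun (@lab_diag Th [U])). Qed.

Lemma cofun_tdiag U : isfun [U; U] [U] (fdiag 1) (rtr (rt (tdiag U))).
Proof. apply (isfun_rfun (@lab_diag Th [U])). Qed.

Lemma cofun_rfun_id A : isfun A A (fun i => i) (rtr (rid A)).
Proof.
split; [intros i a h; exact h|].
intros i j c; unfold rtr, rfun; split; intros [a [h1 [-> h2]]]; exists a; auto.
Qed.

Lemma cofun_id A (R : raw) : isfun A A (fun i => i) R -> isfun A A (fun i => i) (rtr R).
Proof.
intros [_ h]; apply (isfun_requ (R := rtr (rid A))); [|apply cofun_rfun_id].
intros i j c; symmetry; apply h.
Qed.

Lemma cofun_tidm U : isfun [U] [U] (fun i => i) (rtr (rt (tidm U))).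
Proof. apply cofun_rfun_id. Qed.

Lemma cofun_tbang U : isfun [] [U] (fun i => i) (rtr (rt (tbang U))).
Proof. apply isfun_nil, is_mat_empty. Qed.

Lemma isfun_tcobang U : isfun [] [U] (fun i => i) (rt (tcobang U)).
Proof. apply isfun_nil, is_mat_empty. Qed.

(** The transpose of a permutation matrix is its inverse. Diagonals and [tdistlV] are described
    through transposes, and the symmetries inside them need this form. *)
Lemma isfun_inv A B f g (R : raw) :
  isfun A B f R -> lab B A g ->
  (forall i, i < length A -> g (f i) = i) -> (forall i, i < length B -> f (g i) = i) ->
  isfun B A g (rtr R).
Proof.
intros [hl h] hg e e'; split; trivial.
intros i j c; unfold rtr; rewrite (h j i c); unfold rfun.
split; intros [a [h1 [-> h2]]]; exists a; split; auto.
- rewrite e by (eapply nth_error_lt, h1); auto.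
- rewrite e' by (eapply nth_error_lt, h1); auto.
Qed.

Ltac sizes :=
  rewrite ?(tin_typed (tid_typed _)), ?(tout_typed (tid_typed _)),
    ?(tin_typed (tswapm_typed _ _)), ?(tout_typed (tswapm_typed _ _)),
    ?(tin_typed (tbraid_typed _ _)), ?(tout_typed (tbraid_typed _ _));
  cbn [tin tout length]; rewrite ?length_app; cbn [length].

Ltac sums :=
  sizes; intro; cbv beta; unfold fsum, fbraid, fdiag;
  cases_ltb; lia.

Lemma isfun_tid P : isfun P P (fun i => i) (rt (tid P)).
Proof.
induction P as [|U P IH]; [apply isfun_nil, is_mat_empty|].
eapply isfun_ext; [apply (isfun_sum (isfun_tidm U) IH eq_refl eq_refl) | sums].
Qed.

Lemma rt_tid P : requ (rt (tid P)) (rid P).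
Proof. apply isfun_tid. Qed.

Lemma isfun_tswapm U Q :
  isfun (U :: Q) (Q ++ [U]) (fbraid 1 (length Q)) (rt (tswapm U Q)).
Proof.
induction Q as [|V Q IH].
- eapply isfun_ext; [apply isfun_tidm | sums].
- eapply isfun_ext.
  + apply (isfun_comp (isfun_sum (isfun_tswap U V) (isfun_tid Q) eq_refl eq_refl)
      (isfun_sum (isfun_tidm V) IH eq_refl eq_refl)); reflexivity.
  + sums.
Qed.

Lemma isfun_tbraid P Q :
  isfun (P ++ Q) (Q ++ P) (fbraid (length P) (length Q)) (rt (tbraid P Q)).
Proof.
induction P as [|U P IH].
- rewrite app_nil_r; eapply isfun_ext; [apply isfun_tid | sums].
- eapply isfun_ext; [eapply isfun_cast; [
    apply (isfun_comp (isfun_sum (isfun_tidm U) IH eq_refl eq_refl)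
      (isfun_sum (isfun_tswapm U Q) (isfun_tid P)
        (tin_typed (tswapm_typed U Q)) (tout_typed (tswapm_typed U Q))) eq_refl) | |] |].
  + reflexivity.
  + rewrite <- app_assoc; reflexivity.
  + sums.
Qed.

Lemma cofun_tbraid P Q :
  isfun (Q ++ P) (P ++ Q) (fbraid (length Q) (length P)) (rtr (rt (tbraid P Q))).
Proof. apply (isfun_inv (isfun_tbraid P Q)); [apply lab_braid | sums | sums]. Qed.

Lemma cofun_tdiagp P : isfun (P ++ P) P (fdiag (length P)) (rtr (rt (tdiagp P))).
Proof.
induction P as [|U P IH]; [apply isfun_nil, is_mat_empty|].
eapply isfun_ext; [eapply isfun_cast; [
  apply (cofun_comp (cofun_sum (cofun_tdiag U) IH eq_refl eq_refl)
    (cofun_sum (cofun_tidm U) (cofun_sum (cofun_tbraid [U] P) (cofun_id (isfun_tid P))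
      (tin_typed (tbraid_typed [U] P)) (tout_typed (tbraid_typed [U] P)))
      eq_refl eq_refl)) | |] |].
- reflexivity.
- rewrite <- app_assoc; reflexivity.
- reflexivity.
- sums.
Qed.

Lemma isfun_tcodiagp P : isfun (P ++ P) P (fdiag (length P)) (rt (tcodiagp P)).
Proof.
induction P as [|U P IH]; [apply isfun_nil, is_mat_empty|].
eapply isfun_ext; [eapply isfun_cast; [
  apply (isfun_comp 
    (isfun_sum (isfun_tidm U) (isfun_sum (isfun_tbraid P [U]) (isfun_tid P)
      (tin_typed (tbraid_typed P [U])) (tout_typed (tbraid_typed P [U])))
      eq_refl eq_refl) (isfun_sum (isfun_tcodiag U) IH eq_refl eq_refl)) | |] |].
- reflexivity.
- simpl; rewrite <- app_assoc; reflexivity.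
- reflexivity.
- sums.
Qed.

(** The recursion of [tdistl] on positions: the remaining [p] rows are distributed first, then the
    [r] part of the first row moves past their [p * q] positions. *)
Lemma fdistl_cons (p q r i : nat) :
  i < S p * (q + r) ->
  fsum q q (fun i => i) (fsum (r + p * q) (p * q + r) (fbraid r (p * q)) (fun i => i))
    (fsum (q + r) (q + r) (fun i => i) (fdistl p q r) i) = fdistl (S p) q r i.
Proof.
intros hi.
destruct (Nat.lt_ge_cases i (q + r)) as [h|h].
- rewrite (fsum_l (n := q + r)) by exact h.
  destruct (Nat.lt_ge_cases i q) as [h'|h'].
  + rewrite fsum_l by exact h'.
    symmetry; apply (fdistl_pairl (S p) r 0 h').
  + replace i with (q + (i - q)) by lia.
    rewrite fsum_r, fsum_l by lia; unfold fbraid.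
    cases_ltb.
    (* Row [0]: its [r] part lands directly behind the [S p * q] positions of the first summand. *)
    transitivity (S p * q + (0 * r + (i - q))); [lia|].
    symmetry; apply (fdistl_pairr (S p) q 0 H).
- replace i with ((q + r) + (i - (q + r))) by lia; rewrite fsum_r.
  set (k := i - (q + r)) in *.
  assert (hk : k < p * (q + r)) by lia; clearbody k.
  destruct (pair_sum_ex hk) as [[x [y [hx [hy ->]]]]|[x [y [hx [hy ->]]]]].
  + rewrite fdistl_pairl by exact hy.
    replace (q + r + (x * (q + r) + y)) with (S x * (q + r) + y) by ring.
    rewrite fdistl_pairl by exact hy.
    pose proof (pair_lt hx hy).
    replace (q + r + (x * q + y)) with (q + (r + (x * q + y))) by lia.
    rewrite fsum_r, fsum_l by lia; unfold fbraid.
    cases_ltb; lia.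
  + rewrite fdistl_pairr by exact hy.
    replace (q + r + (x * (q + r) + (q + y))) with (S x * (q + r) + (q + y)) by ring.
    rewrite fdistl_pairr by exact hy.
    replace (q + r + (p * q + (x * r + y))) with (q + (r + p * q + (x * r + y))) by lia.
    rewrite !fsum_r; lia.
Qed.

Lemma isfun_tdistl P Q R :
  isfun (pmul P (Q ++ R)) (pmul P Q ++ pmul P R)
    (fdistl (length P) (length Q) (length R)) (rt (tdistl P Q R)).
Proof.
induction P as [|U P IH]; [apply isfun_nil, is_mat_empty|].
eapply isfun_ext; [eapply isfun_cast; [
  apply (isfun_comp
    (isfun_sum (isfun_tid (pmul [U] (Q ++ R))) IH
       (tin_typed (tid_typed _)) (tout_typed (tid_typed _)))
    (isfun_sum (isfun_tid (pmul [U] Q))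
       (isfun_sum (isfun_tbraid (pmul [U] R) (pmul P Q)) (isfun_tid (pmul P R))
         (tin_typed (tbraid_typed _ _)) (tout_typed (tbraid_typed _ _)))
       (tin_typed (tid_typed _)) (tout_typed (tid_typed _)))) | |] |].
- rewrite pmul_sum, <- !app_assoc; reflexivity.
- rewrite <- pmul_cons; reflexivity.
- rewrite (pmul_cons U P Q), (pmul_cons U P R), <- !app_assoc; reflexivity.
- sizes; rewrite !length_pmul, ?length_app; cbn [length].
  rewrite !Nat.mul_1_l; intros i hi; apply fdistl_cons; simpl; lia.
Qed.

(** Since [tdistlV] is the mirror image of [tdistl], its transpose has the same position map. For
    [tdistl_inv] it then only remains to see that [fdistl] is injective. *)
Lemma cofun_tdistlV P Q R :
  isfun (pmul P (Q ++ R)) (pmul P Q ++ pmul P R)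
    (fdistl (length P) (length Q) (length R)) (rtr (rt (tdistlV P Q R))).
Proof.
induction P as [|U P IH]; [apply isfun_nil, is_mat_empty|].
eapply isfun_ext; [eapply isfun_cast; [
  apply (cofun_comp
    (cofun_sum (cofun_id (isfun_tid (pmul [U] Q)))
       (cofun_sum (cofun_tbraid (pmul P Q) (pmul [U] R)) (cofun_id (isfun_tid (pmul P R)))
         (tin_typed (tbraid_typed _ _)) (tout_typed (tbraid_typed _ _)))
       (tin_typed (tid_typed _)) (tout_typed (tid_typed _)))
    (cofun_sum (cofun_id (isfun_tid (pmul [U] (Q ++ R)))) IH
       (tin_typed (tid_typed _)) (tout_typed (tid_typed _)))) | |] |].
- rewrite pmul_sum, <- !app_assoc; reflexivity.
- rewrite <- pmul_cons; reflexivity.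
- rewrite (pmul_cons U P Q), (pmul_cons U P R), <- !app_assoc; reflexivity.
- sizes; rewrite !length_pmul, ?length_app; cbn [length].
  rewrite !Nat.mul_1_l; intros i hi; apply fdistl_cons; simpl; lia.
Qed.

(** * Whiskering and the tensor of tapes *)

Lemma requ_rtr (R S : raw) : requ R S -> requ (rtr R) (rtr S).
Proof. intros h i j c; apply (h j i c). Qed.

(** What the left and right whiskerings of diagrams have in common: monotone functors, with [w] the
    action on monomials and [k] the action on terms. The computations with [rmap] are then done once
    for both sides. *)
Record whisker (w : word -> word) (k : cterm -> cterm) : Prop := {
  whisker_typed : forall c U V, ctyped c U V -> ctyped (k c) (w U) (w V);
  whisker_cl : forall c d, cl (Th := Th) c d -> cl (Th := Th) (k c) (k d);
  whisker_id : forall U, ceq (w U) (w U) (k (cid U)) (cid (w U));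
  whisker_comp : forall c d U V W, ctyped c U V -> ctyped d V W ->
    ceq (w U) (w W) (k (ccomp c d)) (ccomp (k c) (k d))
}.

Lemma whisker_left U : whisker (app U) (cten (cid U)).
Proof.
split.
- intros c V W h; constructor; [constructor | exact h].
- intros c d h; apply cl_ten; [apply (cl_refl (ctyped_ids U)) | exact h].
- intros V; apply ceq_ten_id.
- intros c d V W X hc hd; eapply ceq_trans.
  + apply ceq_ten; [apply ceq_sym, ceq_idl, ctyped_ids | apply ceq_refl; eauto using ctyped].
  + apply ceq_interchange with (V := U) (V' := W); eauto using ctyped.
Qed.

Lemma whisker_right U : whisker (fun V => V ++ U) (fun c => cten c (cid U)).
Proof.
split.
- intros c V W h; constructor; [exact h | constructor].
- intros c d h; apply cl_ten; [exact h | apply (cl_refl (ctyped_ids U))].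
- intros V; apply ceq_ten_id.
- intros c d V W X hc hd; eapply ceq_trans.
  + apply ceq_ten; [apply ceq_refl; eauto using ctyped | apply ceq_sym, ceq_idl, ctyped_ids].
  + apply ceq_interchange with (V := W) (V' := U); eauto using ctyped.
Qed.

Section Whisker.
Context (w : word -> word) (k : cterm -> cterm) (hk : whisker w k).

Lemma rmap_rfun A f : requ (rfun (map w A) f) (rmap k (rfun A f)).
Proof.
intros i j c; unfold rmap, rfun; rewrite nth_error_map; split.
- intros [b [h1 [-> h2]]]; destruct (nth_error A i) as [a|]; [|discriminate].
  injection h1 as <-; exists (cid a); split.
  + exists a; splits; apply (cl_refl (ctyped_ids a)).
  + apply (cl_trans h2), (cl_ceq (ceq_sym (whisker_id hk a))).
- intros [d [[a [-> [-> hd]]] hc]]; exists (w a); splits.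
  apply (cl_trans hc), (cl_trans (whisker_cl hk hd)), (cl_ceq (whisker_id hk a)).
Qed.

Lemma rmap_comp (A B D : poly) (R S : raw) :
  is_mat A B R -> is_mat B D S ->
  requ (rcomp (rmap k R) (rmap k S)) (rmap k (rcomp R S)).
Proof.
intros hR hS i j c; split.
- intros [l [m' [n' [[m [hm lm]] [[n [hn ln]] hc]]]]].
  pose proof (is_mat_typed hR hm) as tm; pose proof (is_mat_typed hS hn) as tn.
  exists (ccomp m n); split.
  + exists l, m, n; splits; eapply cl_refl; eauto using ctyped.
  + eapply cl_trans; [|eapply cl_ceq, ceq_sym, (whisker_comp hk tm tn)].
    eapply cl_comp_inv; [exact hc | exact lm | exact ln | |]; apply (whisker_typed hk);
      eassumption.
- intros [d [[l [m [n [hm [hn hd]]]]] hc]].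
  pose proof (is_mat_typed hR hm) as tm; pose proof (is_mat_typed hS hn) as tn.
  exists l, (k m), (k n); split; [|split].
  + exists m; split; trivial; eapply cl_refl, (whisker_typed hk tm).
  + exists n; split; trivial; eapply cl_refl, (whisker_typed hk tn).
  + apply (cl_trans hc), (cl_trans (whisker_cl hk hd)), (cl_ceq (whisker_comp hk tm tn)).
Qed.

Lemma rmap_sum (n m : nat) (R S : raw) :
  requ (rdsum n m (rmap k R) (rmap k S)) (rmap k (rdsum n m R S)).
Proof.
intros i j c; split.
- intros [[h1 [h2 [d [h3 h4]]]]|[h1 [h2 [d [h3 h4]]]]]; exists d; split; trivial;
    [left | right]; auto.
- intros [d [[[h1 [h2 h3]]|[h1 [h2 h3]]] h4]]; [left | right]; split; trivial; split; trivial;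
    exists d; auto.
Qed.

Lemma rmap_box d U V : ctyped d U V -> requ (rt (tbox (k d))) (rmap k (rt (tbox d))).
Proof.
intros td i j c; simpl; unfold rmap; split.
- intros [h1 [h2 h3]]; exists d; split; trivial; splits.
  apply (cl_refl td).
- intros [e [[h1 [h2 h3]] h4]]; splits.
  apply (cl_trans h4 (whisker_cl hk h3)).
Qed.

Lemma rmap_false : requ (fun _ _ _ => False) (rmap k (fun _ _ _ => False)).
Proof. intros i j c; split; [intros [] | intros [d [[] _]]]. Qed.
End Whisker.

Lemma tin_lwm U t : tin (lwm U t) = tin t /\ tout (lwm U t) = tout t.
Proof. induction t; simpl; intuition congruence. Qed.

Lemma tin_rwm U t : tin (rwm U t) = tin t /\ tout (rwm U t) = tout t.
Proof. induction t; simpl; intuition congruence. Qed.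

Lemma rt_lwm U t P Q : ttyped t P Q -> requ (rt (lwm U t)) (rmap (cten (cid U)) (rt t)).
Proof.
pose proof (whisker_left U) as hk.
induction 1; cbn [rt lwm].
- apply rmap_false.
- apply (rmap_rfun hk [_]).
- apply (rmap_box hk H).
- apply (rmap_rfun hk [_; _]).
- apply (requ_rtr (rmap_rfun hk [_; _] (fdiag 1))).
- apply rmap_false.
- apply (rmap_rfun hk [_; _]).
- apply rmap_false.
- rewrite IHttyped1, IHttyped2; apply (rmap_comp hk (rt_mat H) (rt_mat H0)).
- destruct (tin_lwm U s) as [-> ->]; rewrite IHttyped1, IHttyped2; apply rmap_sum.
Qed.

Lemma rt_rwm U t P Q :
  ttyped t P Q -> requ (rt (rwm U t)) (rmap (fun c => cten c (cid U)) (rt t)).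
Proof.
pose proof (whisker_right U) as hk.
induction 1; cbn [rt rwm].
- apply rmap_false.
- apply (rmap_rfun hk [_]).
- apply (rmap_box hk H).
- apply (rmap_rfun hk [_; _]).
- apply (requ_rtr (rmap_rfun hk [_; _] (fdiag 1))).
- apply rmap_false.
- apply (rmap_rfun hk [_; _]).
- apply rmap_false.
- rewrite IHttyped1, IHttyped2; apply (rmap_comp hk (rt_mat H) (rt_mat H0)).
- destruct (tin_rwm U s) as [-> ->]; rewrite IHttyped1, IHttyped2; apply rmap_sum.
Qed.

Lemma rfun_id_app A B :
  requ (rid (A ++ B))
    (rdsum (length A) (length A) (rid A) (rid B)).
Proof.
eapply isfun_eq;
  [apply isfun_id | apply (isfun_sum (isfun_id A) (isfun_id B) eq_refl eq_refl)
  | reflexivity | sums].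
Qed.

(** Right distributivity is strict, so the plain sum of the whiskerings by the monomials of [S] is
    already the Kronecker product ([raw_distr_nat]). *)
Lemma rt_lw (S : poly) t P Q :
  ttyped t P Q ->
  requ (rt (lw S t)) (rkron (length P) (length Q) (rid S) (rt t)).
Proof.
intros h; induction S as [|W S IH]; cbn [lw].
- apply (raw_empty_src (Q := [])).
  + apply is_mat_empty.
  + pose proof (is_mat_prod (is_mat_fun (isfun_id [])) (rt_mat h)) as h'; exact h'.
- rewrite (rt_sum _ (lwm_typed W h)), !length_pmul, IH, (rt_lwm W h),
    (rkron_left W (rt_mat h)), (rfun_id_app [W] S); symmetry.
  apply (raw_distr_nat (is_mat_fun (isfun_id [W])) (is_mat_fun (isfun_id S)) (rt_mat h)).
Qed.

Lemma tdistl_inv P Q R :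
  requ (rcomp (rt (tdistl P Q R)) (rt (tdistlV P Q R)))
    (rid (pmul P (Q ++ R))).
Proof.
pose proof (cofun_tdistlV P Q R) as hV; intros i j c.
rewrite (fun_pre i j c (isfun_tdistl P Q R) (is_mat_cofun hV)).
pose proof (proj2 hV j (fdistl (length P) (length Q) (length R) i) c) as E.
unfold rtr in E; rewrite E; split.
- intros [hi [a [h1 [h2 h3]]]]; exists a.
  pose proof (nth_error_lt h1) as hj; rewrite length_pmul, length_app in hi, hj.
  apply (f_equal (fdistlV (length P) (length Q) (length R))) in h2.
  rewrite !fdistlK in h2 by assumption; subst j; auto.
- intros [a [h1 [-> h2]]]; split; [eapply nth_error_lt, h1 | exists a; auto].
Qed.

(** By naturality of the left distributor, the sum of whiskerings between [tdistl] and [tdistlV]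
    equals one Kronecker product followed by [tdistl] and its inverse, which cancel. *)
Lemma rt_rw (S : poly) t P Q :
  ttyped t P Q ->
  requ (rt (rw S P Q t)) (rkron (length S) (length S) (rt t) (rid S)).
Proof.
intros h; induction S as [|W S IH]; cbn [rw].
- pose proof (is_mat_prod (rt_mat h) (is_mat_fun (isfun_id []))) as h'.
  rewrite !pmul_nilr in h'; apply (raw_empty_src (Q := [])); [apply is_mat_empty | exact h'].
- cbn [rt]; change (rdsum (tin (rwm W t)) (tout (rwm W t)) (rt (rwm W t)) (rt (rw S P Q t)))
    with (rt (tsum (rwm W t) (rw S P Q t))).
  rewrite (rt_sum _ (rwm_typed W h)), !length_pmul, IH, (rt_rwm W h),
    (rkron_right W (rt_mat h)).
  pose proof (raw_distl_nat (rt_mat h) (is_mat_fun (isfun_id [W]))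
    (is_mat_fun (isfun_id S)) (isfun_tdistl P [W] S) (isfun_tdistl Q [W] S)) as E.
  cbn [length] in E |- *; rewrite <- E, <- (rfun_id_app [W] S).
  pose proof (is_mat_prod (rt_mat h) (is_mat_fun (isfun_id (W :: S)))) as hK.
  rewrite (raw_comp_assoc hK (is_mat_fun (isfun_tdistl Q [W] S))
    (is_mat_cofun (cofun_tdistlV Q [W] S))).
  rewrite tdistl_inv; apply (raw_idr hK).
Qed.

Lemma rt_prod P Q P' Q' (s : thom P Q) (t : thom P' Q') :
  requ (rt (thom_prod s t)) (rkron (length P') (length Q') (rt s) (rt t)).
Proof.
destruct s as [s hs], t as [t ht]; cbn [thom_term thom_prod rt].
rewrite (rt_lw P ht), (rt_rw Q' hs).
rewrite <- (raw_prod_comp (is_mat_fun (isfun_id P)) (rt_mat hs) (rt_mat ht)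
  (is_mat_fun (isfun_id Q'))).
rewrite (raw_idl (rt_mat hs)), (raw_idr (rt_mat ht)); reflexivity.
Qed.

Lemma rt_tpbraidm P V : requ (rt (tpbraidm P V)) (rpbraid P [V]).
Proof.
induction P as [|U P IH]; intros i j c.
- split; [intros [] | intros [h _]; simpl in h; lia].
- cbn [tpbraidm rt]; unfold rdsum; rewrite (IH (i - 1) (j - 1) c).
  unfold rpbraid, rlf, fpbraid, lpbraid; cbn [tin tout length]; rewrite !Nat.mul_1_r.
  rewrite !Nat.div_1_r, !Nat.mod_1_r; simpl.
  destruct i as [|i]; simpl; [|rewrite Nat.sub_0_r]; intuition (subst; simpl; auto; lia).
Qed.

(** The recursive clause of [tpbraid]: distributing over [[V] ++ Q] moves the column of [V] to the
    front, after which the two parts are transposed separately. *)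
Lemma raw_pbraid_cons P Q V (R : raw) :
  isfun (pmul P ([V] ++ Q)) (pmul P [V] ++ pmul P Q)
    (fdistl (length P) 1 (length Q)) R ->
  requ (rcomp R (rdsum (length P) (length P) (rpbraid P [V]) (rpbraid P Q)))
    (rpbraid P (V :: Q)).
Proof.
intros hR.
intros i j c.
assert (hX : is_mat (pmul P [V] ++ pmul P Q) (pmul [V] P ++ pmul Q P)
  (rdsum (length P) (length P) (rpbraid P [V]) (rpbraid P Q))).
{ pose proof (is_mat_sum (is_mat_lf (islf_pbraid P [V])) (is_mat_lf (islf_pbraid P Q))) as h.
  rewrite !length_pmul, Nat.mul_1_r, Nat.mul_1_l in h; exact h. }
rewrite (fun_pre i j c hR hX), length_pmul; unfold rpbraid at 3; unfold rlf.
change (length (V :: Q)) with (1 + length Q); change (length ([V] ++ Q)) with (1 + length Q).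
assert (E : forall p q : Prop, (i < length P * (1 + length Q) -> (p <-> q)) ->
  (i < length P * (1 + length Q) /\ p) <-> (i < length P * (1 + length Q) /\ q))
  by (intros; tauto).
apply E; clear E; intros hi.
destruct (pair_sum_ex hi) as [[x [y [hx [hy ->]]]]|[x [y [hx [hy ->]]]]].
- assert (y = 0) by lia; subst y; rewrite fdistl_pairl, fpbraid_pair by lia.
  change (1 + length Q) with (length (V :: Q)); rewrite lpbraid_pair by (simpl; lia).
  unfold rdsum, rpbraid, rlf, fpbraid, lpbraid; cbn [length].
  rewrite Nat.mul_1_r, Nat.add_0_r, Nat.div_1_r, Nat.mod_1_r; cbn [nth].
  rewrite !Nat.mul_0_l, !Nat.add_0_l, Nat.mul_1_r; intuition lia.
- rewrite fdistl_pairr, fpbraid_pair by lia.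
  change (1 + length Q) with (length (V :: Q)); rewrite lpbraid_pair by (simpl; lia).
  pose proof (pair_lt hx hy).
  unfold rdsum, rpbraid, rlf; rewrite Nat.mul_1_r.
  replace (length P + (x * length Q + y) - length P) with (x * length Q + y) by lia.
  rewrite fpbraid_pair, lpbraid_pair by exact hy.
  change (nth (1 + y) (V :: Q) []) with (nth y Q []).
  intuition lia.
Qed.

Lemma rt_tpbraid P Q : requ (rt (tpbraid P Q)) (rpbraid P Q).
Proof.
induction Q as [|V Q IH].
- intros i j c; split; [intros [] | intros [h _]; simpl in h; lia].
- rewrite <- (raw_pbraid_cons (isfun_tdistl P [V] Q)).
  cbn [tpbraid].
  change (rt (tcomp (tdistl P [V] Q) (tsum (tpbraidm P V) (tpbraid P Q))))
    with (rcomp (rt (tdistl P [V] Q)) (rt (tsum (tpbraidm P V) (tpbraid P Q)))).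
  rewrite (rt_sum _ (tpbraidm_typed P V)), !length_pmul, rt_tpbraidm, IH.
  rewrite Nat.mul_1_r, Nat.mul_1_l; reflexivity.
Qed.

(** ** Soundness *)

Lemma teq_typed P Q s t : teq P Q s t -> ttyped s P Q /\ ttyped t P Q.
Proof.
pose proof (@tid_typed (sg Th)) as h1; pose proof (@tbraid_typed (sg Th)) as h2.
pose proof (@tdiagp_typed (sg Th)) as h3; pose proof (@tcodiagp_typed (sg Th)) as h4.
pose proof (@tbangp_typed (sg Th)) as h5; pose proof (@tcobangp_typed (sg Th)) as h6.
assert (S : forall (s t : tape) P Q P' Q' A B, ttyped s P Q -> ttyped t P' Q' ->
  A = P ++ P' -> B = Q ++ Q' -> ttyped (tsum s t) A B).
{ intros; subst; constructor; assumption. }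
induction 1; repeat match goal with h : _ /\ _ |- _ => destruct h end;
  split; eauto using ttyped.
- rewrite !app_assoc; eauto using ttyped.
- apply (S t (tid0 _) P Q [] []); rewrite ?app_nil_r; eauto using ttyped.
- destruct (ceq_typed H); constructor; assumption.
- destruct (ceq_typed H); constructor; assumption.
- constructor; constructor.
- eauto using ttyped, ctyped.
Qed.

Lemma cofun_tswap U V : isfun [V; U] [U; V] (fbraid 1 1) (rtr (rt (tswap U V))).
Proof.
apply (isfun_inv (isfun_tswap U V)); [apply (@lab_braid Th [V] [U]) | sums | sums].
Qed.

Lemma isfun_tcomp (A B B' D : poly) f g s t :
  isfun A B f (rt s) -> isfun B' D g (rt t) -> B = B' ->
  isfun A D (fun i => g (f i)) (rt (tcomp s t)).
Proof. apply isfun_comp. Qed.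

Lemma cofun_tcomp (A B B' D : poly) f g s t :
  isfun B A f (rtr (rt s)) -> isfun D B' g (rtr (rt t)) -> B = B' ->
  isfun D A (fun i => f (g i)) (rtr (rt (tcomp s t))).
Proof. apply cofun_comp. Qed.

Lemma isfun_tsum A B A' B' f g s t :
  isfun A B f (rt s) -> isfun A' B' g (rt t) -> tin s = length A -> tout s = length B ->
  isfun (A ++ A') (B ++ B') (fsum (length A) (length B) f g) (rt (tsum s t)).
Proof. intros hs ht e e'; rewrite <- e, <- e'; apply isfun_sum; trivial.
Qed.

Lemma cofun_tsum A B A' B' f g s t :
  isfun B A f (rtr (rt s)) -> isfun B' A' g (rtr (rt t)) ->
  tin s = length A -> tout s = length B ->
  isfun (B ++ B') (A ++ A') (fsum (length B) (length A) f g) (rtr (rt (tsum s t))).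
Proof. intros hs ht e e'; rewrite <- e, <- e'; apply cofun_sum; trivial. Qed.

Ltac sizeq :=
  first [ reflexivity | sizes; reflexivity ].

Ltac tfun :=
  lazymatch goal with
  | |- isfun _ _ _ (rtr (rt (tcomp _ _))) => eapply cofun_tcomp; [tfun | tfun | reflexivity]
  | |- isfun _ _ _ (rtr (rt (tsum _ _))) => eapply cofun_tsum; [tfun | tfun | sizeq | sizeq]
  | |- isfun _ _ _ (rtr (rt (tidm _))) => apply cofun_tidm
  | |- isfun _ _ _ (rtr (rt (tdiag _))) => apply cofun_tdiag
  | |- isfun _ _ _ (rtr (rt (tbang _))) => apply cofun_tbang
  | |- isfun _ _ _ (rtr (rt (tswap ?U ?V))) => apply (cofun_tswap U V)
  | |- isfun _ _ _ (rt (tcomp _ _)) => eapply isfun_tcomp; [tfun | tfun | reflexivity]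
  | |- isfun _ _ _ (rt (tsum _ _)) => eapply isfun_tsum; [tfun | tfun | sizeq | sizeq]
  | |- isfun _ _ _ (rt (tidm _)) => apply isfun_tidm
  | |- isfun _ _ _ (rt (tcodiag _)) => apply isfun_tcodiag
  | |- isfun _ _ _ (rt (tcobang _)) => apply isfun_tcobang
  | |- isfun _ _ _ (rt (tswap _ _)) => apply isfun_tswap
  | |- isfun _ _ _ (rt (tid _)) => apply isfun_tid
  end.

Lemma teq_sound P Q s t : teq P Q s t -> requ (rt s) (rt t).
Proof.
induction 1.
- reflexivity.
- symmetry; assumption.
- etransitivity; eassumption.
- cbn [rt]; rewrite IHteq1, IHteq2; reflexivity.
- destruct (teq_typed H), (teq_typed H0).
  rewrite !(rt_sum _ H1), !(rt_sum _ H2), IHteq1, IHteq2; reflexivity.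
- eapply raw_comp_assoc; apply rt_mat; eassumption.
- cbn [rt]; rewrite rt_tid; apply (raw_idl (rt_mat H)).
- cbn [rt]; rewrite rt_tid; apply (raw_idr (rt_mat H)).
- change (requ (rt (tsum (tcomp s t) (tcomp s' t')))
    (rcomp (rt (tsum s s')) (rt (tsum t t')))).
  rewrite (rt_sum _ (ttyped_comp H H0)), (rt_sum _ H), (rt_sum _ H0).
  apply (raw_sum_comp (rt_mat H) (rt_mat H0) (rt_mat H1) (rt_mat H2)).
- apply raw_sum_assoc.
- apply raw_sum_unitl.
- rewrite (rt_sum _ H); apply (raw_sum_unitr (rt_mat H)), is_mat_empty.
- change (requ (rcomp (rt (tsum s t)) (rt (tbraid Q Q')))
    (rcomp (rt (tbraid P P')) (rt (tsum t s)))).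
  rewrite (rt_sum _ H), (rt_sum _ H0).
  apply (raw_braid_nat (rt_mat H) (rt_mat H0)); apply isfun_tbraid.
- eapply isfun_eq; [tfun | tfun | reflexivity | sums].
- eapply cofun_eq; [tfun | tfun | reflexivity | sums].
- eapply cofun_eq; [tfun | tfun | reflexivity | sums].
- eapply cofun_eq; [tfun | tfun | reflexivity | sums].
- eapply isfun_eq; [tfun | tfun | reflexivity | sums].
- eapply isfun_eq; [tfun | tfun | reflexivity | sums].
- eapply isfun_eq; [tfun | tfun | reflexivity | sums].
- change (requ (rcomp (rt t) (rt (tdiagp Q))) (rcomp (rt (tdiagp P)) (rt (tsum t t)))).
  rewrite (rt_sum _ H); apply (raw_diag_nat (rt_mat H)); apply cofun_tdiagp.
- apply (raw_empty_tgt (P := P)); [eapply (rt_mat (ttyped_comp H (tbangp_typed Q)))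
    | apply rt_mat, tbangp_typed].
- change (requ (rcomp (rt (tcodiagp P)) (rt t)) (rcomp (rt (tsum t t)) (rt (tcodiagp Q)))).
  rewrite (rt_sum _ H); apply (raw_codiag_nat (rt_mat H)); apply isfun_tcodiagp.
- apply (raw_empty_src (Q := Q)); [eapply (rt_mat (ttyped_comp (tcobangp_typed P) H))
    | apply rt_mat, tcobangp_typed].
- intros i j e; cbn [rt]; split; intros [h1 [h2 h3]]; split; [|split| |split]; trivial.
  + apply (cl_trans h3), (cl_ceq H).
  + apply (cl_trans h3), (cl_ceq (ceq_sym H)).
- intros i j e; cbn [rt]; split.
  + intros [-> [-> h]]; exists U; auto.
  + intros [a [h1 [-> h2]]]; pose proof (nth_error_lt h1) as h; simpl in h.
    destruct i; [|lia]; injection h1 as <-; auto.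
- intros i j e; cbn [rt]; split.
  + intros [-> [-> h]]; exists 0, c, d.
    split; [|split; [|exact h]]; (splits); eapply cl_refl; eassumption.
  + intros [l [m [n [[-> [-> hm]] [[_ [-> hn]] h]]]]]; splits.
    eapply cl_comp_inv; eassumption.
Qed.

(** The four adjunction inequalities hold because addition is union: [bang] after which comes
    [cobang] gives the empty matrix, [codiag] followed by [diag] has an identity in all four
    entries, and [diag] followed by [codiag] is the union of the identity with itself. *)
Lemma tle_sound P Q (s t : thom P Q) : tle (Th := Th) s t -> rsub (rt s) (rt t).
Proof.
induction 1 as [P Q s t h | P Q s t h | P Q s t u _ IH1 _ IH2
  | P Q R s s' t t' _ IH1 _ IH2 | P Q P' Q' s s' t t' _ IH1 _ IH2
  | P Q P' Q' s s' t t' _ IH1 _ IH2].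
- intros i j c; apply (teq_sound h).
- destruct h as [U V c d h | U | U | U | U].
  + intros i j e [h1 [h2 h3]]; splits.
    apply (cl_trans h3), cl_cle, cle_ineq, h.
  + intros i j e [].
  + intros i j e [k [m [n [[] _]]]].
  + intros i j c; cbn [thom_term thom_sum thom_idm thom_comp thom_codiag thom_diag].
    assert (hI : isfun [U; U] [U; U] (fun i => i) (rt (tsum (tidm U) (tidm U)))).
    { eapply isfun_ext; [eapply isfun_cast; [tfun | reflexivity | reflexivity] | sums]. }
    intros h; apply hI in h; destruct h as [a [h1 [-> h2]]].
    change (rcomp (rt (tcodiag U)) (rt (tdiag U)) i i c).
    rewrite (fun_pre i i c (isfun_tcodiag U) (rt_mat (ttyped_diag U))).
    pose proof (nth_error_lt h1); split; trivial.
    exists a; split; trivial; split; trivial.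
  + intros i j c; cbn [thom_term thom_idm thom_comp thom_codiag thom_diag].
    change (rcomp (rt (tdiag U)) (rt (tcodiag U)) i j c -> rt (tidm U) i j c).
    rewrite (cofun_pre i j c (cofun_tdiag U) (rt_mat (ttyped_codiag U))).
    intros [k [-> [a [h1 [-> h2]]]]]; exists U.
    pose proof (nth_error_lt h1) as h; simpl in h.
    destruct k as [|[|k]]; [| | lia]; simpl in h1; injection h1 as <-; auto.
- intros i j c h; apply IH2, IH1, h.
- intros i j c [k [m [n [h1 [h2 h3]]]]]; exists k, m, n; auto.
- change (rsub (rt (tsum s t)) (rt (tsum s' t'))).
  rewrite (rt_sum _ (thom_typed s)), (rt_sum _ (thom_typed s')).
  intros i j c [[h1 [h2 h3]]|[h1 [h2 h3]]]; [left | right]; auto.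
- intros i j c h; apply rt_prod; apply rt_prod in h.
  destruct h as [x [y [h1 [h2 h3]]]]; exists x, y; auto.
Qed.

(** ** Equational reasoning with tapes *)

(** Boundaries computed from the syntax. On typed terms they are the actual boundaries, which makes
    typing unique, and they turn the composability conditions of the untyped calculus into equations
    that compute. *)
Fixpoint cdom (c : cterm) : word :=
  match c with
  | cid U => U
  | cgen g => arity g
  | csym U V => U ++ V
  | ccomp c _ => cdom c
  | cten c d => cdom c ++ cdom d
  end.

Fixpoint ccod (c : cterm) : word :=
  match c with
  | cid U => U
  | cgen g => coarity g
  | csym U V => V ++ U
  | ccomp _ d => ccod d
  | cten c d => ccod c ++ ccod d
  end.

Fixpoint tdom (t : tape) : poly :=
  match t with
  | tid0 _ | tcobang _ => []
  | tidm U | tdiag U | tbang U => [U]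
  | tbox c => [cdom c]
  | tswap U V => [U; V]
  | tcodiag U => [U; U]
  | tcomp s _ => tdom s
  | tsum s t => tdom s ++ tdom t
  end.

Fixpoint tcod (t : tape) : poly :=
  match t with
  | tid0 _ | tbang _ => []
  | tidm U | tcodiag U | tcobang U => [U]
  | tbox c => [ccod c]
  | tswap U V => [V; U]
  | tdiag U => [U; U]
  | tcomp _ t => tcod t
  | tsum s t => tcod s ++ tcod t
  end.

Lemma cdom_typed c U V : ctyped c U V -> cdom c = U /\ ccod c = V.
Proof. induction 1; simpl; intuition congruence. Qed.

Lemma tdom_typed t P Q : ttyped t P Q -> tdom t = P.
Proof. induction 1; simpl; try destruct (cdom_typed H); congruence. Qed.

Lemma tcod_typed t P Q : ttyped t P Q -> tcod t = Q.
Proof. induction 1; simpl; try destruct (cdom_typed H); congruence. Qed.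

Lemma ttyped_unique t P Q P' Q' : ttyped t P Q -> ttyped t P' Q' -> P = P' /\ Q = Q'.
Proof.
intros h h'; rewrite <- (tdom_typed h), <- (tdom_typed h'), <- (tcod_typed h),
  <- (tcod_typed h'); auto.
Qed.

Lemma ttyped_sum_inv s t A B :
  ttyped (tsum s t) A B -> exists P Q P' Q',
    ttyped s P Q /\ ttyped t P' Q' /\ A = P ++ P' /\ B = Q ++ Q'.
Proof. intros h; inversion h; subst; eauto 10. Qed.

Lemma ttyped_comp_inv s t A B :
  ttyped (tcomp s t) A B -> exists Q, ttyped s A Q /\ ttyped t Q B.
Proof. intros h; inversion h; subst; eauto. Qed.

(** Equality of tapes, all the ill-typed ones being identified, so that it is a
    congruence for the untyped operations. *)
Definition te s t : Prop :=
  forall P Q, ttyped s P Q \/ ttyped t P Q -> teq P Q s t.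

(** The order under the same convention as [te]: if either side has a type, the other has it too and
    the inequality holds there. Ill-typed tapes are all related, so [tl] is a preorder and every
    operation is monotone without side conditions. *)
Definition tl s t : Prop :=
  forall P Q, ttyped s P Q \/ ttyped t P Q ->
    exists (hs : ttyped s P Q) (ht : ttyped t P Q), tle (Th := Th) (THom hs) (THom ht).

#[local] Instance te_equiv : Equivalence te.
Proof.
split.
- intros s P Q [h|h]; apply teq_refl, h.
- intros s t h P Q h'; apply teq_sym, h; tauto.
- intros s t u h1 h2 P Q [h|h].
  + pose proof (h1 P Q (or_introl h)) as e; apply (teq_trans e), h2; left.
    apply (teq_typed e).
  + pose proof (h2 P Q (or_intror h)) as e; refine (teq_trans _ e); apply h1; right.
    apply (teq_typed e).
Qed.

#[local] Instance te_comp : Proper (te ==> te ==> te) (@tcomp (sg Th)).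
Proof.
intros s s' h t t' h' P Q [H|H]; apply ttyped_comp_inv in H; destruct H as [R [h1 h2]];
  eapply teq_comp; [apply h | apply h' | apply h | apply h']; eauto.
Qed.

#[local] Instance te_sum : Proper (te ==> te ==> te) (@tsum (sg Th)).
Proof.
intros s s' h t t' h' P Q [H|H]; apply ttyped_sum_inv in H;
  destruct H as [A [B [A' [B' [h1 [h2 [-> ->]]]]]]]; apply teq_sum;
  (apply h || apply h'); auto.
Qed.

Lemma te_intro P Q s t : teq P Q s t -> te s t.
Proof.
intros h P' Q' [h'|h']; destruct (teq_typed h) as [h1 h2];
  [destruct (ttyped_unique h1 h') as [<- <-] | destruct (ttyped_unique h2 h') as [<- <-]];
  exact h.
Qed.

Lemma tl_te s t : te s t -> tl s t.
Proof.
intros h P Q h'; pose proof (h P Q h') as e; destruct (teq_typed e) as [h1 h2].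
exists h1, h2; apply tle_eq, e.
Qed.

Lemma tle_tl P Q (s t : thom P Q) : tle (Th := Th) s t <-> tl s t.
Proof.
destruct s as [s hs], t as [t ht]; simpl; split.
- intros h P' Q' [h'|h'];
    [destruct (ttyped_unique hs h') as [<- <-] | destruct (ttyped_unique ht h') as [<- <-]];
    exists hs, ht; exact h.
- intros h; destruct (h P Q (or_introl hs)) as [hs' [ht' h']].
  rewrite (proof_irrelevance _ hs hs'), (proof_irrelevance _ ht ht'); exact h'.
Qed.

Lemma tl_intro P Q s t (hs : ttyped s P Q) (ht : ttyped t P Q) :
  tle (Th := Th) (THom hs) (THom ht) -> tl s t.
Proof. apply tle_tl. Qed.

#[local] Instance tl_preorder : PreOrder tl.
Proof.
split.
- intros s; apply tl_te; reflexivity.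
- intros s t u h1 h2 P Q [h|h].
  + destruct (h1 P Q (or_introl h)) as [hs [ht h3]].
    destruct (h2 P Q (or_introl ht)) as [ht' [hu h4]].
    exists hs, hu; apply (tle_trans h3).
    rewrite (proof_irrelevance _ ht ht'); exact h4.
  + destruct (h2 P Q (or_intror h)) as [ht [hu h3]].
    destruct (h1 P Q (or_intror ht)) as [hs [ht' h4]].
    exists hs, hu; refine (tle_trans _ h3).
    rewrite (proof_irrelevance _ ht ht'); exact h4.
Qed.

#[local] Instance tl_comp : Proper (tl ==> tl ==> tl) (@tcomp (sg Th)).
Proof.
intros s s' h t t' h' P Q [H|H]; apply ttyped_comp_inv in H; destruct H as [R [h1 h2]].
- destruct (h P R (or_introl h1)) as [a [b e]], (h' R Q (or_introl h2)) as [a' [b' e']].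
  exists (ttyped_comp a a'), (ttyped_comp b b'); apply (tle_comp e e').
- destruct (h P R (or_intror h1)) as [a [b e]], (h' R Q (or_intror h2)) as [a' [b' e']].
  exists (ttyped_comp a a'), (ttyped_comp b b'); apply (tle_comp e e').
Qed.

#[local] Instance tl_sum : Proper (tl ==> tl ==> tl) (@tsum (sg Th)).
Proof.
intros s s' h t t' h' P Q [H|H]; apply ttyped_sum_inv in H;
  destruct H as [A [B [A' [B' [h1 [h2 [-> ->]]]]]]].
- destruct (h A B (or_introl h1)) as [a [b e]], (h' A' B' (or_introl h2)) as [a' [b' e']].
  exists (ttyped_sum a a'), (ttyped_sum b b'); apply (tle_sum e e').
- destruct (h A B (or_intror h1)) as [a [b e]], (h' A' B' (or_intror h2)) as [a' [b' e']].
  exists (ttyped_sum a a'), (ttyped_sum b b'); apply (tle_sum e e').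
Qed.

#[local] Instance tl_proper : Proper (te ==> te ==> iff) tl.
Proof.
intros s s' h t t' h'; split; intros H.
- transitivity s; [apply tl_te; symmetry; exact h|].
  transitivity t; [exact H | apply tl_te, h'].
- transitivity s'; [apply tl_te, h|].
  transitivity t'; [exact H | apply tl_te; symmetry; exact h'].
Qed.

Lemma te_assoc s t u : te (tcomp (tcomp s t) u) (tcomp s (tcomp t u)).
Proof.
intros P Q [h|h].
- apply ttyped_comp_inv in h; destruct h as [R [h h3]].
  apply ttyped_comp_inv in h; destruct h as [S [h1 h2]].
  eapply teq_assoc; eassumption.
- apply ttyped_comp_inv in h; destruct h as [R [h1 h]].
  apply ttyped_comp_inv in h; destruct h as [S [h2 h3]].
  eapply teq_assoc; eassumption.
Qed.

Lemma te_sum_assoc s t u : te (tsum (tsum s t) u) (tsum s (tsum t u)).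
Proof.
intros P Q [h|h].
- apply ttyped_sum_inv in h; destruct h as [A [B [A' [B' [h [h3 [-> ->]]]]]]].
  apply ttyped_sum_inv in h; destruct h as [C [D [C' [D' [h1 [h2 [-> ->]]]]]]].
  rewrite <- !app_assoc; apply teq_sum_assoc; assumption.
- apply ttyped_sum_inv in h; destruct h as [A [B [A' [B' [h1 [h [-> ->]]]]]]].
  apply ttyped_sum_inv in h; destruct h as [C [D [C' [D' [h2 [h3 [-> ->]]]]]]].
  apply teq_sum_assoc; assumption.
Qed.

Lemma te_unitl t : te (tsum (tid0 _) t) t.
Proof.
intros P Q [h|h]; [|apply teq_unitl, h].
apply ttyped_sum_inv in h; destruct h as [A [B [A' [B' [h [h3 [-> ->]]]]]]].
inversion h; subst; apply teq_unitl, h3.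
Qed.

Lemma te_unitr t : te (tsum t (tid0 _)) t.
Proof.
intros P Q [h|h]; [|apply teq_unitr, h].
apply ttyped_sum_inv in h; destruct h as [A [B [A' [B' [h3 [h [-> ->]]]]]]].
inversion h; subst; rewrite !app_nil_r; apply teq_unitr, h3.
Qed.

(** The hypothesis excludes composites whose middle object is cut at one place by the first sum and
    at another by the second: the left side is then typed while the right side is not. *)
Lemma te_interchange s s' t t' :
  tcod s = tdom t ->
  te (tcomp (tsum s s') (tsum t t')) (tsum (tcomp s t) (tcomp s' t')).
Proof.
intros e P Q [h|h].
- apply ttyped_comp_inv in h; destruct h as [R [h h']].
  apply ttyped_sum_inv in h; destruct h as [A [B [A' [B' [h1 [h2 [-> ->]]]]]]].
  apply ttyped_sum_inv in h'; destruct h' as [C [D [C' [D' [h3 [h4 [e' ->]]]]]]].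
  rewrite (tcod_typed h1), (tdom_typed h3) in e; subst C.
  apply app_inv_head in e'; subst C'.
  eapply teq_sym, teq_interchange; eassumption.
- apply ttyped_sum_inv in h; destruct h as [A [B [A' [B' [h [h' [-> ->]]]]]]].
  apply ttyped_comp_inv in h; destruct h as [R [h1 h2]].
  apply ttyped_comp_inv in h'; destruct h' as [R' [h3 h4]].
  eapply teq_sym, teq_interchange; eassumption.
Qed.

Lemma te_idl P t : tdom t = P -> te (tcomp (tid P) t) t.
Proof.
intros e A B [h|h].
- apply ttyped_comp_inv in h; destruct h as [R [h1 h2]].
  destruct (ttyped_unique h1 (tid_typed P)) as [-> ->]; apply teq_idl, h2.
- rewrite (tdom_typed h) in e; subst P; apply teq_idl, h.
Qed.

Lemma te_idr P t : tcod t = P -> te (tcomp t (tid P)) t.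
Proof.
intros e A B [h|h].
- apply ttyped_comp_inv in h; destruct h as [R [h1 h2]].
  destruct (ttyped_unique h2 (tid_typed P)) as [-> ->]; apply teq_idr, h1.
- rewrite (tcod_typed h) in e; subst P; apply teq_idr, h.
Qed.

Lemma te_tid1 U : te (tid [U]) (tidm U).
Proof. apply te_unitr. Qed.

Lemma te_idml U t : tdom t = [U] -> te (tcomp (tidm U) t) t.
Proof. intros e; rewrite <- te_tid1; apply te_idl, e. Qed.

Lemma te_idmr U t : tcod t = [U] -> te (tcomp t (tidm U)) t.
Proof. intros e; rewrite <- te_tid1; apply te_idr, e. Qed.

Lemma te_idl0 t : tdom t = [] -> te (tcomp (tid0 _) t) t.
Proof. apply (@te_idl []). Qed.

Lemma te_idr0 t : tcod t = [] -> te (tcomp t (tid0 _)) t.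
Proof. apply (@te_idr []). Qed.

Lemma te_tid_app P Q : te (tsum (tid P) (tid Q)) (tid (P ++ Q)).
Proof.
induction P as [|U P IH]; cbn [tid app]; [apply te_unitl|].
rewrite te_sum_assoc, IH; reflexivity.
Qed.

Ltac bdry :=
  cbn [tdom tcod];
  repeat match goal with
  | h : ttyped ?t _ _ |- context [tdom ?t] => rewrite (tdom_typed h)
  | h : ttyped ?t _ _ |- context [tcod ?t] => rewrite (tcod_typed h)
  end;
  rewrite ?(tdom_typed (tid_typed _)), ?(tcod_typed (tid_typed _)),
    ?(tdom_typed (tbraid_typed _ _)), ?(tcod_typed (tbraid_typed _ _)),
    ?(tdom_typed (tswapm_typed _ _)), ?(tcod_typed (tswapm_typed _ _)),
    ?(tdom_typed (tdiagp_typed _)), ?(tcod_typed (tdiagp_typed _)),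
    ?(tdom_typed (tcodiagp_typed _)), ?(tcod_typed (tcodiagp_typed _)),
    ?(tdom_typed (tbangp_typed _)), ?(tcod_typed (tbangp_typed _)),
    ?(tdom_typed (tcobangp_typed _)), ?(tcod_typed (tcobangp_typed _));
  rewrite ?app_nil_r, <- ?app_assoc; reflexivity.

(** * Symmetries, joins and zeros of tapes *)

Lemma te_braid_nat P Q P' Q' s t :
  ttyped s P Q -> ttyped t P' Q' ->
  te (tcomp (tsum s t) (tbraid Q Q')) (tcomp (tbraid P P') (tsum t s)).
Proof. intros hs ht; apply (te_intro (teq_swap_nat hs ht)). Qed.

Lemma te_tswapm1 U V : te (tswapm U [V]) (tswap U V).
Proof.
cbn [tswapm tid]; rewrite te_unitr.
rewrite <- (@te_tid1 V), <- (@te_tid1 U), te_tid_app; apply te_idr; reflexivity.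
Qed.

Lemma te_tbraid1 U P : te (tbraid [U] P) (tswapm U P).
Proof.
cbn [tbraid tid]; rewrite te_unitr.
change (te (tcomp (tid (U :: P)) (tswapm U P)) (tswapm U P)); apply te_idl; bdry.
Qed.

(** Invertibility of the symmetry is an axiom for two monomials only. Along the recursion of
    [tswapm] and [tbraid], the inner symmetries cancel by induction and the outer pair by that
    axiom. *)
Lemma te_braid_inv U P : te (tcomp (tbraid [U] P) (tbraid P [U])) (tid (U :: P)).
Proof.
rewrite te_tbraid1; induction P as [|V P IH].
- cbn [tswapm tbraid]; apply te_idml; reflexivity.
- change (tswapm U (V :: P))
    with (tcomp (tsum (tswap U V) (tid P)) (tsum (tidm V) (tswapm U P))).
  change (tbraid (V :: P) [U])
    with (tcomp (tsum (tidm V) (tbraid P [U])) (tsum (tswapm V [U]) (tid P))).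
  rewrite te_tswapm1, te_assoc.
  rewrite <- (@te_assoc (tsum (tidm V) _)), te_interchange by reflexivity.
  rewrite IH, te_idml by reflexivity.
  change (tsum (tidm V) (tid (U :: P))) with (tid ([V; U] ++ P)).
  rewrite te_idl by bdry; rewrite te_interchange by reflexivity.
  rewrite (te_intro (teq_swap_inv U V)), te_idl by bdry.
  apply te_tid_app.
Qed.

(** The sum of parallel arrows in a finite biproduct category, with [tzero] as its neutral element.
    In the presence of the inequalities [tineq] it is the join and [tzero] the bottom; see [tl_join]
    and [tl_zero]. *)
Definition tjoin P Q s t : tape :=
  tcomp (tdiagp P) (tcomp (tsum s t) (tcodiagp Q)).

Definition tzero P Q : tape := tcomp (tbangp P) (tcobangp Q).

Lemma tjoin_typed P Q s t : ttyped s P Q -> ttyped t P Q -> ttyped (tjoin P Q s t) P Q.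
Proof.
intros hs ht; eapply ttyped_comp; [apply tdiagp_typed|].
eapply ttyped_comp; [|apply tcodiagp_typed]; constructor; assumption.
Qed.

Lemma tzero_typed P Q : ttyped (tzero P Q) P Q.
Proof. eapply ttyped_comp; [apply tbangp_typed | apply tcobangp_typed]. Qed.

Lemma te_tdiagp1 U : te (tdiagp [U]) (tdiag U).
Proof.
cbn [tdiagp]; rewrite te_unitr, te_tbraid1; cbn [tswapm tid]; rewrite te_unitr.
rewrite <- (@te_tid1 U), te_tid_app; apply te_idr; reflexivity.
Qed.

Lemma te_tcodiagp1 U : te (tcodiagp [U]) (tcodiag U).
Proof.
cbn [tcodiagp tbraid]; rewrite te_tid1; cbn [tid]; rewrite !te_unitr.
rewrite <- (@te_tid1 U), te_tid_app; apply te_idl; reflexivity.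
Qed.

(** The braids inside [tdiagp] and [tcodiagp] cancel. *)
Lemma te_join_sum U V P Q (a b c d : tape) :
  ttyped a [U] [V] -> ttyped b [U] [V] -> ttyped c P Q -> ttyped d P Q ->
  te (tjoin (U :: P) (V :: Q) (tsum a c) (tsum b d))
    (tsum (tjoin [U] [V] a b) (tjoin P Q c d)).
Proof.
intros ha hb hc hd; unfold tjoin; rewrite te_tdiagp1, te_tcodiagp1.
cbn [tdiagp tcodiagp].
assert (M : te
  (tcomp (tsum (tidm U) (tsum (tbraid [U] P) (tid P)))
    (tcomp (tsum (tsum a c) (tsum b d)) (tsum (tidm V) (tsum (tbraid Q [V]) (tid Q)))))
  (tsum (tsum a b) (tsum c d))).
{ rewrite (@te_sum_assoc a c), <- (@te_sum_assoc c b).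
  rewrite (te_interchange (s := a)) by bdry.
  rewrite (te_interchange (s := tsum c b)) by bdry.
  rewrite (te_interchange (s := tidm U)) by bdry.
  rewrite (te_interchange (s := tbraid [U] P)) by bdry.
  rewrite te_idml, te_idmr by bdry.
  rewrite (te_idr (t := d)), (te_idl (t := d)) by bdry.
  rewrite <- te_assoc, <- (te_braid_nat hb hc), te_assoc.
  rewrite te_braid_inv, te_idr by bdry.
  rewrite !te_sum_assoc; reflexivity. }
rewrite te_assoc, <- (@te_assoc (tsum (tsum a c) (tsum b d))).
rewrite <- (@te_assoc (tsum (tidm U) _)), M.
rewrite (te_interchange (s := tsum a b)) by bdry.
rewrite te_interchange by bdry; reflexivity.
Qed.

#[local] Instance te_tjoin (P Q : poly) : Proper (te ==> te ==> te) (tjoin P Q).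
Proof. intros s s' h t t' h'; unfold tjoin; rewrite h, h'; reflexivity. Qed.

Lemma te_tbangp1 U : te (tbangp [U]) (tbang U).
Proof. apply te_unitr. Qed.

Lemma te_tcobangp1 U : te (tcobangp [U]) (tcobang U).
Proof. apply te_unitr. Qed.

Lemma te_bang_nat P Q t : ttyped t P Q -> te (tcomp t (tbangp Q)) (tbangp P).
Proof. intros h; apply (te_intro (teq_bang_nat h)). Qed.

Lemma te_cobang_nat P Q t : ttyped t P Q -> te (tcomp (tcobangp P) t) (tcobangp Q).
Proof. intros h; apply (te_intro (teq_cobang_nat h)). Qed.

Lemma te_codiag_nat P Q t :
  ttyped t P Q -> te (tcomp (tcodiagp P) t) (tcomp (tsum t t) (tcodiagp Q)).
Proof. intros h; apply (te_intro (teq_codiag_nat h)). Qed.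

Lemma te_diag_nat P Q t :
  ttyped t P Q -> te (tcomp t (tdiagp Q)) (tcomp (tdiagp P) (tsum t t)).
Proof. intros h; apply (te_intro (teq_diag_nat h)). Qed.

Lemma te_cobang_bang P Q t :
  ttyped t P Q -> te (tcomp (tcobangp P) (tcomp t (tbangp Q))) (tid0 _).
Proof.
intros h; rewrite (te_bang_nat h), (te_cobang_nat (tbangp_typed P)); reflexivity.
Qed.

Lemma te_zero_cons U V P Q :
  te (tzero (U :: P) (V :: Q)) (tsum (tzero [U] [V]) (tzero P Q)).
Proof.
unfold tzero; rewrite te_tbangp1, te_tcobangp1; cbn [tbangp tcobangp].
apply te_interchange; reflexivity.
Qed.

Lemma te_bang_cobang_sum P Q : te (tsum (tbangp P) (tcobangp Q)) (tzero P Q).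
Proof.
rewrite <- (te_idr0 (t := tbangp P)), <- (te_idl0 (t := tcobangp Q)) by bdry.
rewrite <- te_interchange, te_unitr, te_unitl by bdry; reflexivity.
Qed.

Lemma te_cobang_bang_sum P Q : te (tsum (tcobangp Q) (tbangp P)) (tzero P Q).
Proof.
rewrite <- (te_idr0 (t := tbangp P)), <- (te_idl0 (t := tcobangp Q)) by bdry.
rewrite <- te_interchange, te_unitr, te_unitl by bdry; reflexivity.
Qed.

Lemma te_tbraid_nilr U : te (tbraid [U] []) (tidm U).
Proof. rewrite te_tbraid1; reflexivity. Qed.

Lemma te_tbraid_mono U V : te (tbraid [U] [V]) (tswap U V).
Proof. rewrite te_tbraid1; apply te_tswapm1. Qed.

Lemma tl_ineq P Q (s t : thom P Q) : tineq (Th := Th) s t -> tl s t.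
Proof. intros h; apply tle_tl, tle_ineq, h. Qed.

(** An axiom on monomials. On polynomials the composite is the sum of the identity with itself, and
    such sums decompose along the monomials by [te_join_sum]. *)
Lemma tl_diag_codiag P : tl (tcomp (tdiagp P) (tcodiagp P)) (tid P).
Proof.
assert (E : forall P : poly,
  te (tcomp (tdiagp P) (tcodiagp P)) (tjoin P P (tid P) (tid P))).
{ intros Q; unfold tjoin; rewrite te_tid_app, te_idl by bdry; reflexivity. }
rewrite E; induction P as [|U P IH].
- unfold tjoin; cbn [tdiagp tcodiagp tid]; rewrite te_unitl, !te_idl0 by reflexivity.
  reflexivity.
- change (tid (U :: P)) with (tsum (tidm U) (tid P)).
  rewrite te_join_sum by (constructor || apply tid_typed).
  rewrite IH; apply tl_sum; [|reflexivity].
  rewrite <- (@te_tid1 U), <- E, te_tid1, te_tdiagp1, te_tcodiagp1.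
  apply (tl_ineq (@tineq_diag_codiag Th U)).
Qed.

Lemma tl_zero_id P : tl (tzero P P) (tid P).
Proof.
induction P as [|U P IH].
- apply tl_te; unfold tzero; cbn [tbangp tcobangp tid]; apply te_idl0; reflexivity.
- rewrite te_zero_cons, IH; apply tl_sum; [|reflexivity].
  unfold tzero; rewrite te_tbangp1, te_tcobangp1; apply (tl_ineq (@tineq_bang_cobang Th U)).
Qed.

(** Naturality of [tbangp] rewrites the zero arrow as [t] followed by the zero endomorphism of [Q],
    and the latter is below the identity. *)
Lemma tl_zero P Q t : ttyped t P Q -> tl (tzero P Q) t.
Proof.
intros h; unfold tzero; rewrite <- (te_bang_nat h), te_assoc.
change (tl (tcomp t (tzero Q Q)) t).
rewrite (@tl_zero_id Q), te_idr by bdry; reflexivity.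
Qed.

(** Replacing [s] and [t] by [x] leaves the sum of [x] with itself, which by naturality of the
    codiagonal is [x] preceded by [tdiagp] and [tcodiagp]; these compose to something below the
    identity. *)
Lemma tl_join P Q s t x : ttyped x P Q -> tl s x -> tl t x -> tl (tjoin P Q s t) x.
Proof.
intros hx hs ht; unfold tjoin; rewrite hs, ht, <- (te_codiag_nat hx), <- te_assoc.
rewrite (@tl_diag_codiag P), te_idl by bdry; reflexivity.
Qed.

Lemma te_join_zero1 U : te (tjoin [U] [U] (tzero [U] [U]) (tidm U)) (tidm U).
Proof.
unfold tjoin, tzero; rewrite te_tdiagp1, te_tcodiagp1, te_tbangp1, te_tcobangp1.
(* The identity is doubled so that interchange separates the sum into a counit factor next to
   [tdiag] and a unit factor next to [tcodiag]. *)
rewrite <- (te_idml (U := U) (t := tidm U)) at 1 by reflexivity.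
rewrite <- te_interchange by reflexivity.
rewrite te_assoc, <- te_assoc.
rewrite (te_intro (teq_diag_unit U)), (te_intro (teq_codiag_unit U)).
apply te_idml; reflexivity.
Qed.

Lemma te_join_comm1 U V (a b : tape) :
  ttyped a [U] [V] -> ttyped b [U] [V] ->
  te (tjoin [U] [V] a b) (tjoin [U] [V] b a).
Proof.
intros ha hb; unfold tjoin; rewrite te_tdiagp1, te_tcodiagp1.
rewrite <- (te_intro (teq_codiag_comm V)), <- te_tbraid_mono.
rewrite <- (@te_assoc (tsum a b)), (te_braid_nat ha hb), te_assoc, te_tbraid_mono.
rewrite <- te_assoc, (te_intro (teq_diag_comm U)).
rewrite te_tbraid_mono, (te_intro (teq_codiag_comm V)); reflexivity.
Qed.

Lemma te_join_zero P : te (tjoin P P (tzero P P) (tid P)) (tid P).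
Proof.
induction P as [|U P IH].
- unfold tjoin, tzero; cbn [tdiagp tcodiagp tid tbangp tcobangp].
  rewrite te_unitr, !te_idl0 by reflexivity; reflexivity.
- assert (E : te (tzero (U :: P) (U :: P)) (tsum (tzero [U] [U]) (tzero P P)))
    by apply te_zero_cons.
  rewrite E; change (tid (U :: P)) with (tsum (tidm U) (tid P)).
  rewrite te_join_sum by (apply tzero_typed || apply tid_typed || constructor).
  rewrite IH, te_join_zero1; reflexivity.
Qed.

(** Closing under joins, instead of quantifying over the upper bounds of [S], makes
    [below] compatible with composition. *)
Inductive below (P Q : poly) (S : tape -> Prop) : tape -> Prop :=
| below_in s : S s -> below P Q S s
| below_le s t : tl s t -> below P Q S t -> below P Q S s
| below_zero : below P Q S (tzero P Q)
| below_join s t :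
    ttyped s P Q -> ttyped t P Q -> below P Q S s -> below P Q S t ->
    below P Q S (tjoin P Q s t).

Lemma below_te P Q (S : tape -> Prop) s t : te s t -> below P Q S t -> below P Q S s.
Proof. intros h; apply below_le, tl_te, h. Qed.

Lemma below_bound P Q (S : tape -> Prop) s x :
  ttyped x P Q -> (forall t, S t -> tl t x) -> below P Q S s -> tl s x.
Proof.
intros hx h; induction 1.
- apply h; assumption.
- etransitivity; eassumption.
- apply tl_zero, hx.
- apply tl_join; assumption.
Qed.

(** Postcomposition preserves sums and zero by naturality of the codiagonal and of [tcobangp]. The
    mirror image [below_pre] uses the diagonal and [tbangp]. *)
Lemma below_post P Q R (S S' : tape -> Prop) s u :
  ttyped u Q R -> (forall x, S x -> below P R S' (tcomp x u)) ->
  below P Q S s -> below P R S' (tcomp s u).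
Proof.
intros hu h; induction 1 as [s hs | s t hst _ IH | | s t hs ht _ IHs _ IHt].
- apply h, hs.
- apply below_le with (t := tcomp t u); [rewrite hst; reflexivity | exact IH].
- apply below_te with (t := tzero P R); [|apply below_zero].
  unfold tzero; rewrite te_assoc, (te_cobang_nat hu); reflexivity.
- apply below_te with (t := tjoin P R (tcomp s u) (tcomp t u)).
  + unfold tjoin; rewrite !te_assoc, (te_codiag_nat hu).
    rewrite <- (@te_assoc (tsum s t)), te_interchange by bdry; reflexivity.
  + apply below_join; trivial; eapply ttyped_comp; eassumption.
Qed.

Lemma below_pre P Q R (S S' : tape -> Prop) s u :
  ttyped u R P -> (forall x, S x -> below R Q S' (tcomp u x)) ->
  below P Q S s -> below R Q S' (tcomp u s).
Proof.
intros hu h; induction 1 as [s hs | s t hst _ IH | | s t hs ht _ IHs _ IHt].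
- apply h, hs.
- apply below_le with (t := tcomp u t); [rewrite hst; reflexivity | exact IH].
- apply below_te with (t := tzero R Q); [|apply below_zero].
  unfold tzero; rewrite <- te_assoc, (te_bang_nat hu); reflexivity.
- apply below_te with (t := tjoin R Q (tcomp u s) (tcomp u t)).
  + unfold tjoin; rewrite <- te_assoc, (te_diag_nat hu), te_assoc.
    rewrite <- (@te_assoc (tsum u u)), te_interchange by bdry; reflexivity.
  + apply below_join; trivial; eapply ttyped_comp; eassumption.
Qed.

(** * Injections and projections of the monomials *)

Fixpoint tinj (P : poly) (k : nat) : tape :=
  match P with
  | [] => tid0 _
  | U :: P' => match k with
               | 0 => tsum (tidm U) (tcobangp P')
               | S k' => tsum (tcobang U) (tinj P' k')
               end
  end.

Fixpoint tproj (P : poly) (k : nat) : tape :=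
  match P with
  | [] => tid0 _
  | U :: P' => match k with
               | 0 => tsum (tidm U) (tbangp P')
               | S k' => tsum (tbang U) (tproj P' k')
               end
  end.

Lemma tinj_typed P k : k < length P -> ttyped (tinj P k) [nth k P []] P.
Proof.
revert k; induction P as [|U P IH]; intros [|k] h; simpl in h; try lia; cbn [tinj nth].
- apply (@ttyped_sum _ _ _ [U] [U] [] P); [constructor | apply tcobangp_typed].
- apply (@ttyped_sum _ _ _ [] [U] [nth k P []] P); [constructor | apply IH; lia].
Qed.

Lemma tproj_typed P k : k < length P -> ttyped (tproj P k) P [nth k P []].
Proof.
revert k; induction P as [|U P IH]; intros [|k] h; simpl in h; try lia; cbn [tproj nth].
- apply (@ttyped_sum _ _ _ [U] [U] P []); [constructor | apply tbangp_typed].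
- apply (@ttyped_sum _ _ _ [U] [] P [nth k P []]); [constructor | apply IH; lia].
Qed.

Lemma te_inj_proj P k :
  k < length P -> te (tcomp (tinj P k) (tproj P k)) (tidm (nth k P [])).
Proof.
revert k; induction P as [|U P IH]; intros [|k] h; simpl in h; try lia;
  cbn [tinj tproj nth].
- rewrite te_interchange, te_idml, (te_cobang_nat (tbangp_typed P)) by reflexivity.
  apply te_unitr.
- rewrite te_interchange, IH by (reflexivity || lia).
  rewrite <- te_tcobangp1, (te_cobang_nat (ttyped_bang U)); apply te_unitl.
Qed.

Lemma te_inj_proj_neq P k l :
  k < length P -> l < length P -> k <> l ->
  te (tcomp (tinj P k) (tproj P l)) (tzero [nth k P []] [nth l P []]).
Proof.
revert k l; induction P as [|U P IH]; intros [|k] [|l] h h' n; simpl in h, h'; try lia;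
  cbn [tinj tproj nth].
- assert (hl : l < length P) by lia.
  rewrite te_interchange, te_idml, (te_cobang_nat (tproj_typed hl)) by reflexivity.
  rewrite <- te_tbangp1; apply te_bang_cobang_sum.
- assert (hk : k < length P) by lia.
  rewrite te_interchange, te_idmr, (te_bang_nat (tinj_typed hk)) by reflexivity.
  rewrite <- te_tcobangp1; apply te_cobang_bang_sum.
- rewrite te_interchange, IH by (reflexivity || lia).
  rewrite <- te_tcobangp1, (te_cobang_nat (ttyped_bang U)); apply te_unitl.
Qed.

(** The composite is the identity at position [k] and the zero endomorphism at all other monomials,
    where the axiom [tineq_bang_cobang] puts it below the identity. *)
Lemma tl_proj_inj P k : k < length P -> tl (tcomp (tproj P k) (tinj P k)) (tid P).
Proof.
revert k; induction P as [|U P IH]; intros [|k] h; simpl in h; try lia;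
  cbn [tinj tproj tid].
- rewrite te_interchange, te_idml by reflexivity.
  change (tcomp (tbangp P) (tcobangp P)) with (tzero P P); rewrite tl_zero_id; reflexivity.
- rewrite te_interchange, IH by (reflexivity || lia).
  rewrite (tl_ineq (@tineq_bang_cobang Th U) : tl (tcomp (tbang U) (tcobang U)) (tidm U)).
  reflexivity.
Qed.

(** On [U :: P] the identity is the sum of two idempotents, one supported on [U] and one on [P]. The
    first is the projection at [0] followed by the injection at [0]; the second factors through [P],
    where the induction hypothesis applies. *)
Lemma below_tid P :
  below P P (fun s => exists k, k < length P /\ s = tcomp (tproj P k) (tinj P k)) (tid P).
Proof.
induction P as [|U P IH].
{ apply below_te with (t := tzero [] []); [|apply below_zero].
  symmetry; apply te_idl0; reflexivity. }
pose proof (tzero_typed [U] [U]) as h1; pose proof (tzero_typed P P) as h2.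
apply below_te with
  (t := tjoin (U :: P) (U :: P) (tsum (tidm U) (tzero P P)) (tsum (tzero [U] [U]) (tid P))).
{ assert (E : te (tjoin P P (tzero P P) (tid P)) (tid P)) by apply te_join_zero.
  rewrite te_join_sum by (assumption || apply tid_typed || constructor).
  rewrite te_join_comm1, te_join_zero1, E by (assumption || constructor).
  reflexivity. }
assert (h3 : ttyped (tsum (tidm U) (tzero P P)) (U :: P) (U :: P))
  by (apply (@ttyped_sum _ _ _ [U] [U] P P); [constructor | exact h2]).
assert (h4 : ttyped (tsum (tzero [U] [U]) (tid P)) (U :: P) (U :: P))
  by (apply (@ttyped_sum _ _ _ [U] [U] P P); [exact h1 | apply tid_typed]).
apply below_join; trivial.
- apply below_te with (t := tcomp (tproj (U :: P) 0) (tinj (U :: P) 0)).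
  + cbn [tproj tinj]; rewrite te_interchange, te_idml by reflexivity; reflexivity.
  + apply below_in; exists 0; simpl; split; [lia | reflexivity].
(* The idempotent supported on [P], factored through [P] with the identity of [P] in the middle,
   which the induction hypothesis then expands. *)
- apply below_te with
    (t := tcomp (tsum (tbang U) (tid P)) (tcomp (tid P) (tsum (tcobang U) (tid P)))).
  + rewrite te_idl by bdry.
    rewrite te_interchange, te_idl by bdry.
    unfold tzero; rewrite te_tbangp1, te_tcobangp1; reflexivity.
  + assert (t1 : ttyped (tsum (tbang U) (tid P)) (U :: P) P)
      by (apply (@ttyped_sum _ _ _ [U] [] P P); [constructor | apply tid_typed]).
    assert (t2 : ttyped (tsum (tcobang U) (tid P)) P (U :: P))
      by (apply (@ttyped_sum _ _ _ [] [U] P P); [constructor | apply tid_typed]).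
    apply (below_pre (P := P)
      (S := fun x => exists k, k < length P /\
        x = tcomp (tcomp (tproj P k) (tinj P k)) (tsum (tcobang U) (tid P)))); trivial.
    * intros x [k [hk ->]].
      apply below_te with (t := tcomp (tproj (U :: P) (S k)) (tinj (U :: P) (S k))).
      -- pose proof (tproj_typed hk); pose proof (tinj_typed hk).
         rewrite !te_assoc, <- te_assoc.
         rewrite <- (@te_unitl (tproj P k)), <- (@te_unitl (tinj P k)).
         rewrite !te_interchange by reflexivity.
         rewrite te_idl, te_idr, te_idr0, te_idl0 by bdry.
         cbn [tproj tinj]; rewrite te_interchange by reflexivity; reflexivity.
      -- apply below_in; exists (S k); simpl; split; [lia | reflexivity].
    * refine (below_post t2 _ IH); intros x [k [hk ->]]; apply below_in; exists k; auto.
Qed.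

(** * Boxes and the order *)

Lemma te_box U V c d : ceq U V c d -> te (tbox c) (tbox d).
Proof. intros h; apply (te_intro (teq_box h)). Qed.

Lemma te_box_comp U V W c d :
  ctyped c U V -> ctyped d V W -> te (tbox (ccomp c d)) (tcomp (tbox c) (tbox d)).
Proof. intros hc hd; apply (te_intro (teq_box_comp hc hd)). Qed.

(** Between monomials all distributors are trivial: the tensor whiskers [d] by [U] on the left, then
    [c] by [V'] on the right, and interchange of diagrams merges the two. Through this equation
    [tle_prod] accounts for the closure of [cle] under [chom_ten] in [tle_box]. *)
Lemma te_box_ten U V U' V' c d (hc : ctyped c U V) (hd : ctyped d U' V') :
  te (thom_prod (thom_box (CHom hc)) (thom_box (CHom hd))) (tbox (cten c d)).
Proof.
assert (hl : ctyped (cten (cid U) d) (U ++ U') (U ++ V')) by (constructor; [constructor | exact hd]).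
assert (hr : ctyped (cten c (cid V')) (U ++ V') (V ++ V')) by (constructor; [exact hc | constructor]).
destruct (cdom_typed hr) as [e1 e2].
cbn [thom_prod thom_box thom_term chom_term lw rw lwm rwm tdistl tdistlV pmul].
rewrite !te_unitr.
unfold pmul, list_mul; cbn [flat_map map app]; rewrite !te_tid1.
cbn [tbraid tid].
rewrite !te_idml by (cbn [tdom tcod]; rewrite ?e1, ?e2; reflexivity).
rewrite te_idmr by (cbn [tdom tcod]; rewrite ?e1, ?e2; reflexivity).
rewrite <- (te_box_comp hl hr); apply (te_box (U := U ++ U') (V := V ++ V')).
eapply ceq_trans; [apply ceq_sym, ceq_interchange with (V := U) (V' := V');
  (constructor || assumption)|].
apply ceq_ten; [apply ceq_idl, hc | apply ceq_idr, hd].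
Qed.

Lemma tle_box U V (f g : chom U V) :
  cle (Th := Th) f g -> tle (Th := Th) (thom_box f) (thom_box g).
Proof.
induction 1 as [U V c d h | U V c d h | U V c d e _ IH1 _ IH2
  | U V W c c' d d' _ IH1 _ IH2 | U V U' V' c c' d d' _ IH1 _ IH2].
- apply tle_eq, teq_box, h.
- apply tle_ineq, tineq_box, h.
- apply (tle_trans IH1 IH2).
- apply tle_tl; apply tle_tl in IH1, IH2; cbn [thom_term thom_box chom_term chom_comp] in *.
  rewrite (te_box_comp (chom_typed c) (chom_typed d)),
    (te_box_comp (chom_typed c') (chom_typed d')), IH1, IH2; reflexivity.
- apply tle_tl; cbn [thom_term thom_box chom_term chom_ten].
  rewrite <- (@te_box_ten _ _ _ _ _ _ (chom_typed c) (chom_typed d)),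
    <- (@te_box_ten _ _ _ _ _ _ (chom_typed c') (chom_typed d')).
  apply tle_tl, tle_prod.
  + destruct c, c'; exact IH1.
  + destruct d, d'; exact IH2.
Qed.

Lemma tl_box c d : cl (Th := Th) c d -> tl (tbox c) (tbox d).
Proof. intros [U [V [hc [hd h]]]]; apply (tl_intro (tle_box h)). Qed.

(** ** Completeness *)

Definition tentry P Q t k l : tape :=
  tcomp (tinj P k) (tcomp t (tproj Q l)).

(** The two halves say that an entry of [t] is the join of the boxes in its semantics: an upper
    bound of all of them, and below a finite join of some of them. The set itself may be infinite,
    but [below] only forms finite joins. *)
Definition entries_ok P Q t : Prop :=
  forall k l, k < length P -> l < length Q ->
  (forall c, rt t k l c -> tl (tbox c) (tentry P Q t k l)) /\
  below [nth k P []] [nth l Q []] (fun s => exists2 c, rt t k l c & s = tbox c)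
    (tentry P Q t k l).

Lemma entry_id U (R : cterm -> Prop) (e : tape) :
  te e (tidm U) -> (forall c, R c <-> cl c (cid U)) ->
  (forall c, R c -> tl (tbox c) e) /\
  below [U] [U] (fun s => exists2 c, R c & s = tbox c) e.
Proof.
intros he hR.
assert (E : te e (tbox (cid U))) by (rewrite he; symmetry; apply (te_intro (teq_box_id U))).
split.
- intros c hc; rewrite E; apply tl_box, hR, hc.
- apply (below_te E), below_in; exists (cid U); trivial.
  apply hR, (cl_refl (ctyped_ids U)).
Qed.

Lemma entry_zero U V (R : cterm -> Prop) (e : tape) :
  te e (tzero [U] [V]) -> (forall c, ~ R c) ->
  (forall c, R c -> tl (tbox c) e) /\
  below [U] [V] (fun s => exists2 c, R c & s = tbox c) e.
Proof.
intros he hR; split; [intros c hc; destruct (hR c hc)|].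
apply (below_te he), below_zero.
Qed.

Lemma te_inj1 U : te (tinj [U] 0) (tidm U).
Proof. apply te_unitr. Qed.

Lemma te_proj1 U : te (tproj [U] 0) (tidm U).
Proof. apply te_unitr. Qed.

Lemma te_inj_swap0 U V : te (tcomp (tinj [U; V] 0) (tswap U V)) (tinj [V; U] 1).
Proof.
cbn [tinj]; rewrite te_tcobangp1, !te_unitr, <- te_tbraid_mono.
rewrite (te_braid_nat (ttyped_idm U) (ttyped_cobang V)), te_tbraid_nilr.
apply te_idml; reflexivity.
Qed.

Lemma te_inj_swap1 U V : te (tcomp (tinj [U; V] 1) (tswap U V)) (tinj [V; U] 0).
Proof.
cbn [tinj]; rewrite te_tcobangp1, !te_unitr, <- te_tbraid_mono.
rewrite (te_braid_nat (ttyped_cobang U) (ttyped_idm V)); cbn [tbraid]; rewrite te_tid1.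
apply te_idml; reflexivity.
Qed.

Lemma te_diag_proj1 U : te (tcomp (tdiag U) (tproj [U; U] 1)) (tidm U).
Proof. cbn [tproj]; rewrite te_unitr; apply (te_intro (teq_diag_unit U)). Qed.

(** The counit axiom discards the first copy only; cocommutativity and naturality of the symmetry
    move the discarded copy to the front. *)
Lemma te_diag_proj0 U : te (tcomp (tdiag U) (tproj [U; U] 0)) (tidm U).
Proof.
cbn [tproj]; rewrite te_tbangp1.
rewrite <- (te_intro (teq_diag_comm U)), te_assoc, <- te_tbraid_mono.
rewrite <- (te_braid_nat (ttyped_bang U) (ttyped_idm U)); cbn [tbraid].
rewrite te_idr by reflexivity; apply (te_intro (teq_diag_unit U)).
Qed.

Lemma te_inj1_codiag U : te (tcomp (tinj [U; U] 1) (tcodiag U)) (tidm U).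
Proof. cbn [tinj]; rewrite te_unitr; apply (te_intro (teq_codiag_unit U)). Qed.

Lemma te_inj0_codiag U : te (tcomp (tinj [U; U] 0) (tcodiag U)) (tidm U).
Proof.
rewrite <- (te_intro (teq_codiag_comm U)), <- te_assoc, te_inj_swap0; apply te_inj1_codiag.
Qed.

Lemma te_inj_appl P P' k :
  k < length P -> te (tinj (P ++ P') k) (tsum (tinj P k) (tcobangp P')).
Proof.
assert (E : forall P, te (tcobangp (P ++ P')) (tsum (tcobangp P) (tcobangp P'))).
{ intros Q; induction Q as [|U Q IH]; cbn [app tcobangp];
    [symmetry; apply te_unitl | rewrite IH; symmetry; apply te_sum_assoc]. }
revert k; induction P as [|U P IH]; intros [|k] h; simpl in h; try lia; cbn [app tinj].
- rewrite E; symmetry; apply te_sum_assoc.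
- rewrite IH by lia; symmetry; apply te_sum_assoc.
Qed.

Lemma te_inj_appr P P' k :
  te (tinj (P ++ P') (length P + k)) (tsum (tcobangp P) (tinj P' k)).
Proof.
induction P as [|U P IH]; cbn [app tinj length Nat.add tcobangp];
  [symmetry; apply te_unitl | rewrite IH; symmetry; apply te_sum_assoc].
Qed.

Lemma te_proj_appl P P' k :
  k < length P -> te (tproj (P ++ P') k) (tsum (tproj P k) (tbangp P')).
Proof.
assert (E : forall P, te (tbangp (P ++ P')) (tsum (tbangp P) (tbangp P'))).
{ intros Q; induction Q as [|U Q IH]; cbn [app tbangp];
    [symmetry; apply te_unitl | rewrite IH; symmetry; apply te_sum_assoc]. }
revert k; induction P as [|U P IH]; intros [|k] h; simpl in h; try lia; cbn [app tproj].
- rewrite E; symmetry; apply te_sum_assoc.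
- rewrite IH by lia; symmetry; apply te_sum_assoc.
Qed.

Lemma te_proj_appr P P' k :
  te (tproj (P ++ P') (length P + k)) (tsum (tbangp P) (tproj P' k)).
Proof.
induction P as [|U P IH]; cbn [app tproj length Nat.add tbangp];
  [symmetry; apply te_unitl | rewrite IH; symmetry; apply te_sum_assoc].
Qed.

Lemma below_mono P Q (S S' : tape -> Prop) s :
  (forall x, S x -> S' x) -> below P Q S s -> below P Q S' s.
Proof.
intros h; induction 1.
- apply below_in, h; assumption.
- eapply below_le; eassumption.
- apply below_zero.
- apply below_join; assumption.
Qed.

Lemma entry_te U V (R R' : cterm -> Prop) (e e' : tape) :
  te e e' -> (forall c, R c <-> R' c) ->
  (forall c, R' c -> tl (tbox c) e') /\
    below [U] [V] (fun s => exists2 c, R' c & s = tbox c) e' ->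
  (forall c, R c -> tl (tbox c) e) /\
    below [U] [V] (fun s => exists2 c, R c & s = tbox c) e.
Proof.
intros he hR [h1 h2]; split.
- intros c hc; rewrite he; apply h1, hR, hc.
- apply (below_te he); apply (below_mono (S := fun s => exists2 c, R' c & s = tbox c)); trivial.
  intros x [c hc ->]; exists c; trivial; apply hR, hc.
Qed.

(** Matrix multiplication inside the tapes. For the lower bound it suffices to pass through one
    position [m] of [Q], since the projection followed by the injection is below the identity; the
    upper bound needs all positions at once. *)
Lemma entries_comp P Q R s t :
  ttyped s P Q -> ttyped t Q R -> entries_ok P Q s -> entries_ok Q R t ->
  entries_ok P R (tcomp s t).
Proof.
intros hs ht IHs IHt k l hk hl.
pose proof (tinj_typed hk) as ti; pose proof (tproj_typed hl) as tp.
assert (E : forall m, m < length Q ->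
  te (tcomp (tinj P k) (tcomp (tcomp s (tcomp (tcomp (tproj Q m) (tinj Q m)) t)) (tproj R l)))
     (tcomp (tentry P Q s k m) (tentry Q R t m l))).
{ intros m hm; unfold tentry; rewrite !te_assoc; reflexivity. }
split.
- intros c [m [a [b [ha [hb hc]]]]].
  destruct (is_mat_lt (rt_mat hs) ha) as [_ hm].
  rewrite (tl_box hc), (te_box_comp (is_mat_typed (rt_mat hs) ha) (is_mat_typed (rt_mat ht) hb)).
  rewrite (proj1 (IHs k m hk hm) a ha), (proj1 (IHt m l hm hl) b hb).
  rewrite <- E by exact hm.
  rewrite (tl_proj_inj hm), te_idl by bdry; reflexivity.
(* The identity of [Q] is inserted so that [below_tid] can expand it. Composition distributes over
   the resulting joins, which leaves products of entries of [s] and [t], and two composed boxes are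
   one box. *)
- apply below_te with (t := tcomp (tcomp (tinj P k) s) (tcomp (tid Q) (tcomp t (tproj R l)))).
  { unfold tentry; rewrite te_idl by bdry; rewrite !te_assoc; reflexivity. }
  assert (t1 : ttyped (tcomp (tinj P k) s) [nth k P []] Q) by (eapply ttyped_comp; eassumption).
  assert (t2 : ttyped (tcomp t (tproj R l)) Q [nth l R []]) by (eapply ttyped_comp; eassumption).
  apply (below_pre (P := Q)
    (S := fun x => exists m, m < length Q /\
      x = tcomp (tcomp (tproj Q m) (tinj Q m)) (tcomp t (tproj R l)))); trivial.
  + intros x [m [hm ->]].
    apply below_te with (t := tcomp (tentry P Q s k m) (tentry Q R t m l)).
    { unfold tentry; rewrite !te_assoc; reflexivity. }
    destruct (IHs k m hk hm) as [_ b1], (IHt m l hm hl) as [_ b2].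
    assert (t3 : ttyped (tentry Q R t m l) [nth m Q []] [nth l R []])
      by (eapply ttyped_comp; [apply tinj_typed, hm | exact t2]).
    refine (below_post t3 _ b1); intros x [a ha ->].
    pose proof (is_mat_typed (rt_mat hs) ha) as ta.
    refine (below_pre (ttyped_box ta) _ b2); intros x [b hb ->].
    pose proof (is_mat_typed (rt_mat ht) hb) as tb.
    apply below_te with (t := tbox (ccomp a b)); [symmetry; apply (te_box_comp ta tb)|].
    apply below_in; exists (ccomp a b); trivial.
    exists m, a, b; splits; eapply cl_refl; eauto using ctyped.
  + refine (below_post t2 _ (below_tid Q)); intros x [m [hm ->]]; apply below_in; exists m; auto.
Qed.

(** Injections and projections of a concatenation are sums with [tcobangp] or [tbangp]. On a
    diagonal block the other summand collapses to [tid0]; off the diagonal, naturality absorbs both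
    tapes and leaves the zero arrow. *)
Lemma entries_sum P Q P' Q' s t :
  ttyped s P Q -> ttyped t P' Q' -> entries_ok P Q s -> entries_ok P' Q' t ->
  entries_ok (P ++ P') (Q ++ Q') (tsum s t).
Proof.
intros hs ht IHs IHt k l hk hl; rewrite length_app in hk, hl; unfold tentry.
assert (HR : rt (tsum s t) = rdsum (length P) (length Q) (rt s) (rt t)) by apply (rt_sum _ hs).
rewrite HR; unfold rdsum.
destruct (Nat.lt_ge_cases k (length P)) as [h|h], (Nat.lt_ge_cases l (length Q)) as [h'|h'].
- rewrite (nth_appl _ _ h), (nth_appl _ _ h').
  pose proof (tinj_typed h); pose proof (tproj_typed h').
  refine (entry_te _ _ (IHs k l h h')).
  + rewrite te_inj_appl, te_proj_appl by assumption.
    rewrite !te_interchange by bdry.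
    rewrite (te_cobang_bang ht); apply te_unitr.
  + intros c; intuition lia.
- assert (e' : l = length Q + (l - length Q)) by lia.
  rewrite (nth_appl _ _ h), (nth_appr _ _ h').
  assert (hl' : l - length Q < length Q') by lia.
  pose proof (tinj_typed h); pose proof (tproj_typed hl').
  apply entry_zero; [|intros c; intuition lia].
  rewrite te_inj_appl, e', te_proj_appr by assumption.
  rewrite !te_interchange by bdry.
  rewrite (te_bang_nat hs), (te_bang_nat (tinj_typed h)).
  replace (length Q + (l - length Q) - length Q) with (l - length Q) by lia.
  rewrite <- te_assoc, (te_cobang_nat ht), (te_cobang_nat (tproj_typed hl')).
  apply te_bang_cobang_sum.
- assert (e : k = length P + (k - length P)) by lia.
  rewrite (nth_appr _ _ h), (nth_appl _ _ h').
  assert (hk' : k - length P < length P') by lia.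
  pose proof (tinj_typed hk'); pose proof (tproj_typed h').
  apply entry_zero; [|intros c; intuition lia].
  rewrite e, te_inj_appr, te_proj_appl by assumption.
  rewrite !te_interchange by bdry.
  rewrite (te_bang_nat ht).
  replace (length P + (k - length P) - length P) with (k - length P) by lia.
  rewrite (te_bang_nat (tinj_typed hk')).
  rewrite <- te_assoc, (te_cobang_nat hs), (te_cobang_nat (tproj_typed h')).
  apply te_cobang_bang_sum.
- rewrite (nth_appr _ _ h), (nth_appr _ _ h').
  assert (e : k = length P + (k - length P)) by lia.
  assert (e' : l = length Q + (l - length Q)) by lia.
  assert (hk' : k - length P < length P') by lia.
  assert (hl' : l - length Q < length Q') by lia.
  pose proof (tinj_typed hk'); pose proof (tproj_typed hl').
  refine (entry_te _ _ (IHt _ _ hk' hl')).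
  + rewrite e at 1; rewrite e' at 1; rewrite te_inj_appr, te_proj_appr.
    rewrite !te_interchange by bdry.
    rewrite (te_cobang_bang hs); apply te_unitl.
  + intros c; intuition lia.
Qed.

Ltac unit_entry U :=
  intros c; split; [intros [a [[= <-] [_ h]]]; exact h | intros h; exists U; auto].

Lemma entries_typed P Q t : ttyped t P Q -> entries_ok P Q t.
Proof.
induction 1 as [| U | c U V hc | U V | U | U | U | U
  | s t P Q R hs IHs ht IHt | s t P Q P' Q' hs IHs ht IHt];
  try (intros k l hk hl; simpl in hk, hl; unfold tentry).
- lia.
- destruct k; [|lia]; destruct l; [|lia]; apply entry_id.
  + rewrite te_inj1, te_proj1, !te_idml by reflexivity; reflexivity.
  + unit_entry U.
- destruct k; [|lia]; destruct l; [|lia]; simpl nth.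
  assert (E : te (tcomp (tinj [U] 0) (tcomp (tbox c) (tproj [V] 0))) (tbox c)).
  { rewrite te_inj1, te_proj1.
    destruct (cdom_typed hc).
    rewrite te_idml, te_idmr by (cbn [tdom tcod]; congruence); reflexivity. }
  split.
  + intros d [_ [_ h]]; rewrite E; apply tl_box, h.
  + apply (below_te E), below_in; exists c; trivial.
    splits; apply (cl_refl hc).
- destruct k as [|[|k]]; [| | lia]; destruct l as [|[|l]]; try lia; simpl nth.
  + apply entry_zero.
    * rewrite <- te_assoc, te_inj_swap0; apply (@te_inj_proj_neq [V; U] 1 0); simpl; lia.
    * intros c [a [_ [h _]]]; discriminate h.
  + apply entry_id.
    * rewrite <- te_assoc, te_inj_swap0; apply (@te_inj_proj [V; U] 1); simpl; lia.
    * unit_entry U.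
  + apply entry_id.
    * rewrite <- te_assoc, te_inj_swap1; apply (@te_inj_proj [V; U] 0); simpl; lia.
    * unit_entry V.
  + apply entry_zero.
    * rewrite <- te_assoc, te_inj_swap1; apply (@te_inj_proj_neq [V; U] 0 1); simpl; lia.
    * intros c [a [_ [h _]]]; discriminate h.
- destruct k; [|lia]; destruct l as [|[|l]]; [| | lia]; simpl nth; apply entry_id.
  + rewrite te_diag_proj0, te_inj1, te_idml by reflexivity; reflexivity.
  + unit_entry U.
  + rewrite te_diag_proj1, te_inj1, te_idml by reflexivity; reflexivity.
  + unit_entry U.
- lia.
- destruct l; [|lia]; destruct k as [|[|k]]; [| | lia]; simpl nth; apply entry_id.
  + rewrite <- te_assoc, te_inj0_codiag, te_proj1, te_idml by reflexivity; reflexivity.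
  + unit_entry U.
  + rewrite <- te_assoc, te_inj1_codiag, te_proj1, te_idml by reflexivity; reflexivity.
  + unit_entry U.
- lia.
- exact (entries_comp hs ht IHs IHt hk hl).
- exact (entries_sum hs ht IHs IHt hk hl).
Qed.

(** Expanding the identities on both sides of [s] and then its entries bounds [s] by a finite join
    of boxes placed between a projection and an injection. Each such box belongs to the semantics of
    [t], so it is below an entry of [t], and the surrounding projections and injections compose to
    at most the identity. *)
Lemma tle_complete P Q s t :
  ttyped s P Q -> ttyped t P Q -> rsub (rt s) (rt t) -> tl s t.
Proof.
intros hs ht hst.
apply (below_bound (P := P) (Q := Q) (S := fun x => exists k l c,
  rt s k l c /\ x = tcomp (tproj P k) (tcomp (tbox c) (tinj Q l)))); trivial.
- intros x [k [l [c [hc ->]]]].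
  destruct (is_mat_lt (rt_mat hs) hc) as [hk hl].
  rewrite (proj1 (entries_typed ht hk hl) c (hst _ _ _ hc)).
  transitivity (tcomp (tcomp (tproj P k) (tinj P k)) (tcomp t (tcomp (tproj Q l) (tinj Q l)))).
  { apply tl_te; unfold tentry; rewrite !te_assoc; reflexivity. }
  rewrite (tl_proj_inj hk), (tl_proj_inj hl), te_idl, te_idr by bdry; reflexivity.
- apply below_te with (t := tcomp (tid P) (tcomp s (tid Q))).
  { rewrite te_idl, te_idr by bdry; reflexivity. }
  assert (t1 : ttyped (tcomp s (tid Q)) P Q)
    by (eapply ttyped_comp; [exact hs | apply tid_typed]).
  refine (below_post t1 _ (below_tid P)); intros x [k [hk ->]].
  apply below_te with (t := tcomp (tcomp (tcomp (tproj P k) (tinj P k)) s) (tid Q)).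
  { rewrite !te_assoc; reflexivity. }
  pose proof (tproj_typed hk) as tp; pose proof (tinj_typed hk) as ti.
  assert (t2 : ttyped (tcomp (tcomp (tproj P k) (tinj P k)) s) P Q)
    by (eapply ttyped_comp; [eapply ttyped_comp; eassumption | exact hs]).
  refine (below_pre t2 _ (below_tid Q)); intros x [l [hl ->]].
  pose proof (tproj_typed hl) as tp'; pose proof (tinj_typed hl) as ti'.
  apply below_te with (t := tcomp (tproj P k) (tcomp (tentry P Q s k l) (tinj Q l))).
  { unfold tentry; rewrite !te_assoc; reflexivity. }
  apply (below_pre (P := [nth k P []]) (S := fun x => exists2 c, rt s k l c &
    x = tcomp (tbox c) (tinj Q l))); trivial.
  + intros x [c hc ->]; apply below_in; exists k, l, c; auto.
  + refine (below_post ti' _ (proj2 (entries_typed hs hk hl))).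
    intros x [c hc ->]; apply below_in; exists c; trivial.
Qed.

(** ** Fullness *)

Lemma rt_join P Q s t :
  ttyped s P Q -> ttyped t P Q ->
  requ (rt (tjoin P Q s t)) (fun i j c => rt s i j c \/ rt t i j c).
Proof.
intros hs ht i j c; unfold tjoin.
change (rcomp (rt (tdiagp P)) (rcomp (rt (tsum s t)) (rt (tcodiagp Q))) i j c <->
  (rt s i j c \/ rt t i j c)).
pose proof (rt_mat (ttyped_sum hs ht)) as hst.
rewrite (cofun_pre i j c (cofun_tdiagp P) (is_mat_comp hst (rt_mat (tcodiagp_typed Q)))).
assert (E : forall k, rcomp (rt (tsum s t)) (rt (tcodiagp Q)) k j c <->
  exists l, rdsum (length P) (length Q) (rt s) (rt t) k l c /\ j = fdiag (length Q) l).
{ intros k; rewrite (fun_post k j c hst (isfun_tcodiagp Q)), (rt_sum _ hs); reflexivity. }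
split.
- intros [k [-> h]]; apply E in h; destruct h as [l [[[h1 [h2 h3]]|[h1 [h2 h3]]] ->]];
    unfold fdiag; cases_ltb; auto.
- intros [h|h].
  + destruct (is_mat_lt (rt_mat hs) h); exists i; split.
    * unfold fdiag; cases_ltb; lia.
    * apply E; exists j; split; [left; auto|].
      unfold fdiag; cases_ltb; lia.
  + destruct (is_mat_lt (rt_mat ht) h); exists (length P + i); split.
    * unfold fdiag; cases_ltb; lia.
    * apply E; exists (length Q + j); split.
      -- right; rewrite !(Nat.add_comm (length _) _), !Nat.add_sub.
         split; [lia | split; [lia | exact h]].
      -- unfold fdiag; cases_ltb; lia.
Qed.

Lemma isfun_tcobangp P : isfun [] P (fun i => i) (rt (tcobangp P)).
Proof. apply isfun_nil, rt_mat, tcobangp_typed. Qed.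

Lemma isfun_tinj P k :
  k < length P -> isfun [nth k P []] P (fun _ => k) (rt (tinj P k)).
Proof.
revert k; induction P as [|U P IH]; intros [|k] h; simpl in h; try lia; cbn [tinj nth].
- eapply isfun_ext.
  + apply (isfun_sum (isfun_tidm U) (isfun_tcobangp P) eq_refl eq_refl).
  + intros [|i] hi; simpl in hi; [reflexivity | lia].
- eapply isfun_ext.
  + apply (isfun_sum (isfun_tcobang U) (IH k ltac:(lia)) eq_refl eq_refl).
  + intros i hi; reflexivity.
Qed.

Lemma cofun_tbangp P : isfun [] P (fun i => i) (rtr (rt (tbangp P))).
Proof.
pose proof (rt_mat (tbangp_typed P)) as h; apply isfun_nil, is_mat_intro.
- intros i j c hc; apply (is_mat_lt h) in hc; simpl in hc; lia.
- intros i j; apply (proj2 h).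
Qed.

Lemma cofun_tproj P k :
  k < length P -> isfun [nth k P []] P (fun _ => k) (rtr (rt (tproj P k))).
Proof.
revert k; induction P as [|U P IH]; intros [|k] h; simpl in h; try lia; cbn [tproj nth].
- eapply isfun_ext.
  + apply (cofun_sum (cofun_tidm U) (cofun_tbangp P) eq_refl eq_refl).
  + intros [|i] hi; simpl in hi; [reflexivity | lia].
- eapply isfun_ext.
  + apply (cofun_sum (cofun_tbang U) (IH k ltac:(lia)) eq_refl eq_refl).
  + intros i hi; reflexivity.
Qed.

Definition representable P Q (R : raw) : Prop :=
  exists2 t, ttyped t P Q & requ (rt t) R.

Lemma representable_requ P Q (R S : raw) :
  requ R S -> representable P Q R -> representable P Q S.
Proof. intros h [t ht hR]; exists t; trivial; rewrite hR; exact h. Qed.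

Lemma representable_or P Q (R S : raw) :
  representable P Q R -> representable P Q S ->
  representable P Q (fun i j c => R i j c \/ S i j c).
Proof.
intros [s hs hR] [t ht hS]; exists (tjoin P Q s t); [apply tjoin_typed; assumption|].
rewrite (rt_join hs ht); intros i j c; rewrite (hR i j c), (hS i j c); reflexivity.
Qed.

Lemma representable_empty P Q (R : raw) :
  (forall i j c, ~ R i j c) -> representable P Q R.
Proof.
intros h; exists (tzero P Q); [apply tzero_typed|].
intros i j c; split; [|intros hR; destruct (h _ _ _ hR)].
intros [k [m [n [h1 _]]]]; apply (is_mat_lt (rt_mat (tbangp_typed P))) in h1.
simpl in h1; lia.
Qed.

Lemma representable_single P Q k l d :
  k < length P -> l < length Q -> ctyped d (nth k P []) (nth l Q []) ->
  representable P Q (fun i j c => i = k /\ j = l /\ cl c d).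
Proof.
intros hk hl hd.
pose proof (ttyped_comp (ttyped_box hd) (tinj_typed hl)) as h1.
exists (tcomp (tproj P k) (tcomp (tbox d) (tinj Q l))).
{ eapply ttyped_comp; [apply (tproj_typed hk) | exact h1]. }
intros i j c.
change (rcomp (rt (tproj P k)) (rcomp (rt (tbox d)) (rt (tinj Q l))) i j c <->
  i = k /\ j = l /\ cl c d).
rewrite (cofun_pre i j c (cofun_tproj hk) (rt_mat h1)); split.
- intros [m [-> h]]; apply (fun_post m j c (rt_mat (ttyped_box hd)) (isfun_tinj hl)) in h.
  destruct h as [n [[_ [_ h]] ->]]; auto.
- intros [-> [-> h]]; exists 0; split; trivial.
  apply (fun_post 0 l c (rt_mat (ttyped_box hd)) (isfun_tinj hl)).
  exists 0; split; trivial; split; auto.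
Qed.

Lemma representable_mat P Q (R : raw) : is_mat P Q R -> representable P Q R.
Proof.
intros hR.
(* A single entry, by induction on its generators; each typed generator is realised by a box between
   a projection and an injection, and unions by [tjoin]. *)
assert (H0 : forall k l, representable P Q (fun i j c => i = k /\ j = l /\ R i j c)).
{ intros k l; destruct (proj2 hR k l) as [L hL].
  apply (representable_requ (R := fun i j c =>
    i = k /\ j = l /\ exists2 d, In d L & cl c d)).
  { intros i j c; split; intros [-> [-> h]]; (splits); apply hL, h. }
  assert (hL' : forall c d, In d L -> cl c d -> R k l c) by (intros c d h h'; apply hL; eauto).
  clear hL; induction L as [|d L IH].
  - apply representable_empty; intros i j c [_ [_ [d [] _]]].
  - apply (representable_requ (R := fun i j c => (i = k /\ j = l /\ cl c d) \/
      (i = k /\ j = l /\ exists2 d, In d L & cl c d))).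
    { intros i j c; split.
      - intros [[-> [-> h]]|[-> [-> [e he h]]]]; (splits);
          [exists d | exists e]; simpl; auto.
      - intros [-> [-> [e [<-|he] h]]]; [left | right]; (splits);
          exists e; trivial. }
    apply representable_or.
    (* This asks whether [d] has a type. If not, nothing is below it and the zero tape represents
       its contribution. *)
    + destruct (classic (cl (Th := Th) d d)) as [hd|hd].
      * assert (h : R k l d) by (apply (hL' d d); simpl; auto).
        destruct (is_mat_lt hR h); apply representable_single; trivial.
        apply (is_mat_typed hR h).
      * apply representable_empty; intros i j c [_ [_ h]]; apply hd.
        destruct h as [U [V [_ [td _]]]]; apply (cl_refl td).
    + apply IH; intros c e he; apply hL'; right; exact he. }
(* Unions of entries over the target positions, then over the source positions. Both stop at the
   lengths of the polynomials, beyond which [R] is empty. *)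
assert (H1 : forall n k, representable P Q (fun i j c => i = k /\ j < n /\ R i j c)).
{ intros n k; induction n as [|n IH].
  - apply representable_empty; intros i j c; lia.
  - apply (representable_requ (R := fun i j c => (i = k /\ j = n /\ R i j c) \/
      (i = k /\ j < n /\ R i j c))).
    + intros i j c; assert (j < S n <-> j = n \/ j < n) by lia; tauto.
    + apply representable_or; [apply H0 | apply IH]. }
assert (H2 : forall m, representable P Q (fun i j c => i < m /\ j < length Q /\ R i j c)).
{ intros m; induction m as [|m IH].
  - apply representable_empty; intros i j c; lia.
  - apply (representable_requ (R := fun i j c => (i = m /\ j < length Q /\ R i j c) \/
      (i < m /\ j < length Q /\ R i j c))).
    + intros i j c; assert (i < S m <-> i = m \/ i < m) by lia; tauto.
    + apply representable_or; [apply H1 | apply IH]. }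
refine (representable_requ _ (H2 (length P))).
intros i j c; split; [tauto | intros h; pose proof (is_mat_lt hR h); tauto].
Qed.

Lemma tape_raw_sem : inhabited (raw_sem Th (tape_rig Th)).
Proof.
constructor.
assert (hle : forall (P Q : poly) (f g : thom P Q),
  tle (Th := Th) f g <-> rsub (rt f) (rt g)).
{ intros P Q f g; split; [apply tle_sound|].
  intros h; apply tle_tl, (tle_complete (thom_typed f) (thom_typed g) h). }
apply (@RawSem Th (tape_rig Th) (fun A => A) (fun A => A) (fun A => eq_refl)
  (fun A => eq_refl) (fun P Q (f : thom P Q) => rt f)); try reflexivity.
- intros P Q f; apply rt_mat, thom_typed.
- intros P Q R hR; destruct (representable_mat hR) as [t ht h]; exists (THom ht); exact h.
- exact hle.
- intros P Q f g; split.
  + intros [h1 h2]; apply hle in h1, h2; intros i j c; split; [apply h1 | apply h2].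
  + intros h; split; apply hle; intros i j c; apply h.
- intros P; apply rt_tid.
- intros P Q P' Q' f g; change (requ (rt (tsum f g))
    (rdsum (length P) (length Q) (rt f) (rt g))).
  rewrite (rt_sum _ (thom_typed f)); reflexivity.
- intros P Q P' Q' f g; apply rt_prod.
- exact isfun_tbraid.
- exact rt_tpbraid.
- exact cofun_tdiagp.
- exact isfun_tcodiagp.
- exact isfun_tdistl.
Qed.

End TapeSemantics.

Theorem theorem6p9 (Th : theory) :
  poset_fbrig_axioms (tape_rig Th) /\
  poset_fbrig_axioms (mat (down (pos_monoidal (circ_monoidal Th)))) /\
  inhabited
    (fbrig_iso (tape_rig Th) (mat (down (pos_monoidal (circ_monoidal Th))))).
Proof.
destruct (tape_raw_sem Th) as [s], (mat_raw_sem Th) as [t].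
split; [exact (raw_sem_fbrig s) | split; [exact (raw_sem_fbrig t) | exact (raw_sem_iso s t)]].
Qed.
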